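(* Let $(\alpha_0,\beta_0),(\alpha_1,\beta_1)\in\mathbb{R}^2\setminus\{(0,0)\}$, let $T>0$ and $R>R_0:=e^{(2e)^{-1}}$. Let $\psi_T\in H(D(0,R))$. Then there exist two control functions $h_0,h_1\in G^2([0,T])$ such that the solution $\psi$ of $$\psi_t-\psi_{xx}=0,\ x\in(-1,1),\ t\in(0,T),$$ $$\alpha_0\psi(-1,t)+\beta_0\psi_x(-1,t)=h_0(t),\quad \alpha_1\psi(1,t)+\beta_1\psi_x(1,t)=h_1(t),\ t\in(0,T),$$ $$\psi(x,0)=0,\ x\in(-1,1),$$ belongs to $G^{1,2}([-1,1]\times[0,T])$ and satisfies $\psi(x,T)=\psi_T(x)$ for all $x\in[-1,1]$.
   Context: $H(D(0,R))$ is the set of holomorphic functions on the open disk $D(0,R)=\{z\in\mathbb{C};|z|<R\}$. Functions $h_0,h_1,\psi$ may be complex-valued. $G^s([t_1,t_2])$ is the set of $y\in C^\infty([t_1,t_2])$ for which there are $C,\rho>0$ with $|y^{(p)}(t)|\le C\,p!^s/\rho^p$ for all $p\in\mathbb{N}$, $t\in[t_1,t_2]$. $G^{s_1,s_2}([x_1,x_2]\times[t_1,t_2])$ is the set of $\theta\in C^\infty([x_1,x_2]\times[t_1,t_2])$ for which there are $C,R_1,R_2>0$ with $|\partial_x^{p_1}\partial_t^{p_2}\theta(x,t)|\le C\frac{(p_1!)^{s_1}(p_2!)^{s_2}}{R_1^{p_1}R_2^{p_2}}$ for all $p_1,p_2\in\mathbb{N}$ and all $(x,t)\in[x_1,x_2]\times[t_1,t_2]$.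 *)

(* Defs.v *)
From Stdlib Require Import Reals Factorial.
From Coquelicot Require Import Coquelicot.

Open Scope R_scope.

Definition holomorphic_on_disk (r : R) (f : C -> C) : Prop :=
  forall z : C, Cmod z < r -> @ex_derive C_AbsRing C_NormedModule f z.

Definition segment (a b x : R) : Prop := a <= x <= b.

Definition rectangle (x1 x2 t1 t2 : R) (z : R * R) : Prop :=
  segment x1 x2 (fst z) /\ segment t1 t2 (snd z).

(* Functions on [a,b] or on a rectangle are represented by total functions,
   whose values outside the domain are irrelevant.  [is_derive_within D f x l]
   only tests increments that stay in D: on D = [a,b] with a < b it is the usual
   derivative at interior points and the one-sided one at a and b. *)
Definition is_derive_within (D : R -> Prop) (f : R -> C) (x : R) (l : C) : Prop :=
  @filterdiff R_AbsRing R_NormedModule C_R_NormedModule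
    f (within D (locally x)) (fun h : R => @scal R_AbsRing C_R_NormedModule h l).

(* y is C^infinity on [a,b], with p-th derivative d p there. *)
Definition derivatives_on (a b : R) (y : R -> C) (d : nat -> R -> C) : Prop :=
  (forall t, segment a b t -> d 0%nat t = y t) /\
  (forall p t, segment a b t ->
     is_derive_within (segment a b) (d p) t (d (S p) t)).

(* theta is C^infinity on the rectangle, with d_x^p d_t^q theta = d p q there. *)
Definition partial_derivatives_on (x1 x2 t1 t2 : R) (theta : R -> R -> C)
    (d : nat -> nat -> R -> R -> C) : Prop :=
  (forall x t, rectangle x1 x2 t1 t2 (x, t) -> d 0%nat 0%nat x t = theta x t) /\
  (forall p q x t, rectangle x1 x2 t1 t2 (x, t) ->
     is_derive_within (segment x1 x2) (fun x' => d p q x' t) x (d (S p) q x t) /\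
     is_derive_within (segment t1 t2) (fun t' => d p q x t') t (d p (S q) x t)) /\
  (forall p q,
     continuous_on (rectangle x1 x2 t1 t2)
       (fun z : R * R => d p q (fst z) (snd z) : C_UniformSpace)).

Definition fact_pow (p : nat) (s : R) : R := Rpower (INR (fact p)) s.

Definition Gevrey (s t1 t2 : R) (y : R -> C) : Prop :=
  exists d : nat -> R -> C, derivatives_on t1 t2 y d /\
  exists M rho : R, 0 < M /\ 0 < rho /\
  forall p t, segment t1 t2 t -> Cmod (d p t) <= M * (fact_pow p s / rho ^ p).

Definition Gevrey2 (s1 s2 x1 x2 t1 t2 : R) (theta : R -> R -> C) : Prop :=
  exists d : nat -> nat -> R -> R -> C,
  partial_derivatives_on x1 x2 t1 t2 theta d /\
  exists M R1 R2 : R, 0 < M /\ 0 < R1 /\ 0 < R2 /\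
  forall p1 p2 x t, rectangle x1 x2 t1 t2 (x, t) ->
    Cmod (d p1 p2 x t) <=
      M * (fact_pow p1 s1 * fact_pow p2 s2 / (R1 ^ p1 * R2 ^ p2)).

(* Classical solutions: continuous on the closed rectangle, with psi_x defined
   up to x = -1 and x = 1 so that the boundary conditions make sense. *)
Definition heat_solution (alpha0 beta0 alpha1 beta1 T : R) (h0 h1 : R -> C)
    (psi : R -> R -> C) : Prop :=
  continuous_on (rectangle (-1) 1 0 T)
    (fun z : R * R => psi (fst z) (snd z) : C_UniformSpace) /\
  exists psi_x psi_xx psi_t : R -> R -> C,
  (forall x t, segment (-1) 1 x -> 0 < t < T ->
     is_derive_within (segment (-1) 1) (fun x' => psi x' t) x (psi_x x t)) /\
  (forall x t, -1 < x < 1 -> 0 < t < T ->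
     @is_derive R_AbsRing C_R_NormedModule (fun x' => psi_x x' t) x (psi_xx x t) /\
     @is_derive R_AbsRing C_R_NormedModule (fun t' => psi x t') t (psi_t x t) /\
     (psi_t x t - psi_xx x t = 0)%C) /\
  (forall t, 0 < t < T ->
     (alpha0 * psi (-1)%R t + beta0 * psi_x (-1)%R t = h0 t)%C /\
     (alpha1 * psi 1%R t + beta1 * psi_x 1%R t = h1 t)%C) /\
  (forall x, -1 < x < 1 -> psi x 0 = 0%C).

(* Main.v *)
Require Import Defs.
From Stdlib Require Import Reals Lra Lia FunctionalExtensionality Factorial ClassicalEpsilon.
From Coquelicot Require Import Coquelicot.

(* Only [r > 1] matters. On the square with vertices [a i^k], [1 < a < r], Cauchy's formula expresses
   [psiT] through [1 / (zeta - x)], and each edge admits a slope [om] with [Re (om^2) > 0] and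
   [1 / (zeta - x) = int_0^oo om e^{- om s (zeta - x)} ds] uniformly in [x] in [-1, 1]. Replacing
   [e^{om s x}] by [e^{om s x - om^2 s^2 (T - t)}] gives a solution of the heat equation for [t <= T]
   equal to [psiT] at time [T]; differentiating [p] times in [x] and [q] times in [t] brings down
   [(om s)^(p + 2 q)], whence bounds of order [(p + 2 q)!] up to [t = T], while for [t <= T / 2] the
   Gaussian factor makes the solution entire. Cutting off the flat outputs [psi(0, .)] and
   [psi_x(0, .)] by a Gevrey function supported in [t <= T / 2] yields a second solution, with the same
   data at [t = 0] and vanishing for large [t]; the difference of the two is the required solution.
   Uniqueness is the maximum principle. *)

(** * Complex-valued calculus on the real line *)

(** The symmetric slope [1 - i] would give [Re (om zeta) = a] on the whole side from [a] to [a i],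
    but its square is imaginary and the Gaussian factor would not decay. Tilting it to [1 - i kappa]
    makes the real part of the square [1 - kappa^2] and only lowers the bound on that side to
    [kappa a], which still exceeds [|Re (om x)| <= 1] when [1 / a < kappa < 1]. Such a [kappa]
    exists exactly when [a > 1]. The cutoff cannot act up to time [T]: there the [m]-th space
    derivatives are only known to be of size [m! d^m], and a power series rebuilt from data at
    [x = 0] need not converge on [[-1, 1]] when [d >= 1]. Before [T / 2] this rate is as small as
    desired, and so is that of the cutoff; both are chosen so that the rebuilt series converges,
    while the target at time [T] stays untouched. The Gevrey orders 1 and 2 come from
    [(p + 2 q)! <= 2^(p + 2 q) 4^q p! q!^2]. *)

Lemma C_eq (z w : C) : Re z = Re w -> Im z = Im w -> z = w.
Proof. destruct z, w; simpl; intros; subst; reflexivity. Qed.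

Lemma Im_le_Cmod (z : C) : Rabs (Im z) <= Cmod z.
Proof.
  apply Rle_trans with (2 := Rmax_Cmod z). apply Rmax_r.
Qed.

Lemma Cmod_le_Re_Im (z : C) : Cmod z <= Rabs (Re z) + Rabs (Im z).
Proof.
  unfold Cmod. apply Rsqr_incr_0_var.
  - rewrite Rsqr_sqrt by nra. unfold Rsqr.
    assert (H1 := Rsqr_abs (Re z)). assert (H2 := Rsqr_abs (Im z)). unfold Rsqr, Re, Im in *.
    assert (0 <= Rabs (fst z)) by apply Rabs_pos. assert (0 <= Rabs (snd z)) by apply Rabs_pos.
    nra.
  - generalize (Rabs_pos (Re z)) (Rabs_pos (Im z)); lra.
Qed.

Lemma Cmod_minus_le (z w : C) : Cmod (z - w) <= Cmod z + Cmod w.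
Proof. unfold Cminus. rewrite <- (Cmod_opp w). apply Cmod_triangle. Qed.

Lemma Cmod_minus_sym (z w : C) : Cmod (z - w) = Cmod (w - z).
Proof. rewrite <- Cmod_opp. f_equal. ring. Qed.

(** Complex functions of a real variable are handled by components, so that real continuity,
    derivatives and integrals apply directly. The derivatives of the statement are recovered at the
    end from second-order bounds on increments. *)
Definition Ccontp (f : R -> C) (x : R) : Prop :=
  continuous (fun u => Re (f u)) x /\ continuous (fun u => Im (f u)) x.

Definition Ccont_on (f : R -> C) (a b : R) : Prop := forall x, a <= x <= b -> Ccontp f x.

Definition Cder (f : R -> C) (x : R) (l : C) : Prop :=
  is_derive (fun u => Re (f u)) x (Re l) /\ is_derive (fun u => Im (f u)) x (Im l).

Lemma Cder_cont f x l : Cder f x l -> Ccontp f x.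
Proof.
  intros [H1 H2]; split; apply (ex_derive_continuous (V := R_NormedModule)); eexists; eassumption.
Qed.

Lemma Ccontp_const c x : Ccontp (fun _ => c) x.
Proof. split; apply continuous_const. Qed.

Lemma Ccontp_plus f g x : Ccontp f x -> Ccontp g x -> Ccontp (fun u => f u + g u)%C x.
Proof.
  intros [H1 H2] [H3 H4]; split; simpl.
  - apply (continuous_plus (fun u => Re (f u)) (fun u => Re (g u))); assumption.
  - apply (continuous_plus (fun u => Im (f u)) (fun u => Im (g u))); assumption.
Qed.

Lemma Ccontp_opp f x : Ccontp f x -> Ccontp (fun u => - f u)%C x.
Proof.
  intros [H1 H2]; split; simpl.
  - apply (continuous_opp (fun u => Re (f u))); assumption.
  - apply (continuous_opp (fun u => Im (f u))); assumption.
Qed.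

Lemma Ccontp_minus f g x : Ccontp f x -> Ccontp g x -> Ccontp (fun u => f u - g u)%C x.
Proof. intros Hf Hg. apply (Ccontp_plus f (fun u => - g u)%C); [assumption | now apply Ccontp_opp]. Qed.

Lemma Ccontp_mult f g x : Ccontp f x -> Ccontp g x -> Ccontp (fun u => f u * g u)%C x.
Proof.
  intros [H1 H2] [H3 H4]; split; simpl.
  - apply (continuous_minus (fun u => Re (f u) * Re (g u)) (fun u => Im (f u) * Im (g u)));
    apply (continuous_mult (K := R_AbsRing)); assumption.
  - apply (continuous_plus (fun u => Re (f u) * Im (g u)) (fun u => Im (f u) * Re (g u)));
    apply (continuous_mult (K := R_AbsRing)); assumption.
Qed.

Lemma Ccontp_inv (f : R -> C) x : f x <> 0%C -> Ccontp f x -> Ccontp (fun u => / f u)%C x.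
Proof.
  intros H0 [H1 H2].
  set (N := fun u => Re (f u) * Re (f u) + Im (f u) * Im (f u)).
  assert (Hd : N x <> 0).
  { intros E. apply H0. unfold N in E. apply C_eq; simpl; nra. }
  assert (HN : continuous N x).
  { apply (continuous_plus (fun u => Re (f u) * Re (f u)) (fun u => Im (f u) * Im (f u)));
    apply (continuous_mult (K := R_AbsRing)); assumption. }
  assert (Hc : continuous (fun u => / (Re (f u) ^ 2 + Im (f u) ^ 2)) x).
  { apply (continuous_ext (fun u => / N u)).
    - intros u; unfold N; f_equal; ring.
    - apply (continuous_comp N Rinv); [exact HN | now apply continuous_Rinv]. }
  split; unfold Cinv; simpl.
  - apply (continuous_mult (K := R_AbsRing)); assumption.
  - apply (continuous_mult (K := R_AbsRing)); [ | assumption].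
    apply (continuous_opp (fun u => Im (f u))); assumption.
Qed.

Lemma Cder_const c x : Cder (fun _ => c) x 0.
Proof. split; simpl; apply (is_derive_const (K := R_AbsRing) (V := R_NormedModule)). Qed.

Lemma Cder_plus f g x lf lg : Cder f x lf -> Cder g x lg -> Cder (fun u => f u + g u)%C x (lf + lg)%C.
Proof.
  intros [H1 H2] [H3 H4]; split; simpl.
  - apply (is_derive_plus (fun u => Re (f u)) (fun u => Re (g u))); assumption.
  - apply (is_derive_plus (fun u => Im (f u)) (fun u => Im (g u))); assumption.
Qed.

Lemma Cder_mult f g x lf lg : Cder f x lf -> Cder g x lg ->
  Cder (fun u => f u * g u)%C x (lf * g x + f x * lg)%C.
Proof.
  intros [H1 H2] [H3 H4].
  assert (M : forall p q lp lq, is_derive p x lp -> is_derive q x lq ->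
     is_derive (fun u => p u * q u) x (lp * q x + p x * lq)).
  { intros p q lp' lq Hp Hq. apply (is_derive_mult p q x lp' lq Hp Hq). intros; apply Rmult_comm. }
  split; simpl.
  - replace (_ + _) with ((Re lf * Re (g x) + Re (f x) * Re lg) - (Im lf * Im (g x) + Im (f x) * Im lg))
      by (unfold Re, Im; simpl; ring).
    apply (is_derive_minus (fun u => Re (f u) * Re (g u)) (fun u => Im (f u) * Im (g u)));
    apply M; assumption.
  - replace (_ + _) with ((Re lf * Im (g x) + Re (f x) * Im lg) + (Im lf * Re (g x) + Im (f x) * Re lg))
      by (unfold Re, Im; simpl; ring).
    apply (is_derive_plus (fun u => Re (f u) * Im (g u)) (fun u => Im (f u) * Re (g u)));
    apply M; assumption.
Qed.

Lemma Cder_eq f x l l' : Cder f x l -> l = l' -> Cder f x l'.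
Proof. intros H E; now rewrite <- E. Qed.

Lemma Cder_RtoC f x l : is_derive f x l -> Cder (fun u => RtoC (f u)) x (RtoC l).
Proof. intros H; split; simpl; [exact H | apply (is_derive_const (K := R_AbsRing) (V := R_NormedModule))]. Qed.

Lemma Cder_id x : Cder (fun u => RtoC u) x 1.
Proof. apply Cder_RtoC. apply (is_derive_id (K := R_AbsRing)). Qed.

Lemma Cder_scal c f x l : Cder f x l -> Cder (fun u => c * f u)%C x (c * l)%C.
Proof.
  intros H. apply Cder_eq with (0 * f x + c * l)%C; [ | ring].
  apply (Cder_mult (fun _ => c)); [apply Cder_const | exact H].
Qed.

Lemma Cder_minus f g x lf lg : Cder f x lf -> Cder g x lg -> Cder (fun u => f u - g u)%C x (lf - lg)%C.
Proof.
  intros [H1 H2] [H3 H4]; split; simpl.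
  - apply (is_derive_minus (fun u => Re (f u)) (fun u => Re (g u))); assumption.
  - apply (is_derive_minus (fun u => Im (f u)) (fun u => Im (g u))); assumption.
Qed.

(** * The complex exponential *)

Lemma exp_le x y : x <= y -> exp x <= exp y.
Proof. intros [H|H]; [left; now apply exp_increasing | rewrite H; lra]. Qed.

Definition cexp (z : C) : C := (exp (Re z) * cos (Im z), exp (Re z) * sin (Im z)).

Lemma Cmod_cexp z : Cmod (cexp z) = exp (Re z).
Proof.
  unfold Cmod, cexp; simpl.
  replace (_ + _) with (exp (Re z) ^ 2).
  - rewrite sqrt_pow2; auto. left; apply exp_pos.
  - generalize (sin2_cos2 (Im z)); unfold Rsqr; intros H.
    transitivity (exp (Re z) ^ 2 * (sin (Im z) * sin (Im z) + cos (Im z) * cos (Im z))); [rewrite H|]; ring.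
Qed.

Lemma cexp_plus z w : cexp (z + w) = (cexp z * cexp w)%C.
Proof.
  apply C_eq; unfold cexp, Re, Im; simpl; rewrite exp_plus.
  - rewrite cos_plus; ring.
  - rewrite sin_plus; ring.
Qed.

Lemma cexp_0 : cexp 0 = 1%C.
Proof. apply C_eq; unfold cexp, Re, Im; simpl; rewrite exp_0, ?cos_0, ?sin_0; lra. Qed.

Lemma Cder_cexp u x l : Cder u x l -> Cder (fun y => cexp (u y)) x (l * cexp (u x))%C.
Proof.
  assert (A : forall (p q : R -> R) (l1 l2 : R), is_derive p x l1 -> is_derive q x l2 ->
    is_derive (fun y => exp (p y) * cos (q y)) x (l1 * (exp (p x) * cos (q x)) - l2 * (exp (p x) * sin (q x))) /\
    is_derive (fun y => exp (p y) * sin (q y)) x (l1 * (exp (p x) * sin (q x)) + l2 * (exp (p x) * cos (q x)))).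
  { intros p q l1 l2 H1 H2.
    assert (E1 := is_derive_unique _ _ _ H1). assert (E2 := is_derive_unique _ _ _ H2).
    split; auto_derive.
    1, 3: repeat split; eexists; eassumption.
    all: change (Derive (fun x => p x) x) with (Derive p x); change (Derive (fun x => q x) x) with (Derive q x);
      rewrite E1, E2; ring. }
  intros [H1 H2]. destruct (A _ _ _ _ H1 H2) as [B1 B2]. now split.
Qed.

Lemma Ccontp_cexp u x : Ccontp u x -> Ccontp (fun y => cexp (u y)) x.
Proof.
  intros [H1 H2].
  assert (He : continuous (fun y => exp (Re (u y))) x).
  { apply (continuous_comp (fun y => Re (u y)) exp); [assumption | apply continuous_exp]. }
  split; unfold cexp; simpl; apply (continuous_mult (K := R_AbsRing)); try assumption.
  - apply (continuous_comp (fun y => Im (u y)) cos); [assumption | apply continuous_cos].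
  - apply (continuous_comp (fun y => Im (u y)) sin); [assumption | apply continuous_sin].
Qed.

Lemma Ccontp_pow f x n : Ccontp f x -> Ccontp (fun u => f u ^ n)%C x.
Proof.
  intros H; induction n as [|n IH]; simpl.
  - apply Ccontp_const.
  - now apply Ccontp_mult.
Qed.

Create HintDb ccont.
Ltac ccont := repeat match goal with
  | |- Ccontp (fun _ => ?c) _ => apply Ccontp_const
  | |- Ccontp (fun u => (_ - _)%C) _ => apply Ccontp_minus
  | |- Ccontp (fun u => (_ + _)%C) _ => apply Ccontp_plus
  | |- Ccontp (fun u => (- _)%C) _ => apply Ccontp_opp
  | |- Ccontp (fun u => (_ * _)%C) _ => apply Ccontp_mult
  | |- Ccontp (fun u => cexp _) _ => apply Ccontp_cexp
  end; auto with ccont.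

(** * Integrals of complex-valued functions *)

Definition CInt (f : R -> C) (a b : R) : C :=
  (RInt (fun u => Re (f u)) a b, RInt (fun u => Im (f u)) a b).

Lemma Ccont_on_ex_RInt f a b : a <= b -> Ccont_on f a b ->
  ex_RInt (fun u => Re (f u)) a b /\ ex_RInt (fun u => Im (f u)) a b.
Proof.
  intros Hab H; split; apply (ex_RInt_continuous (V := R_CompleteNormedModule));
  rewrite Rmin_left, Rmax_right by assumption; intros z Hz; apply (H z Hz).
Qed.

Lemma CInt_ext f g a b : a <= b -> (forall u, a <= u <= b -> f u = g u) -> CInt f a b = CInt g a b.
Proof.
  intros Hab H; unfold CInt; f_equal; apply RInt_ext; rewrite Rmin_left, Rmax_right by assumption;
  intros x Hx; rewrite H; auto; lra.
Qed.

Lemma CInt_plus f g a b : a <= b -> Ccont_on f a b -> Ccont_on g a b ->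
  CInt (fun u => f u + g u)%C a b = (CInt f a b + CInt g a b)%C.
Proof.
  intros Hab Hf Hg.
  destruct (Ccont_on_ex_RInt f a b) as [F1 F2]; auto.
  destruct (Ccont_on_ex_RInt g a b) as [G1 G2]; auto.
  apply C_eq; simpl.
  - apply (RInt_plus (fun u => Re (f u)) (fun u => Re (g u))); assumption.
  - apply (RInt_plus (fun u => Im (f u)) (fun u => Im (g u))); assumption.
Qed.

Lemma CInt_scal c f a b : a <= b -> Ccont_on f a b ->
  CInt (fun u => c * f u)%C a b = (c * CInt f a b)%C.
Proof.
  intros Hab Hf.
  destruct (Ccont_on_ex_RInt f a b) as [F1 F2]; auto.
  assert (S : forall k g, ex_RInt g a b -> ex_RInt (fun u => k * g u) a b)
    by (intros; now apply (ex_RInt_scal (V := R_NormedModule))).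
  assert (S' : forall k g, ex_RInt g a b -> RInt (fun u => k * g u) a b = k * RInt g a b)
    by (intros; now apply (RInt_scal (V := R_CompleteNormedModule))).
  apply C_eq; simpl.
  - transitivity (RInt (fun u => Re c * Re (f u)) a b - RInt (fun u => Im c * Im (f u)) a b).
    + apply (RInt_minus
        (fun u => Re c * Re (f u)) (fun u => Im c * Im (f u))); now apply S.
    + rewrite !S' by assumption. reflexivity.
  - transitivity (RInt (fun u => Re c * Im (f u)) a b + RInt (fun u => Im c * Re (f u)) a b).
    + apply (RInt_plus
        (fun u => Re c * Im (f u)) (fun u => Im c * Re (f u))); now apply S.
    + rewrite !S' by assumption. reflexivity.
Qed.

Lemma CInt_minus f g a b : a <= b -> Ccont_on f a b -> Ccont_on g a b ->
  CInt (fun u => f u - g u)%C a b = (CInt f a b - CInt g a b)%C.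
Proof.
  intros Hab Hf Hg. rewrite (CInt_ext _ (fun u => f u + - 1 * g u)%C a b Hab) by (intros; ring).
  assert (Hg' : Ccont_on (fun u => - 1 * g u)%C a b) by (intros u Hu; ccont).
  rewrite (CInt_plus f _ a b Hab Hf Hg'), CInt_scal by assumption. ring.
Qed.

Lemma CInt_Chasles f a b c : a <= b -> b <= c -> Ccont_on f a c ->
  (CInt f a b + CInt f b c)%C = CInt f a c.
Proof.
  intros Hab Hbc Hf.
  assert (H1 : Ccont_on f a b) by (intros x Hx; apply Hf; lra).
  assert (H2 : Ccont_on f b c) by (intros x Hx; apply Hf; lra).
  apply Ccont_on_ex_RInt in H1; auto. apply Ccont_on_ex_RInt in H2; auto.
  apply C_eq; simpl.
  - apply (RInt_Chasles (fun u => Re (f u))); tauto.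
  - apply (RInt_Chasles (fun u => Im (f u))); tauto.
Qed.

(** The factor 2 is the price of bounding the real and the imaginary integrals separately; only the
    order of magnitude is used. *)
Lemma CInt_bound_fun f g a b : a <= b -> Ccont_on f a b -> ex_RInt g a b ->
  (forall u, a <= u <= b -> Cmod (f u) <= g u) -> Cmod (CInt f a b) <= 2 * RInt g a b.
Proof.
  intros Hab Hf Hg H.
  destruct (Ccont_on_ex_RInt f a b) as [F1 F2]; auto.
  assert (A : forall h, ex_RInt h a b -> (forall u, a <= u <= b -> Rabs (h u) <= g u) ->
     Rabs (RInt h a b) <= RInt g a b).
  { intros h Hh B. eapply Rle_trans; [apply abs_RInt_le; assumption | ].
    apply RInt_le; auto.
    - apply (ex_RInt_norm (h)); assumption.
    - intros; apply B; lra. }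
  eapply Rle_trans; [apply Cmod_le_Re_Im | ]. simpl.
  assert (Rabs (RInt (fun u => Re (f u)) a b) <= RInt g a b).
  { apply A; auto. intros u Hu. eapply Rle_trans; [apply re_le_Cmod | auto]. }
  assert (Rabs (RInt (fun u => Im (f u)) a b) <= RInt g a b).
  { apply A; auto. intros u Hu. eapply Rle_trans; [apply Im_le_Cmod | auto]. }
  lra.
Qed.

Lemma CInt_bound f M a b : a <= b -> Ccont_on f a b ->
  (forall u, a <= u <= b -> Cmod (f u) <= M) -> Cmod (CInt f a b) <= 2 * M * (b - a).
Proof.
  intros Hab Hf H.
  replace (2 * M * (b - a)) with (2 * RInt (fun _ => M) a b).
  - apply CInt_bound_fun; auto. apply (ex_RInt_const).
  - rewrite (RInt_const). unfold scal; simpl; unfold mult; simpl. ring.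
Qed.

Lemma CInt_derive F f a b : a <= b -> (forall u, a <= u <= b -> Cder F u (f u)) -> Ccont_on f a b ->
  CInt f a b = (F b - F a)%C.
Proof.
  intros Hab HF Hf.
  apply C_eq; simpl; apply is_RInt_unique.
  - apply (is_RInt_derive (fun u => Re (F u)) (fun u => Re (f u)));
    rewrite Rmin_left, Rmax_right by assumption; intros x Hx; [apply (HF x Hx) | apply (Hf x Hx)].
  - apply (is_RInt_derive (fun u => Im (F u)) (fun u => Im (f u)));
    rewrite Rmin_left, Rmax_right by assumption; intros x Hx; [apply (HF x Hx) | apply (Hf x Hx)].
Qed.

Lemma Ccont_on_bounded f a b : a <= b -> Ccont_on f a b ->
  exists M, 0 < M /\ forall u, a <= u <= b -> Cmod (f u) <= M.
Proof.
  intros Hab Hf.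
  assert (B : forall g : R -> R, (forall x, a <= x <= b -> continuous g x) ->
     exists M, forall u, a <= u <= b -> Rabs (g u) <= M).
  { intros g Hg.
    destruct (continuity_ab_maj g a b Hab) as [M1 [H1 _]].
    { intros c Hc. apply continuity_pt_filterlim. apply Hg; auto. }
    destruct (continuity_ab_min g a b Hab) as [M2 [H2 _]].
    { intros c Hc. apply continuity_pt_filterlim. apply Hg; auto. }
    exists (Rabs (g M1) + Rabs (g M2)). intros u Hu.
    specialize (H1 u Hu); specialize (H2 u Hu).
    unfold Rabs; repeat destruct Rcase_abs; lra. }
  destruct (B (fun u => Re (f u))) as [M1 H1]; [intros; now apply Hf | ].
  destruct (B (fun u => Im (f u))) as [M2 H2]; [intros; now apply Hf | ].
  exists (M1 + M2 + 1). split.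
  - specialize (H1 a (conj (Rle_refl a) Hab)). specialize (H2 a (conj (Rle_refl a) Hab)).
    generalize (Rabs_pos (Re (f a))) (Rabs_pos (Im (f a))); lra.
  - intros u Hu. specialize (H1 u Hu); specialize (H2 u Hu).
    generalize (Cmod_le_Re_Im (f u)); lra.
Qed.

(** * Goursat's theorem and Cauchy's formula on a square *)

Lemma nested_limit (u v : nat -> R) :
  (forall n, u n <= u (S n)) -> (forall n, v (S n) <= v n) -> (forall n, u n <= v n) ->
  exists l, forall n, u n <= l <= v n.
Proof.
  intros Hu Hv Huv.
  assert (Mu : forall n m, (n <= m)%nat -> u n <= u m).
  { intros n m H; induction H; [lra | eapply Rle_trans; eauto]. }
  assert (Mv : forall n m, (n <= m)%nat -> v m <= v n).
  { intros n m H; induction H; [lra | eapply Rle_trans; eauto]. }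
  assert (C : forall n m, u n <= v m).
  { intros n m. apply Rle_trans with (u (Nat.max n m)); [apply Mu; lia | ].
    apply Rle_trans with (v (Nat.max n m)); [auto | apply Mv; lia]. }
  destruct (completeness (fun x => exists n, x = u n)) as [l [H1 H2]].
  - exists (v 0%nat). intros x [n ->]. apply C.
  - exists (u 0%nat), 0%nat; reflexivity.
  - exists l; intros n; split.
    + apply H1; exists n; reflexivity.
    + apply H2. intros x [m ->]. apply C.
Qed.

Definition subinterval (a b x y : R) : Prop := a <= x /\ x <= y /\ y <= b.

(** Bisection with an arbitrary property inherited by one quadrant: it serves both for Goursat's
    theorem and for the existence of a maximum. *)
Lemma rectangle_bisection (B : R -> R -> R -> R -> Prop) (a1 a2 b1 b2 : R) :
  a1 <= a2 -> b1 <= b2 -> B a1 a2 b1 b2 ->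
  (forall x1 x2 y1 y2, subinterval a1 a2 x1 x2 -> subinterval b1 b2 y1 y2 -> B x1 x2 y1 y2 ->
     let m := (x1 + x2) / 2 in let n := (y1 + y2) / 2 in
     B x1 m y1 n \/ B m x2 y1 n \/ B x1 m n y2 \/ B m x2 n y2) ->
  exists p q, a1 <= p <= a2 /\ b1 <= q <= b2 /\ forall delta, 0 < delta ->
    exists x1 x2 y1 y2, subinterval a1 a2 x1 x2 /\ subinterval b1 b2 y1 y2 /\
      x1 <= p <= x2 /\ y1 <= q <= y2 /\ x2 - x1 < delta /\ y2 - y1 < delta /\ B x1 x2 y1 y2.
Proof.
  intros Ha Hb HB Hstep.
  pose (V := fun r : (R * R) * (R * R) => subinterval a1 a2 (fst (fst r)) (snd (fst r)) /\
     subinterval b1 b2 (fst (snd r)) (snd (snd r)) /\ B (fst (fst r)) (snd (fst r)) (fst (snd r)) (snd (snd r))).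
  pose (W := fun r r' : (R * R) * (R * R) => V r' /\
     subinterval (fst (fst r)) (snd (fst r)) (fst (fst r')) (snd (fst r')) /\
     subinterval (fst (snd r)) (snd (snd r)) (fst (snd r')) (snd (snd r')) /\
     snd (fst r') - fst (fst r') = (snd (fst r) - fst (fst r)) / 2 /\
     snd (snd r') - fst (snd r') = (snd (snd r) - fst (snd r)) / 2).
  (* Where [V] fails the rectangle is kept unchanged, which makes [step] a total function. *)
  assert (HW : forall r, exists r', V r -> W r r').
  { intros r. destruct (excluded_middle_informative (V r)) as [Hr|Hr]; [ | exists r; tauto].
    destruct r as [[x1 x2] [y1 y2]]. destruct Hr as [Vx [Vy VB]]; simpl in *.
    unfold W, V, subinterval in *; simpl.
    destruct (Hstep x1 x2 y1 y2 Vx Vy VB) as [H|[H|[H|H]]].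
    - exists ((x1, (x1 + x2) / 2), (y1, (y1 + y2) / 2)); simpl; intros _; repeat split; try exact H; lra.
    - exists (((x1 + x2) / 2, x2), (y1, (y1 + y2) / 2)); simpl; intros _; repeat split; try exact H; lra.
    - exists ((x1, (x1 + x2) / 2), ((y1 + y2) / 2, y2)); simpl; intros _; repeat split; try exact H; lra.
    - exists (((x1 + x2) / 2, x2), ((y1 + y2) / 2, y2)); simpl; intros _; repeat split; try exact H; lra. }
  pose (step := fun r => proj1_sig (constructive_indefinite_description _ (HW r))).
  assert (Hs : forall r, V r -> W r (step r)).
  { intros r. unfold step. apply (proj2_sig (constructive_indefinite_description _ (HW r))). }
  pose (r := fix r (n : nat) := match n with O => ((a1, a2), (b1, b2)) | S k => step (r k) end).
  assert (VR : forall n, V (r n)).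
  { induction n as [|n IH]; [unfold V, subinterval; simpl; repeat split; try lra; exact HB | ]. apply (Hs _ IH). }
  assert (ST : forall n, W (r n) (r (S n))) by (intros n; apply Hs, VR).
  destruct (nested_limit (fun n => fst (fst (r n))) (fun n => snd (fst (r n)))) as [p Hp].
  { intros n; apply (ST n). } { intros n; apply (ST n). } { intros n; apply (VR n). }
  destruct (nested_limit (fun n => fst (snd (r n))) (fun n => snd (snd (r n)))) as [q Hq].
  { intros n; apply (ST n). } { intros n; apply (ST n). } { intros n; apply (VR n). }
  exists p, q. split; [apply (Hp 0%nat) | ]. split; [apply (Hq 0%nat) | ]. intros delta Hd.
  assert (Wd : forall n, snd (fst (r n)) - fst (fst (r n)) = (a2 - a1) * (/2) ^ n /\
     snd (snd (r n)) - fst (snd (r n)) = (b2 - b1) * (/2) ^ n).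
  { induction n as [|n [I1 I2]]; [simpl; lra | ].
    destruct (ST n) as [_ [_ [_ [D1 D2]]]]. rewrite D1, D2, I1, I2. simpl pow. split; field. }
  destruct (pow_lt_1_zero (/2)) with (y := delta / (a2 - a1 + (b2 - b1) + 1)) as [N HN].
  { rewrite Rabs_right; lra. } { apply Rdiv_lt_0_compat; lra. }
  specialize (HN N (le_n N)).
  assert (Hpos : 0 < (/2) ^ N) by (apply pow_lt; lra).
  rewrite Rabs_right in HN by lra.
  apply Rmult_lt_compat_r with (r := a2 - a1 + (b2 - b1) + 1) in HN; [ | lra].
  replace (delta / (a2 - a1 + (b2 - b1) + 1) * (a2 - a1 + (b2 - b1) + 1)) with delta in HN by (field; lra).
  destruct (Wd N) as [W1 W2].
  exists (fst (fst (r N))), (snd (fst (r N))), (fst (snd (r N))), (snd (snd (r N))).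
  destruct (VR N) as [V1 [V2 V3]].
  split; [exact V1 | ]. split; [exact V2 | ]. split; [apply Hp | ]. split; [apply Hq | ].
  rewrite W1, W2. split; [nra | ]. split; [nra | exact V3].
Qed.

(* Goursat's bisection argument. *)
Lemma additive_rectangle_zero (E : R -> R -> R -> R -> C) (a1 a2 b1 b2 : R) :
  a1 <= a2 -> b1 <= b2 ->
  (forall x1 m x2 y1 y2, subinterval a1 a2 x1 x2 -> subinterval b1 b2 y1 y2 -> x1 <= m <= x2 ->
     E x1 x2 y1 y2 = (E x1 m y1 y2 + E m x2 y1 y2)%C) ->
  (forall x1 x2 y1 m y2, subinterval a1 a2 x1 x2 -> subinterval b1 b2 y1 y2 -> y1 <= m <= y2 ->
     E x1 x2 y1 y2 = (E x1 x2 y1 m + E x1 x2 m y2)%C) ->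
  (forall p q eps, a1 <= p <= a2 -> b1 <= q <= b2 -> 0 < eps ->
     exists delta, 0 < delta /\ forall x1 x2 y1 y2, subinterval a1 a2 x1 x2 -> subinterval b1 b2 y1 y2 ->
       x1 <= p <= x2 -> y1 <= q <= y2 -> x2 - x1 < delta -> y2 - y1 < delta ->
       Cmod (E x1 x2 y1 y2) <= eps * (x2 - x1 + (y2 - y1)) ^ 2) ->
  E a1 a2 b1 b2 = 0%C.
Proof.
  intros Ha Hb Ax Ay Hloc.
  set (s := a2 - a1 + (b2 - b1)).
  set (e0 := Cmod (E a1 a2 b1 b2)).
  (* [l] is the half-perimeter relative to that of the initial rectangle: halving both sides divides
     [l ^ 2] by 4, and some quadrant retains at least a quarter of the modulus of [E]. *)
  pose (B := fun x1 x2 y1 y2 => exists l, 0 < l /\ x2 - x1 + (y2 - y1) = l * s /\ e0 * l ^ 2 <= Cmod (E x1 x2 y1 y2)).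
  destruct (rectangle_bisection B a1 a2 b1 b2 Ha Hb) as [p [q [Hp [Hq H]]]].
  - exists 1. unfold s, e0. split; [lra | split; lra].
  - intros x1 x2 y1 y2 Sx Sy [l [Hl [Hs HE]]] m n.
    assert (Hm : x1 <= m <= x2) by (unfold m, subinterval in *; lra).
    assert (Hn : y1 <= n <= y2) by (unfold n, subinterval in *; lra).
    assert (T : Cmod (E x1 x2 y1 y2) <= Cmod (E x1 m y1 n) + Cmod (E m x2 y1 n) + Cmod (E x1 m n y2) + Cmod (E m x2 n y2)).
    { rewrite (Ay x1 x2 y1 n y2), (Ax x1 m x2 y1 n), (Ax x1 m x2 n y2) by (unfold subinterval in *; lra).
      generalize (Cmod_triangle (E x1 m y1 n + E m x2 y1 n) (E x1 m n y2 + E m x2 n y2)),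
        (Cmod_triangle (E x1 m y1 n) (E m x2 y1 n)), (Cmod_triangle (E x1 m n y2) (E m x2 n y2)). lra. }
    assert (C : forall x y u v, y - x = (x2 - x1) / 2 -> v - u = (y2 - y1) / 2 ->
      Cmod (E x1 x2 y1 y2) / 4 <= Cmod (E x y u v) -> B x y u v).
    { intros x y u v E1 E2 E3. exists (l / 2). split; [lra | ]. rewrite E1, E2. split; [lra | ].
      replace (e0 * (l / 2) ^ 2) with (e0 * l ^ 2 / 4) by field. lra. }
    destruct (Rle_dec (Cmod (E x1 x2 y1 y2) / 4) (Cmod (E x1 m y1 n))) as [L1|L1];
      [left; apply C; auto; unfold m, n; field | ].
    destruct (Rle_dec (Cmod (E x1 x2 y1 y2) / 4) (Cmod (E m x2 y1 n))) as [L2|L2];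
      [right; left; apply C; auto; unfold m, n; field | ].
    destruct (Rle_dec (Cmod (E x1 x2 y1 y2) / 4) (Cmod (E x1 m n y2))) as [L3|L3];
      [right; right; left; apply C; auto; unfold m, n; field | ].
    right; right; right. apply C; [unfold m; field | unfold n; field | lra].
  - apply Cmod_eq_0. apply Rle_antisym; [ | apply Cmod_ge_0]. apply le_epsilon. intros eps Heps.
    assert (Hs2 : 0 <= s ^ 2) by apply pow2_ge_0.
    (* Dividing by [s ^ 2 + 1] instead of [s ^ 2] allows a rectangle reduced to a point. *)
    destruct (Hloc p q (eps / (s ^ 2 + 1)) Hp Hq) as [delta [Hd Hsmall]]; [apply Rdiv_lt_0_compat; lra | ].
    destruct (H delta Hd) as [x1 [x2 [y1 [y2 [Sx [Sy [Px [Py [Dx [Dy [l [Hl [Es HE]]]]]]]]]]]]].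
    assert (Q := Hsmall x1 x2 y1 y2 Sx Sy Px Py Dx Dy). rewrite Es in Q.
    assert (Hl2 : 0 < l ^ 2) by (apply pow_lt; lra).
    apply Rmult_le_reg_r with (l ^ 2); [exact Hl2 | ]. rewrite Rplus_0_l.
    apply Rle_trans with (1 := HE). apply Rle_trans with (1 := Q).
    rewrite Rpow_mult_distr. replace (eps / (s ^ 2 + 1) * (l ^ 2 * s ^ 2)) with (eps * (s ^ 2 / (s ^ 2 + 1)) * l ^ 2) by (field; lra).
    apply Rmult_le_compat_r; [lra | ]. rewrite <- (Rmult_1_r eps) at 2. apply Rmult_le_compat_l; [lra | ].
    apply Rmult_le_reg_r with (s ^ 2 + 1); [lra | ]. unfold Rdiv. rewrite Rmult_assoc, Rinv_l by lra. lra.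
Qed.

Lemma holomorphic_eps r f z : holomorphic_on_disk r f -> Cmod z < r ->
  exists l : C, forall eps, 0 < eps -> exists delta, 0 < delta /\
    forall z', Cmod (z' - z) < delta -> Cmod (f z' - f z - l * (z' - z))%C <= eps * Cmod (z' - z).
Proof.
  intros Hf Hz. destruct (Hf z Hz) as [l [_ Hl]]. exists l. intros eps Heps.
  specialize (Hl z (fun P HP => HP) (mkposreal eps Heps)). destruct Hl as [d Hd].
  exists d; split; [apply cond_pos | ]. intros z' Hz'.
  specialize (Hd z' Hz').
  change (Cmod ((f z' - f z) - ((z' - z) * l))%C <= eps * Cmod (z' - z)) in Hd.
  rewrite (Cmult_comm l). exact Hd.
Qed.

Lemma Ccontp_eps (g : R -> C) x : (forall eps, 0 < eps -> exists delta, 0 < delta /\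
    forall u, Rabs (u - x) < delta -> Cmod (g u - g x) < eps) <-> Ccontp g x.
Proof.
  split.
  - intros H; split; apply continuity_pt_filterlim; intros eps Heps;
    destruct (H eps Heps) as [d [Hd Hu]]; exists d; (split; [exact Hd | ]);
    intros u [_ Hux]; simpl; unfold Rdist in *; eapply Rle_lt_trans; try apply (Hu u Hux).
    + apply (re_le_Cmod (g u - g x)).
    + apply (Im_le_Cmod (g u - g x)).
  - intros [H1 H2] eps Heps.
    apply continuity_pt_filterlim in H1. apply continuity_pt_filterlim in H2.
    destruct (H1 (eps / 2)) as [d1 [P1 Q1]]; [lra | ].
    destruct (H2 (eps / 2)) as [d2 [P2 Q2]]; [lra | ].
    exists (Rmin d1 d2); split; [now apply Rmin_pos | ].
    intros u Hu. destruct (Req_dec u x) as [->|Hne].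
    + unfold Cminus. rewrite Cplus_opp_r, Cmod_0. exact Heps.
    + assert (N : D_x no_cond x u) by (split; [exact I | auto]).
      assert (D1 := Q1 u (conj N (Rlt_le_trans _ _ _ Hu (Rmin_l _ _)))).
      assert (D2 := Q2 u (conj N (Rlt_le_trans _ _ _ Hu (Rmin_r _ _)))).
      simpl in D1, D2; unfold Rdist in D1, D2.
      eapply Rle_lt_trans; [apply Cmod_le_Re_Im | ].
      change (Rabs (Re (g u) - Re (g x)) + Rabs (Im (g u) - Im (g x)) < eps). lra.
Qed.

Lemma holomorphic_cont r f z : holomorphic_on_disk r f -> Cmod z < r ->
  forall eps, 0 < eps -> exists delta, 0 < delta /\ forall z', Cmod (z' - z) < delta -> Cmod (f z' - f z) < eps.
Proof.
  intros Hf Hz eps Heps. destruct (holomorphic_eps r f z Hf Hz) as [l Hl].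
  destruct (Hl 1 Rlt_0_1) as [d [Hd H]].
  assert (Hm := Cmod_ge_0 l).
  exists (Rmin d (eps / (Cmod l + 1))). split.
  - apply Rmin_pos; [exact Hd | apply Rdiv_lt_0_compat; lra].
  - intros z' Hz'. assert (H1 := H z' (Rlt_le_trans _ _ _ Hz' (Rmin_l _ _))).
    assert (H2 := Rlt_le_trans _ _ _ Hz' (Rmin_r _ _)).
    replace (f z' - f z)%C with ((f z' - f z - l * (z' - z)) + l * (z' - z))%C by ring.
    eapply Rle_lt_trans; [apply Cmod_triangle | ]. rewrite Cmod_mult.
    apply Rmult_lt_compat_r with (r := Cmod l + 1) in H2; [ | lra].
    replace (eps / (Cmod l + 1) * (Cmod l + 1)) with eps in H2 by (field; lra). lra.
Qed.

Lemma holomorphic_comp_cont r f g x : holomorphic_on_disk r f -> Ccontp g x -> Cmod (g x) < r ->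
  Ccontp (fun u => f (g u)) x.
Proof.
  intros Hf Hg Hr. apply Ccontp_eps. intros eps Heps.
  destruct (holomorphic_cont r f _ Hf Hr eps Heps) as [d [Hd H]].
  destruct (proj2 (Ccontp_eps g x) Hg d Hd) as [d' [Hd' H']].
  exists d'; split; auto.
Qed.

(** * Sides of the square and cones over them *)

Definition edge (a u : R) : C := (a * (1 - u), a * u).
Definition edge_dir (a : R) : C := (- a, a).

Lemma edge_minus a u v : (edge a u - edge a v = RtoC (u - v) * edge_dir a)%C.
Proof. apply C_eq; simpl; ring. Qed.

Lemma Cder_edge a u : Cder (edge a) u (edge_dir a).
Proof. split; unfold edge, edge_dir; simpl; auto_derive; auto; ring. Qed.

Lemma Ccontp_edge a u : Ccontp (edge a) u.
Proof. eapply Cder_cont, Cder_edge. Qed.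

#[global] Hint Resolve Ccontp_edge : ccont.

Lemma Cmod_edge a u : 0 < a -> 0 <= u <= 1 -> Cmod (edge a u) <= a.
Proof.
  intros Ha Hu. eapply Rle_trans; [apply Cmod_le_Re_Im | ]. simpl.
  rewrite !Rabs_right; nra.
Qed.

Lemma Cmod_edge_dir a : 0 < a -> Cmod (edge_dir a) <= 2 * a.
Proof.
  intros Ha. eapply Rle_trans; [apply Cmod_le_Re_Im | ]. simpl.
  rewrite Rabs_left, Rabs_right; lra.
Qed.

Lemma edge_neq a u w : Re w + Im w < a -> (edge a u - w <> 0)%C.
Proof.
  intros H E. assert (E1 := f_equal Re E). assert (E2 := f_equal Im E).
  unfold Re, Im in *; simpl in *. lra.
Qed.

Lemma edge_sub_cont a w u : Ccontp (fun v => edge a v - w)%C u.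
Proof. apply Ccontp_minus; [apply Ccontp_edge | apply Ccontp_const]. Qed.

(** The coefficient of [dz / (z - w)] pulled back to the side from [a] to [a i] by the
    parametrisation [edge]. *)
Definition edge_form (a : R) (w : C) (u : R) : C := (edge_dir a * / (edge a u - w))%C.

Lemma edge_form_cont a w u : Re w + Im w < a -> Ccontp (edge_form a w) u.
Proof.
  intros H. apply (Ccontp_mult (fun _ => edge_dir a)); [apply Ccontp_const | ].
  apply (Ccontp_inv (fun v => edge a v - w)%C); [now apply edge_neq | apply edge_sub_cont].
Qed.

(** Joins [w], at [l = 0], to the side, at [l = 1]. In these coordinates [dz / (z - w)] becomes
    [dl / l + edge_form a w u du], with separated variables. *)
Definition cone (a : R) (w : C) (l u : R) : C := (w + RtoC l * (edge a u - w))%C.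

Lemma cone_cont_l a w u l : Ccontp (fun l => cone a w l u) l.
Proof.
  apply Ccontp_plus; [apply Ccontp_const | ]. apply Ccontp_mult; [eapply Cder_cont, Cder_id | apply Ccontp_const].
Qed.

Lemma cone_cont_u a w u l : Ccontp (fun u => cone a w l u) u.
Proof.
  apply Ccontp_plus; [apply Ccontp_const | ]. apply Ccontp_mult; [apply Ccontp_const | apply edge_sub_cont].
Qed.

Lemma cone_in_disk a r w l u : 0 < a < r -> Cmod w < r -> 0 <= l <= 1 -> 0 <= u <= 1 -> Cmod (cone a w l u) < r.
Proof.
  intros Ha Hw Hl Hu.
  replace (cone a w l u) with (RtoC (1 - l) * w + RtoC l * edge a u)%C by (apply C_eq; simpl; ring).
  eapply Rle_lt_trans; [apply Cmod_triangle | ]. rewrite !Cmod_mult, !Cmod_R.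
  rewrite !Rabs_right by lra. assert (H := Cmod_edge a u (proj1 Ha) Hu).
  assert (0 <= Cmod w) by apply Cmod_ge_0.
  destruct (Req_dec l 1) as [->|]; nra.
Qed.

Lemma Ccontp_Rinv l : l <> 0 -> Ccontp (fun x => RtoC (/ x)) l.
Proof. intros H. split; simpl; [now apply continuous_Rinv | apply continuous_const]. Qed.

Lemma CInt_const c a b : a <= b -> CInt (fun _ => c) a b = (RtoC (b - a) * c)%C.
Proof.
  intros H. rewrite (CInt_derive (fun u => RtoC u * c)%C); auto.
  - apply C_eq; simpl; ring.
  - intros u _. eapply Cder_eq; [apply Cder_mult; [apply Cder_id | apply Cder_const] | cbv beta; ring].
  - intros u _; apply Ccontp_const.
Qed.

(* Stokes on the image of the rectangle for the closed form f(z) dz / (z - w), pulled back by the cone. *)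
Lemma cone_goursat (f : C -> C) (r a : R) (w : C) (l1 l2 : R) :
  holomorphic_on_disk r f -> 0 < a < r -> Cmod w < r -> Re w + Im w < a -> 0 < l1 <= l2 -> l2 <= 1 ->
  (CInt (fun u => (f (cone a w l2 u) - f (cone a w l1 u)) * edge_form a w u)%C 0 1 =
   CInt (fun l => (f (cone a w l 1) - f (cone a w l 0)) * RtoC (/ l))%C l1 l2)%C.
Proof.
  intros Hf Ha Hw Hwa Hl1 Hl2.
  pose (E1 := fun l l' u v => CInt (fun u => (f (cone a w l' u) - f (cone a w l u)) * edge_form a w u)%C u v).
  pose (E2 := fun l l' u v => CInt (fun l => (f (cone a w l v) - f (cone a w l u)) * RtoC (/ l))%C l l').
  enough (H : (E1 l1 l2 0 1 - E2 l1 l2 0 1 = 0)%C).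
  { apply (proj2 (Ceq_minus _ _)). exact H. }
  assert (Cu : forall l u, l1 <= l <= l2 -> 0 <= u <= 1 -> Ccontp (fun u => f (cone a w l u)) u).
  { intros l u Hl Hu. apply (holomorphic_comp_cont r f _ _ Hf); [apply cone_cont_u | ].
    apply cone_in_disk; auto; lra. }
  assert (Cl : forall l u, l1 <= l <= l2 -> 0 <= u <= 1 -> Ccontp (fun l => f (cone a w l u)) l).
  { intros l u Hl Hu. apply (holomorphic_comp_cont r f (fun l => cone a w l u) _ Hf); [apply cone_cont_l | ].
    apply cone_in_disk; auto; lra. }
  assert (K1 : forall l l' u, l1 <= l <= l2 -> l1 <= l' <= l2 -> 0 <= u <= 1 ->
    Ccontp (fun u => (f (cone a w l' u) - f (cone a w l u)) * edge_form a w u)%C u).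
  { intros. apply Ccontp_mult; [apply Ccontp_minus; auto | now apply edge_form_cont]. }
  assert (K2 : forall l u v, l1 <= l <= l2 -> 0 <= u <= 1 -> 0 <= v <= 1 ->
    Ccontp (fun l => (f (cone a w l v) - f (cone a w l u)) * RtoC (/ l))%C l).
  { intros. apply Ccontp_mult; [apply Ccontp_minus; auto | apply Ccontp_Rinv; lra]. }
  apply (additive_rectangle_zero (fun l l' u v => E1 l l' u v - E2 l l' u v)%C); [lra | lra | | | ].
  - intros x1 m x2 y1 y2 [A1 [A2 A3]] [B1 [B2 B3]] Hm.
    assert (H1 : E1 x1 x2 y1 y2 = (E1 x1 m y1 y2 + E1 m x2 y1 y2)%C).
    { unfold E1. rewrite <- CInt_plus; [ | lra | intros u Hu; apply K1; lra | intros u Hu; apply K1; lra].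
      apply CInt_ext; [lra | intros; ring]. }
    assert (H2 : E2 x1 x2 y1 y2 = (E2 x1 m y1 y2 + E2 m x2 y1 y2)%C).
    { unfold E2. symmetry; apply CInt_Chasles; [lra | lra | intros u Hu; apply K2; lra]. }
    rewrite H1, H2; ring.
  - intros x1 x2 y1 m y2 [A1 [A2 A3]] [B1 [B2 B3]] Hm.
    assert (H1 : E1 x1 x2 y1 y2 = (E1 x1 x2 y1 m + E1 x1 x2 m y2)%C).
    { unfold E1. symmetry; apply CInt_Chasles; [lra | lra | intros u Hu; apply K1; lra]. }
    assert (H2 : E2 x1 x2 y1 y2 = (E2 x1 x2 y1 m + E2 x1 x2 m y2)%C).
    { unfold E2. rewrite <- CInt_plus; [ | lra | intros u Hu; apply K2; lra | intros u Hu; apply K2; lra].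
      apply CInt_ext; [lra | intros; ring]. }
    rewrite H1, H2; ring.
  - intros p q eps Hp Hq Heps.
    destruct (Ccont_on_bounded (edge_form a w) 0 1) as [M [HM HMb]]; [lra | intros u _; now apply edge_form_cont | ].
    (* A Lipschitz constant of [cone]: [a + |w|] bounds [edge a u - w], the derivative in [l], and
       [2 a] bounds [edge_dir a], which governs the derivative in [u]. *)
    set (K := a + Cmod w + 2 * a). assert (HK : 0 < K) by (unfold K; generalize (Cmod_ge_0 w); lra).
    assert (Hi : 0 < / l1) by (apply Rinv_0_lt_compat; lra).
    destruct (holomorphic_eps r f (cone a w p q) Hf) as [B HB]; [apply cone_in_disk; auto; lra | ].
    (* The two integrals of the remainder will be at most [4 e K M s ^ 2] and [4 e K s ^ 2 / l1],
       with sum [eps s ^ 2]. *)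
    set (e := eps / (4 * K * (M + / l1))).
    assert (He : 0 < e) by (apply Rdiv_lt_0_compat; [lra | apply Rmult_lt_0_compat; lra]).
    destruct (HB e He) as [d [Hd Hrho]].
    exists (d / (2 * K)); split; [apply Rdiv_lt_0_compat; lra | ].
    intros x1 x2 y1 y2 [A1 [A2 A3]] [B1 [B2 B3]] Hx Hy Hdx Hdy.
    set (s := x2 - x1 + (y2 - y1)).
    pose (rho := fun z => (f z - f (cone a w p q) - B * (z - cone a w p q))%C).
    assert (Hs : forall l u, x1 <= l <= x2 -> y1 <= u <= y2 -> Cmod (rho (cone a w l u)) <= e * (K * s)).
    { intros l u Hl Hu.
      assert (D : Cmod (cone a w l u - cone a w p q) <= K * s).
      { replace (cone a w l u - cone a w p q)%C
          with (RtoC (l - p) * (edge a u - w) + RtoC p * (edge a u - edge a q))%C by (apply C_eq; simpl; ring).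
        eapply Rle_trans; [apply Cmod_triangle | ]. rewrite edge_minus, !Cmod_mult, !Cmod_R.
        assert (T1 : Rabs (l - p) <= x2 - x1) by (apply Rabs_le; lra).
        assert (T2 : Rabs (u - q) <= y2 - y1) by (apply Rabs_le; lra).
        assert (T3 : Rabs p <= 1) by (apply Rabs_le; lra).
        assert (T4 := Cmod_edge_dir a (proj1 Ha)).
        assert (T5 : Cmod (edge a u - w) <= a + Cmod w).
        { eapply Rle_trans; [apply Cmod_minus_le | ]. generalize (Cmod_edge a u (proj1 Ha)); intros Q.
          assert (0 <= u <= 1) by lra. specialize (Q H). lra. }
        assert (P1 : Rabs (l - p) * Cmod (edge a u - w) <= (x2 - x1) * (a + Cmod w)).
        { apply Rmult_le_compat; auto using Rabs_pos, Cmod_ge_0. }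
        assert (P2 : Rabs p * (Rabs (u - q) * Cmod (edge_dir a)) <= 1 * ((y2 - y1) * (2 * a))).
        { apply Rmult_le_compat; auto using Rabs_pos.
          - apply Rmult_le_pos; auto using Rabs_pos, Cmod_ge_0.
          - apply Rmult_le_compat; auto using Rabs_pos, Cmod_ge_0. }
        assert (0 <= Cmod w) by apply Cmod_ge_0.
        unfold K, s. nra. }
      eapply Rle_trans; [apply Hrho | ].
      - eapply Rle_lt_trans; [exact D | ].
        apply Rlt_le_trans with (K * (d / (2 * K) + d / (2 * K))); [ | right; field; lra].
        apply Rmult_lt_compat_l; unfold s; lra.
      - apply Rmult_le_compat_l; lra. }
    assert (Cr1 : forall l u, x1 <= l <= x2 -> y1 <= u <= y2 -> Ccontp (fun u => rho (cone a w l u)) u).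
    { intros l u Hl Hu. unfold rho. apply Ccontp_minus; [apply Ccontp_minus | ].
      - apply Cu; lra. - apply Ccontp_const. - ccont. apply cone_cont_u. }
    assert (Cr2 : forall l u, x1 <= l <= x2 -> y1 <= u <= y2 -> Ccontp (fun l => rho (cone a w l u)) l).
    { intros l u Hl Hu. unfold rho. apply Ccontp_minus; [apply Ccontp_minus | ].
      - apply Cl; lra. - apply Ccontp_const. - ccont. apply cone_cont_l. }
    pose (J1 := CInt (fun u => (rho (cone a w x2 u) - rho (cone a w x1 u)) * edge_form a w u)%C y1 y2).
    pose (J2 := CInt (fun l => (rho (cone a w l y2) - rho (cone a w l y1)) * RtoC (/ l))%C x1 x2).
    (* The constant term of the expansion of [f] at the limit point drops out of the differences,
       and the linear term contributes the same product [(x2 - x1) (y2 - y1) B edge_dir] to both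
       integrals: only the remainder [rho] survives in [E1 - E2]. *)
    assert (G1 : E1 x1 x2 y1 y2 = (J1 + RtoC (y2 - y1) * (B * RtoC (x2 - x1) * edge_dir a))%C).
    { unfold E1, J1. rewrite <- CInt_const by lra. rewrite <- CInt_plus.
      - apply CInt_ext; [lra | ]. intros u Hu. unfold rho, edge_form, cone.
        rewrite RtoC_minus. field. now apply edge_neq.
      - lra.
      - intros u Hu. apply Ccontp_mult; [apply Ccontp_minus; apply Cr1; lra | now apply edge_form_cont].
      - intros u Hu; apply Ccontp_const. }
    assert (G2 : E2 x1 x2 y1 y2 = (J2 + RtoC (x2 - x1) * (B * RtoC (y2 - y1) * edge_dir a))%C).
    { unfold E2, J2. rewrite <- CInt_const by lra. rewrite <- CInt_plus.
      - apply CInt_ext; [lra | ]. intros l Hl. unfold rho.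
        assert (Q : (cone a w l y2 - cone a w l y1 = RtoC l * (RtoC (y2 - y1) * edge_dir a))%C)
          by (rewrite <- edge_minus; unfold cone; ring).
        replace (cone a w l y2) with (cone a w l y1 + RtoC l * (RtoC (y2 - y1) * edge_dir a))%C at 3
          by (rewrite <- Q; ring).
        rewrite RtoC_inv by lra. field. intros Z. apply RtoC_inj in Z. lra.
      - lra.
      - intros l Hl. apply Ccontp_mult; [apply Ccontp_minus; apply Cr2; lra | apply Ccontp_Rinv; lra].
      - intros u Hu; apply Ccontp_const. }
    rewrite G1, G2.
    replace (J1 + RtoC (y2 - y1) * (B * RtoC (x2 - x1) * edge_dir a) -
       (J2 + RtoC (x2 - x1) * (B * RtoC (y2 - y1) * edge_dir a)))%C with (J1 - J2)%C by ring.
    eapply Rle_trans; [apply Cmod_minus_le | ].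
    assert (Hs0 : 0 <= s) by (unfold s; lra).
    assert (HeKs : 0 <= e * (K * s)) by (apply Rmult_le_pos; [lra | apply Rmult_le_pos; lra]).
    assert (L1 : Cmod J1 <= 2 * (2 * (e * (K * s)) * M) * (y2 - y1)).
    { apply CInt_bound; [lra | | ].
      - intros u Hu. apply Ccontp_mult; [apply Ccontp_minus; apply Cr1; lra | now apply edge_form_cont].
      - intros u Hu. rewrite Cmod_mult. apply Rmult_le_compat; auto using Cmod_ge_0.
        + eapply Rle_trans; [apply Cmod_minus_le | ].
          assert (Q1 : Cmod (rho (cone a w x2 u)) <= e * (K * s)) by (apply Hs; lra).
          assert (Q2 : Cmod (rho (cone a w x1 u)) <= e * (K * s)) by (apply Hs; lra). lra.
        + apply HMb; lra. }
    assert (L2 : Cmod J2 <= 2 * (2 * (e * (K * s)) * / l1) * (x2 - x1)).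
    { apply CInt_bound; [lra | | ].
      - intros l Hl. apply Ccontp_mult; [apply Ccontp_minus; apply Cr2; lra | apply Ccontp_Rinv; lra].
      - intros l Hl. rewrite Cmod_mult. apply Rmult_le_compat; auto using Cmod_ge_0.
        + eapply Rle_trans; [apply Cmod_minus_le | ].
          assert (Q1 : Cmod (rho (cone a w l y2)) <= e * (K * s)) by (apply Hs; lra).
          assert (Q2 : Cmod (rho (cone a w l y1)) <= e * (K * s)) by (apply Hs; lra). lra.
        + rewrite Cmod_R, Rabs_right by (left; apply Rinv_0_lt_compat; lra).
          apply Rinv_le_contravar; lra. }
    assert (L : forall c h, 0 <= c -> h <= s -> 2 * (2 * (e * (K * s)) * c) * h <= 4 * (e * (K * s)) * c * s).
    { intros c h Hc Hh. replace (2 * (2 * (e * (K * s)) * c) * h) with (4 * (e * (K * s)) * c * h) by ring.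
      apply Rmult_le_compat_l; [apply Rmult_le_pos; lra | exact Hh]. }
    assert (L3 := L M (y2 - y1) ltac:(lra) ltac:(unfold s; lra)).
    assert (L4 := L (/ l1) (x2 - x1) ltac:(lra) ltac:(unfold s; lra)).
    apply Rle_trans with (4 * (e * (K * s)) * M * s + 4 * (e * (K * s)) * / l1 * s); [lra | ].
    replace (4 * (e * (K * s)) * M * s + 4 * (e * (K * s)) * / l1 * s) with (e * (4 * K * (M + / l1)) * s ^ 2) by ring.
    right. f_equal. unfold e. field. split; [lra | split; [ | lra]].
    assert (0 < M * l1) by (apply Rmult_lt_0_compat; lra). lra.
Qed.

(** * Rotation of a side, winding number and Cauchy's formula *)

Lemma holomorphic_rot r f (c : C) : Cmod c = 1 -> holomorphic_on_disk r f ->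
  holomorphic_on_disk r (fun z => f (c * z)%C).
Proof.
  intros Hc Hf z Hz.
  apply (ex_derive_comp f (fun z : C_AbsRing => (c * z)%C : C_AbsRing)).
  - apply Hf. rewrite Cmod_mult, Hc. lra.
  - exists c. apply (is_derive_ext (V := AbsRing_NormedModule C_AbsRing)
      (fun z : C_AbsRing => scal z c)).
    + intros t; apply Cmult_comm.
    + assert (H := is_derive_scal_l (V := AbsRing_NormedModule C_AbsRing)
        (fun z => z) z one c (is_derive_id z)).
      change (scal one c) with (1 * c)%C in H. rewrite Cmult_1_l in H. exact H.
Qed.

(** These are the powers [i ^ k] for [k <= 3]. The default value beyond lets bounds be stated for
    all [k]; [sum4] reads only the first four. *)
Definition quad (k : nat) : C :=
  match k with O => (1, 0) | 1%nat => (0, 1) | 2%nat => (-1, 0) | _ => (0, -1) end.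

Definition sum4 (g : nat -> C) : C := (g 0%nat + g 1%nat + g 2%nat + g 3%nat)%C.

Lemma Cmod_quad k : Cmod (quad k) = 1.
Proof.
  destruct k as [|[|[|k]]]; unfold Cmod; simpl; (transitivity (sqrt 1); [f_equal; ring | apply sqrt_1]).
Qed.

Lemma quad_conj k : (quad k * Cconj (quad k) = 1)%C.
Proof. destruct k as [|[|[|k]]]; apply C_eq; simpl; ring. Qed.

(** The position of [x] once the [k]-th side has been rotated back onto the one from [a] to
    [a i]. *)
Definition edge_center (k : nat) (x : R) : C := (Cconj (quad k) * RtoC x)%C.

Lemma edge_center_lt a k x : - a < x < a -> Re (edge_center k x) + Im (edge_center k x) < a.
Proof. destruct k as [|[|[|k]]]; unfold Re, Im; simpl; lra. Qed.

Lemma Cmod_edge_center k x : Cmod (edge_center k x) = Rabs x.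
Proof. unfold edge_center. rewrite Cmod_mult, Cmod_conj, Cmod_quad, Cmod_R. ring. Qed.

Lemma quad_cone a k x l u : (quad k * cone a (edge_center k x) l u =
  RtoC x + RtoC l * (quad k * edge a u - RtoC x))%C.
Proof.
  unfold cone, edge_center.
  replace (quad k * (Cconj (quad k) * x + l * (edge a u - Cconj (quad k) * x)))%C
    with ((quad k * Cconj (quad k)) * x + l * (quad k * edge a u - (quad k * Cconj (quad k)) * x))%C by ring.
  rewrite quad_conj. ring.
Qed.

(** A branch of the logarithm of [edge a u - w] up to a constant:
    [e + i v = (1 - i) (edge a u - w)], and [e > 0] makes [atan (v / e)] its argument. *)
Lemma edge_form_antiderivative a w u : Re w + Im w < a ->
  let e := a - Re w - Im w in
  let v := fun u => 2 * a * u - a + Re w - Im w in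
  Cder (fun u => (/ 2 * ln (e ^ 2 + v u ^ 2), atan (v u / e)) : C) u (edge_form a w u).
Proof.
  intros H e v. assert (He : 0 < e) by (unfold e; lra).
  assert (Hp : 0 < e ^ 2 + v u ^ 2) by nra.
  assert (Hx : edge_form a w u = (2 * a * v u / (e ^ 2 + v u ^ 2), 2 * a * e / (e ^ 2 + v u ^ 2))).
  { destruct w as [p q]. unfold edge_form, edge, edge_dir, Re, Im in *; simpl in *.
    assert (D : (a * (1 - u) - p) ^ 2 + (a * u - q) ^ 2 = (e ^ 2 + v u ^ 2) / 2) by (unfold e, v; field).
    assert (D' : (a * (1 - u) + - p) ^ 2 + (a * u + - q) ^ 2 <> 0) by (unfold Rminus in D; lra).
    unfold Cinv, Cminus, Cplus, Copp, Cmult; simpl. unfold Rminus in *. simpl in D'.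
    apply injective_projections; simpl.
    - replace (e * (e * 1) + v u * (v u * 1)) with
       (2 * ((a * (1 + - u) + - p) ^ 2 + (a * u + - q) ^ 2)) by (rewrite D; simpl; field).
      unfold v. field. exact D'.
    - replace (e * (e * 1) + v u * (v u * 1)) with
       (2 * ((a * (1 + - u) + - p) ^ 2 + (a * u + - q) ^ 2)) by (rewrite D; simpl; field).
      unfold e. field. exact D'. }
  rewrite Hx. split; simpl; unfold v in *; auto_derive.
  - simpl in Hp; lra.
  - field. simpl in *. lra.
  - lra.
  - field. simpl in Hp |- *. split; [lra|]. unfold Rsqr. intros Z. lra.
Qed.

Lemma CInt_edge_form a w : Re w + Im w < a ->
  let e := a - Re w - Im w in
  let v0 := - a + Re w - Im w in let v1 := a + Re w - Im w in
  CInt (edge_form a w) 0 1 =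
    (/ 2 * ln (e ^ 2 + v1 ^ 2) - / 2 * ln (e ^ 2 + v0 ^ 2), atan (v1 / e) - atan (v0 / e)) :> C.
Proof.
  intros H e v0 v1.
  rewrite (CInt_derive _ _ 0 1 ltac:(lra) (fun u _ => edge_form_antiderivative a w u H)).
  - cbv beta zeta. fold e.
    replace (2 * a * 1 - a + Re w - Im w) with v1 by (unfold v1; ring).
    replace (2 * a * 0 - a + Re w - Im w) with v0 by (unfold v0; ring).
    reflexivity.
  - intros u _; now apply edge_form_cont.
Qed.

(** The logarithms of the moduli telescope around the square, and the angles under which [x] sees
    the four sides add up to [2 PI] by [atan y + atan (1 / y) = PI / 2] for [y > 0]. *)
Lemma winding_number a x : - a < x < a ->
  sum4 (fun k => CInt (edge_form a (edge_center k x)) 0 1) = (0, 2 * PI).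
Proof.
  intros Hx. unfold sum4.
  rewrite !CInt_edge_form by now apply edge_center_lt.
  assert (A1 : forall d, d <> 0 -> atan (d / d) = PI / 4).
  { intros d Hd. unfold Rdiv at 1. rewrite Rinv_r by assumption. apply atan_1. }
  assert (A2 : forall d, d <> 0 -> atan (- d / d) = - (PI / 4)).
  { intros d Hd. replace (- d / d) with (- (d / d)) by (field; auto). now rewrite atan_opp, A1. }
  assert (A3 : atan ((a - x) / (a + x)) = PI / 2 - atan ((a + x) / (a - x))).
  { rewrite <- atan_inv.
    - f_equal; field; lra.
    - apply Rdiv_lt_0_compat; lra. }
  apply C_eq; unfold Re, Im; simpl.
  - match goal with |- ?L = 0 => replace L with
     ((/ 2 * ln ((a - x) ^ 2 + (a + x) ^ 2) - / 2 * ln ((a - x) ^ 2 + (a - x) ^ 2)) +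
      (/ 2 * ln ((a + x) ^ 2 + (a + x) ^ 2) - / 2 * ln ((a - x) ^ 2 + (a + x) ^ 2)) +
      (/ 2 * ln ((a - x) ^ 2 + (a + x) ^ 2) - / 2 * ln ((a + x) ^ 2 + (a + x) ^ 2)) +
      (/ 2 * ln ((a - x) ^ 2 + (a - x) ^ 2) - / 2 * ln ((a - x) ^ 2 + (a + x) ^ 2))) end.
    + ring.
    + repeat match goal with |- / 2 * ln _ = / 2 * ln _ => apply f_equal, f_equal
       | |- context [ln] => apply f_equal2 end; ring.
  - match goal with |- ?L = _ => replace L with
     ((atan ((a + x) / (a - x)) - atan (- (a - x) / (a - x))) +
      (atan ((a + x) / (a + x)) - atan (- (a - x) / (a + x))) +
      (atan ((a - x) / (a + x)) - atan (- (a + x) / (a + x))) +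
      (atan ((a - x) / (a - x)) - atan (- (a + x) / (a - x)))) end.
    + rewrite !A1, !A2 by lra.
      replace (- (a - x) / (a + x)) with (- ((a - x) / (a + x))) by (field; lra).
      replace (- (a + x) / (a - x)) with (- ((a + x) / (a - x))) by (field; lra).
      rewrite !atan_opp, A3. field.
    + repeat match goal with |- atan _ = atan _ => apply f_equal
       | |- context [atan] => apply f_equal2 end; field; lra.
Qed.

Lemma sum4_bound g e : (forall k, Cmod (g k) <= e) -> Cmod (sum4 g) <= 4 * e.
Proof.
  intros H. unfold sum4.
  generalize (H 0%nat) (H 1%nat) (H 2%nat) (H 3%nat); intros.
  generalize (Cmod_triangle (g 0%nat + g 1%nat + g 2%nat) (g 3%nat)),
   (Cmod_triangle (g 0%nat + g 1%nat) (g 2%nat)), (Cmod_triangle (g 0%nat) (g 1%nat)). lra.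
Qed.

Lemma CInt_sum4 (g : nat -> R -> C) a b : a <= b -> (forall k, Ccont_on (g k) a b) ->
  sum4 (fun k => CInt (g k) a b) = CInt (fun u => sum4 (fun k => g k u)) a b.
Proof.
  intros Hab Hg. unfold sum4.
  rewrite (CInt_plus (fun u => g 0%nat u + g 1%nat u + g 2%nat u)%C (g 3%nat) a b Hab).
  - rewrite (CInt_plus (fun u => g 0%nat u + g 1%nat u)%C (g 2%nat) a b Hab).
    + rewrite (CInt_plus (g 0%nat) (g 1%nat) a b Hab (Hg _) (Hg _)). reflexivity.
    + intros u Hu; apply Ccontp_plus; now apply Hg.
    + apply Hg.
  - intros u Hu; apply Ccontp_plus; [apply Ccontp_plus | ]; now apply Hg.
  - apply Hg.
Qed.

(** Shrinking the square towards [x] by the factor [l] does not change the total integral: each ray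
    from [x] to a vertex is shared by two consecutive sides, whose contributions along it cancel. As
    [l] tends to 0, continuity of [f] at [x] leaves [f x] times the winding integral. *)
Lemma cauchy_square (f : C -> C) (r a x : R) : holomorphic_on_disk r f -> 0 < a < r -> - a < x < a ->
  sum4 (fun k => CInt (fun u => f (quad k * edge a u) * edge_form a (edge_center k x) u)%C 0 1) =
  (f (RtoC x) * (0, (2 * PI)%R))%C.
Proof.
  intros Hf Ha Hx.
  assert (Hwr : forall k, Cmod (edge_center k x) < r) by (intros k; rewrite Cmod_edge_center; apply Rabs_def1; lra).
  assert (Hwa : forall k, Re (edge_center k x) + Im (edge_center k x) < a) by (intros; now apply edge_center_lt).
  assert (Hfk : forall k, holomorphic_on_disk r (fun z => f (quad k * z)%C)).
  { intros k. apply holomorphic_rot; [apply Cmod_quad | exact Hf]. }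
  pose (A := fun l k => CInt (fun u => f (quad k * cone a (edge_center k x) l u) * edge_form a (edge_center k x) u)%C 0 1).
  assert (Kc : forall k l u, 0 <= l <= 1 -> 0 <= u <= 1 ->
    Ccontp (fun u => f (quad k * cone a (edge_center k x) l u)%C) u).
  { intros k l u Hl Hu. apply (holomorphic_comp_cont r (fun z => f (quad k * z)%C) _ _ (Hfk k)); [apply cone_cont_u | ].
    apply cone_in_disk; auto. }
  assert (Kl : forall k l u, 0 <= l <= 1 -> 0 <= u <= 1 ->
    Ccontp (fun l => f (quad k * cone a (edge_center k x) l u)%C) l).
  { intros k l u Hl Hu. apply (holomorphic_comp_cont r (fun z => f (quad k * z)%C) (fun l => cone a (edge_center k x) l u) _ (Hfk k)); [apply cone_cont_l | ].
    apply cone_in_disk; auto. }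
  assert (KA : forall k l, 0 <= l <= 1 -> Ccont_on (fun u => f (quad k * cone a (edge_center k x) l u) * edge_form a (edge_center k x) u)%C 0 1).
  { intros k l Hl u Hu. apply Ccontp_mult; [now apply Kc | now apply edge_form_cont]. }
  assert (HA : forall l, 0 < l <= 1 -> sum4 (A 1) = sum4 (A l)).
  { intros l Hl. apply (proj2 (Ceq_minus _ _)).
    pose (ray := fun k l => ((f (quad k * cone a (edge_center k x) l 1) - f (quad k * cone a (edge_center k x) l 0)) * RtoC (/ l))%C).
    assert (Hk : forall k, (A 1 k - A l k = CInt (ray k) l 1)%C).
    { intros k. unfold A. rewrite <- CInt_minus; [ | lra | apply KA; lra | apply KA; lra].
      assert (Hl' : 0 < l <= 1) by lra.
      etransitivity; [ | exact (cone_goursat (fun z => f (quad k * z)%C) r a (edge_center k x) l 1 (Hfk k) Ha (Hwr k) (Hwa k) Hl' (Rle_refl 1))].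
      apply CInt_ext; [lra | intros; ring]. }
    assert (Kr : forall k, Ccont_on (ray k) l 1).
    { intros k y Hy. apply Ccontp_mult; [apply Ccontp_minus; apply Kl; lra | apply Ccontp_Rinv; lra]. }
    transitivity (sum4 (fun k => CInt (ray k) l 1)); [unfold sum4; rewrite <- !Hk; ring | ].
    rewrite CInt_sum4; [ | lra | exact Kr].
    transitivity (CInt (fun _ => 0%C) l 1).
    - apply CInt_ext; [lra | ]. intros y Hy. unfold ray, sum4. rewrite !quad_cone.
      assert (Q : forall k, (k < 3)%nat -> (quad (S k) * edge a 0 = quad k * edge a 1)%C).
      { intros [|[|[|k]]] Hk'; try lia; apply C_eq; simpl; ring. }
      assert (Q' : (quad 0 * edge a 0 = quad 3 * edge a 1)%C) by (apply C_eq; simpl; ring).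
      rewrite Q', !Q by lia. ring.
    - rewrite CInt_const by lra. ring. }
  assert (W := winding_number a x Hx).
  assert (E1 : sum4 (A 1) = sum4 (fun k => CInt (fun u => f (quad k * edge a u) * edge_form a (edge_center k x) u)%C 0 1)).
  { assert (E : forall k, A 1 k = CInt (fun u => f (quad k * edge a u) * edge_form a (edge_center k x) u)%C 0 1).
    { intros k. apply CInt_ext; [lra | ]. intros u _.
      replace (cone a (edge_center k x) 1 u) with (edge a u) by (unfold cone; ring). reflexivity. }
    unfold sum4. rewrite !E. reflexivity. }
  rewrite <- E1, <- W. apply (proj2 (Ceq_minus _ _)). apply Cmod_eq_0. apply Rle_antisym; [ | apply Cmod_ge_0].
  apply le_epsilon. intros eps Heps. rewrite Rplus_0_l.
  assert (HM : exists M, 0 < M /\ forall k u, 0 <= u <= 1 -> Cmod (edge_form a (edge_center k x) u) <= M).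
  { assert (B : forall k, exists M, 0 < M /\ forall u, 0 <= u <= 1 -> Cmod (edge_form a (edge_center k x) u) <= M).
    { intros k. apply Ccont_on_bounded; [lra | ]. intros u _; now apply edge_form_cont. }
    destruct (B 0%nat) as [M0 [P0 H0]], (B 1%nat) as [M1 [P1 H1]], (B 2%nat) as [M2 [P2 H2]], (B 3%nat) as [M3 [P3 H3]].
    exists (M0 + M1 + M2 + M3); split; [lra | ].
    intros [|[|[|k]]] u Hu; [generalize (H0 u Hu) | generalize (H1 u Hu) | generalize (H2 u Hu) | generalize (H3 u Hu)];
      try change (edge_center (S (S (S k))) x) with (edge_center 3 x); lra. }
  destruct HM as [M [HM0 HM]].
  destruct (holomorphic_cont r f (RtoC x) Hf) with (eps := eps / (8 * M)) as [d [Hd Hfd]].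
  { rewrite Cmod_R. apply Rabs_def1; lra. } { apply Rdiv_lt_0_compat; lra. }
  (* A point of the shrunken square is within [2 a l] of [x], hence within [d / 2]. *)
  set (l := Rmin 1 (d / (4 * a))).
  assert (Hl : 0 < l <= 1).
  { split; [apply Rmin_pos; [lra | apply Rdiv_lt_0_compat; lra] | apply Rmin_l]. }
  assert (Hld : l * (2 * a) < d).
  { apply Rle_lt_trans with (d / (4 * a) * (2 * a)); [ | replace (d / (4 * a) * (2 * a)) with (d / 2) by (field; lra); lra].
    apply Rmult_le_compat_r; [lra | apply Rmin_r]. }
  rewrite (HA l Hl).
  replace (sum4 (A l) - f x * sum4 (fun k => CInt (edge_form a (edge_center k x)) 0 1))%C
    with (sum4 (fun k => A l k - f x * CInt (edge_form a (edge_center k x)) 0 1)%C) by (unfold sum4; ring).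
  replace eps with (4 * (2 * (eps / (8 * M) * M) * (1 - 0))) by (field; lra).
  apply sum4_bound. intros k. unfold A.
  rewrite <- CInt_scal; [ | lra | intros u _; now apply edge_form_cont].
  assert (Kc2 : Ccont_on (fun u => f x * edge_form a (edge_center k x) u)%C 0 1).
  { intros u _. apply Ccontp_mult; [apply Ccontp_const | now apply edge_form_cont]. }
  rewrite <- CInt_minus; [ | lra | apply KA; lra | exact Kc2].
  apply CInt_bound; [lra | | ].
  { intros u Hu. apply Ccontp_minus; [apply KA; lra | now apply Kc2]. }
  intros u Hu.
  replace (f (quad k * cone a (edge_center k x) l u) * edge_form a (edge_center k x) u -
    f x * edge_form a (edge_center k x) u)%C with
    ((f (quad k * cone a (edge_center k x) l u) - f x) * edge_form a (edge_center k x) u)%C by ring.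
  rewrite Cmod_mult. apply Rmult_le_compat; auto using Cmod_ge_0.
  left. apply Hfd. rewrite quad_cone.
  replace (x + l * (quad k * edge a u - x) - x)%C with (l * (quad k * edge a u - x))%C by ring.
  rewrite Cmod_mult, Cmod_R, Rabs_right by lra.
  eapply Rle_lt_trans; [ | exact Hld]. apply Rmult_le_compat_l; [lra | ].
  eapply Rle_trans; [apply Cmod_minus_le | ]. rewrite Cmod_mult, Cmod_quad, Cmod_R.
  assert (T := Cmod_edge a u (proj1 Ha) Hu). assert (Rabs x < a) by (apply Rabs_def1; lra). lra.
Qed.

(** * Taylor estimates and limits *)

Lemma eps_of_quadratic M eps : 0 < eps -> exists delta, 0 < delta /\
  forall h, Rabs h < delta -> M * h ^ 2 <= eps * Rabs h.
Proof.
  intros He. assert (HM := Rabs_pos M). exists (eps / (Rabs M + 1)). split; [apply Rdiv_lt_0_compat; lra | ].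
  intros h Hh. apply Rmult_lt_compat_r with (r := Rabs M + 1) in Hh; [ | lra].
  replace (eps / (Rabs M + 1) * (Rabs M + 1)) with eps in Hh by (field; lra).
  rewrite <- pow2_abs. assert (Hp := Rabs_pos h). assert (L := Rle_abs M).
  apply Rle_trans with (Rabs M * Rabs h ^ 2).
  - apply Rmult_le_compat_r; [apply pow2_ge_0 | exact L].
  - replace (Rabs M * Rabs h ^ 2) with (Rabs M * Rabs h * Rabs h) by ring.
    apply Rmult_le_compat_r; [exact Hp | ]. nra.
Qed.

Lemma is_derive_eps (f : R -> R) x l :
  (forall eps, 0 < eps -> exists delta, 0 < delta /\ forall y, Rabs (y - x) < delta ->
     Rabs (f y - f x - (y - x) * l) <= eps * Rabs (y - x)) -> is_derive f x l.
Proof.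
  intros H. split.
  - apply (is_linear_scal_l).
  - intros x' Hx'. apply (is_filter_lim_locally_unique (K := R_AbsRing) (V := R_NormedModule)) in Hx'. subst x'.
    intros eps. destruct (H eps (cond_pos eps)) as [d [Hd Hy]]. exists (mkposreal d Hd). intros y H'. exact (Hy y H').
Qed.

Lemma is_derive_quadratic (f : R -> R) x l d M : 0 < d ->
  (forall y, Rabs (y - x) < d -> Rabs (f y - f x - (y - x) * l) <= M * (y - x) ^ 2) -> is_derive f x l.
Proof.
  intros Hd H. apply is_derive_eps. intros eps He. destruct (eps_of_quadratic M eps He) as [d' [Hd' Hq]].
  exists (Rmin d d'). split; [now apply Rmin_pos | ]. intros y Hy.
  assert (L1 := Rmin_l d d'). assert (L2 := Rmin_r d d'). eapply Rle_trans; [apply H | apply Hq]; lra.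
Qed.

Lemma Cder_quadratic f x l d M : 0 < d ->
  (forall y, Rabs (y - x) < d -> Cmod (f y - f x - RtoC (y - x) * l)%C <= M * (y - x) ^ 2) -> Cder f x l.
Proof.
  intros Hd H; split; apply (is_derive_quadratic _ _ _ d M Hd); intros y Hy;
  (eapply Rle_trans; [ | apply (H y Hy)]).
  - replace (Re (f y) - Re (f x) - (y - x) * Re l) with (Re (f y - f x - RtoC (y - x) * l)%C)
      by (unfold Re, Im; simpl; ring). apply re_le_Cmod.
  - replace (Im (f y) - Im (f x) - (y - x) * Im l) with (Im (f y - f x - RtoC (y - x) * l)%C)
      by (unfold Re, Im; simpl; ring). apply Im_le_Cmod.
Qed.

Lemma Cder_CInt_param (g : R -> R -> C) (g1 : R -> C) a b x M : a <= b ->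
  (forall y, Rabs (y - x) < 1 -> Ccont_on (g y) a b) -> Ccont_on g1 a b ->
  (forall y u, Rabs (y - x) < 1 -> a <= u <= b ->
     Cmod (g y u - g x u - RtoC (y - x) * g1 u)%C <= M * (y - x) ^ 2) ->
  Cder (fun y => CInt (g y) a b) x (CInt g1 a b).
Proof.
  intros Hab Hg Hg1 H. apply (Cder_quadratic _ _ _ 1 (2 * M * (b - a)) Rlt_0_1). intros y Hy.
  assert (Hx : Rabs (x - x) < 1) by (rewrite Rminus_diag, Rabs_R0; lra).
  assert (Hs : Ccont_on (fun u => RtoC (y - x) * g1 u)%C a b)
    by (intros u Hu; apply Ccontp_mult; [apply Ccontp_const | auto]).
  assert (Hm : Ccont_on (fun u => g y u - g x u)%C a b)
    by (intros u Hu; apply Ccontp_minus; [apply (Hg y Hy) | apply (Hg x Hx)]; auto).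
  rewrite <- CInt_scal, <- CInt_minus, <- CInt_minus; auto.
  replace (2 * M * (b - a) * (y - x) ^ 2) with (2 * (M * (y - x) ^ 2) * (b - a)) by ring.
  apply CInt_bound; auto. intros u Hu; apply Ccontp_minus; [apply Hm | apply Hs]; auto.
Qed.

(** Both [q - p] and [q + p] are nondecreasing, by the mean value theorem. *)
Lemma derive_dominated (p q p1 q1 : R -> R) a b : a <= b ->
  (forall u, a <= u <= b -> is_derive p u (p1 u)) -> (forall u, a <= u <= b -> is_derive q u (q1 u)) ->
  (forall u, a <= u <= b -> Rabs (p1 u) <= q1 u) -> Rabs (p b - p a) <= q b - q a.
Proof.
  intros Hab Hp Hq H.
  assert (A : forall f f1 : R -> R, (forall u, a <= u <= b -> is_derive f u (f1 u)) ->
     (forall u, a <= u <= b -> 0 <= f1 u) -> f a <= f b).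
  { intros f f1 Hf Hf1. destruct (MVT_gen f a b f1) as [c [Hc E]]; rewrite ?Rmin_left, ?Rmax_right in * by assumption.
    - intros; apply Hf; lra.
    - intros u Hu. apply continuity_pt_filterlim. apply (ex_derive_continuous (V := R_NormedModule)).
      eexists; now apply Hf.
    - specialize (Hf1 c Hc). nra. }
  assert (H1 := A (fun u => q u - p u) (fun u => q1 u - p1 u)).
  assert (H2 := A (fun u => q u + p u) (fun u => q1 u + p1 u)).
  assert (L1 : q a - p a <= q b - p b).
  { apply H1.
    - intros u Hu. apply (is_derive_minus q p); auto.
    - intros u Hu. generalize (H u Hu) (Rle_abs (p1 u)); lra. }
  assert (L2 : q a + p a <= q b + p b).
  { apply H2.
    - intros u Hu. apply (is_derive_plus q p); auto.
    - intros u Hu. generalize (H u Hu) (Rle_abs (- p1 u)). rewrite Rabs_Ropp. lra. }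
  apply Rabs_le; lra.
Qed.

Fixpoint taylor_sum (c : nat -> R) (h : R) (N : nat) : R :=
  match N with O => 0 | S n => taylor_sum c h n + c n * (h ^ n / INR (fact n)) end.

Lemma is_derive_pow_fact h n : is_derive (fun h => h ^ S n / INR (fact (S n))) h (h ^ n / INR (fact n)).
Proof.
  apply (is_derive_ext (fun h => / INR (fact (S n)) * h ^ S n)); [intros; apply Rmult_comm | ].
  replace (h ^ n / INR (fact n)) with (/ INR (fact (S n)) * (INR (S n) * 1 * h ^ pred (S n))).
  - apply is_derive_scal. apply (is_derive_pow (fun h => h) (S n)). apply (is_derive_id (K := R_AbsRing)).
  - rewrite fact_simpl, mult_INR. simpl pred. field. split; [apply INR_fact_neq_0 | apply not_0_INR; lia].
Qed.

Lemma is_derive_taylor_sum c h N :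
  is_derive (fun h => taylor_sum c h (S N)) h (taylor_sum (fun n => c (S n)) h N).
Proof.
  induction N as [|N IH].
  - apply (is_derive_ext (fun _ => c 0%nat)); [intros t; change (c 0%nat = 0 + c 0%nat * (1 / 1)); field | apply (is_derive_const (K := R_AbsRing) (V := R_NormedModule))].
  - change (is_derive (fun h => taylor_sum c h (S N) + c (S N) * (h ^ S N / INR (fact (S N)))) h
     (taylor_sum (fun n => c (S n)) h N + c (S N) * (h ^ N / INR (fact N)))).
    apply (is_derive_plus _ _ _ _ _ IH).
    apply is_derive_scal. apply is_derive_pow_fact.
Qed.

(** Induction on the order: the derivative of the remainder of order [N + 1] of [g 0] is the
    remainder of order [N] of [g 1], which is dominated by the derivative of the claimed bound. *)
Lemma taylor_bound_right N : forall (g : nat -> R -> R) x0 x B, x0 <= x ->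
  (forall n u, (n < N)%nat -> x0 <= u <= x -> is_derive (g n) u (g (S n) u)) ->
  (forall u, x0 <= u <= x -> Rabs (g N u) <= B) ->
  Rabs (g 0%nat x - taylor_sum (fun n => g n x0) (x - x0) N) <= B * ((x - x0) ^ N / INR (fact N)).
Proof.
  induction N as [|N IH]; intros g x0 x B Hx Hd HB.
  - simpl. rewrite Rminus_0_r. replace (B * (1 / 1)) with B by field. apply HB; lra.
  - assert (D := derive_dominated (fun u => g 0%nat u - taylor_sum (fun n => g n x0) (u - x0) (S N))
      (fun u => B * ((u - x0) ^ S N / INR (fact (S N))))
      (fun u => g 1%nat u - taylor_sum (fun n => g (S n) x0) (u - x0) N)
      (fun u => B * ((u - x0) ^ N / INR (fact N))) x0 x Hx).
    assert (Z : forall M, taylor_sum (fun n => g n x0) 0 (S M) = g 0%nat x0).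
    { induction M as [|M E]; [simpl; field | ].
      change (taylor_sum (fun n => g n x0) 0 (S M) + g (S M) x0 * (0 ^ S M / INR (fact (S M))) = g 0%nat x0).
      rewrite E, pow_i by lia. unfold Rdiv; ring. }
    cbv beta in D. rewrite (Rminus_diag x0), Z in D.
    rewrite pow_i in D by lia.
    match type of D with _ -> _ -> _ -> Rabs (?p - ?z) <= ?q - ?w =>
      replace (p - z) with p in D by ring; replace (q - w) with q in D by (unfold Rdiv; ring) end.
    apply D.
    + intros u Hu. apply (is_derive_minus (g 0%nat)).
      * apply Hd; [lia | exact Hu].
      * replace (taylor_sum (fun n => g (S n) x0) (u - x0) N)
          with (scal 1 (taylor_sum (fun n => g (S n) x0) (u - x0) N)) by (apply Rmult_1_l).
        apply (is_derive_comp (fun h => taylor_sum (fun n => g n x0) h (S N)) (fun u => u - x0)).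
        -- apply (is_derive_taylor_sum (fun n => g n x0)).
        -- auto_derive; auto; ring.
    + intros u Hu. apply is_derive_scal.
      replace ((u - x0) ^ N / INR (fact N)) with (scal 1 ((u - x0) ^ N / INR (fact N))) by (apply Rmult_1_l).
      apply (is_derive_comp (fun h => h ^ S N / INR (fact (S N))) (fun u => u - x0)).
      * apply is_derive_pow_fact.
      * auto_derive; auto; ring.
    + intros u Hu. apply (IH (fun n => g (S n)) x0 u B).
      * apply Hu.
      * intros n v Hn Hv. apply Hd; [lia | lra].
      * intros v Hv. apply HB; lra.
Qed.

Lemma taylor_bound N (g : nat -> R -> R) x0 x B :
  (forall n u, (n < N)%nat -> Rmin x0 x <= u <= Rmax x0 x -> is_derive (g n) u (g (S n) u)) ->
  (forall u, Rmin x0 x <= u <= Rmax x0 x -> Rabs (g N u) <= B) ->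
  Rabs (g 0%nat x - taylor_sum (fun n => g n x0) (x - x0) N) <= B * (Rabs (x - x0) ^ N / INR (fact N)).
Proof.
  intros Hd HB. destruct (Rle_dec x0 x) as [Hx|Hx].
  - rewrite Rmin_left, Rmax_right in * by assumption. rewrite (Rabs_right (x - x0)) by lra.
    now apply taylor_bound_right.
  - rewrite Rmin_right, Rmax_left in * by lra.
    rewrite (Rabs_left (x - x0)) by lra. replace (- (x - x0)) with (- x - - x0) by ring.
    (* Reflection about 0, with the matching sign on each derivative, reduces expansion to the left
       to expansion to the right. *)
    assert (T := taylor_bound_right N (fun n u => (-1) ^ n * g n (- u)) (- x0) (- x) B).
    cbv beta in T. replace ((-1) ^ 0 * g 0%nat (- - x)) with (g 0%nat x) in T by (rewrite Ropp_involutive; simpl; ring).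
    replace (taylor_sum (fun n => (-1) ^ n * g n (- - x0)) (- x - - x0) N)
      with (taylor_sum (fun n => g n x0) (x - x0) N) in T.
    + apply T; [lra | | ].
      * intros n u Hn Hu.
        assert (D := Hd n (- u) Hn ltac:(lra)).
        replace ((-1) ^ S n * g (S n) (- u)) with ((-1) ^ n * (-1 * g (S n) (- u))) by (simpl; ring).
        apply is_derive_scal.
        apply (is_derive_comp (g n) Ropp); [exact D | ].
        auto_derive; auto; ring.
      * intros u Hu. rewrite Rabs_mult, pow_1_abs, Rmult_1_l. apply HB; lra.
    + clear. induction N as [|N IH]; [reflexivity | ]. simpl. rewrite IH, Ropp_involutive.
      replace (- x - - x0) with (-1 * (x - x0)) by ring. rewrite Rpow_mult_distr.
      assert (E : (-1) ^ N * (-1) ^ N = 1).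
      { rewrite <- Rpow_mult_distr. replace (-1 * -1) with 1 by ring. apply pow1. }
      transitivity (taylor_sum (fun n => (-1) ^ n * g n x0) (-1 * (x - x0)) N +
        ((-1) ^ N * (-1) ^ N) * (g N x0 * ((x - x0) ^ N / INR (fact N)))).
      * rewrite E; ring.
      * unfold Rdiv; ring.
Qed.

Lemma Rabs_le_between_Rabs X a b u : Rabs a <= X -> Rabs b <= X -> Rmin a b <= u <= Rmax a b -> Rabs u <= X.
Proof.
  unfold Rmin, Rmax, Rabs. destruct Rle_dec; repeat destruct Rcase_abs; lra.
Qed.

(** Each of the two components contributes half of [B (y - x) ^ 2]. The second-order estimates on
    exponentials, heat kernels and terms of series all come from here. *)
Lemma Ctaylor2 (f f1 f2 : R -> C) x y B :
  (forall u, Rmin x y <= u <= Rmax x y -> Cder f u (f1 u)) ->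
  (forall u, Rmin x y <= u <= Rmax x y -> Cder f1 u (f2 u)) ->
  (forall u, Rmin x y <= u <= Rmax x y -> Cmod (f2 u) <= B) ->
  Cmod (f y - f x - RtoC (y - x) * f1 x)%C <= B * (y - x) ^ 2.
Proof.
  intros H1 H2 HB.
  assert (T : forall pr : C -> R, (forall z, Rabs (pr z) <= Cmod z) ->
    (forall g u l, Cder g u l -> is_derive (fun v => pr (g v)) u (pr l)) ->
    Rabs (pr (f y) - pr (f x) - (y - x) * pr (f1 x)) <= B * ((y - x) ^ 2 / 2)).
  { intros pr P1 P2.
    pose (g := fun n : nat => match n with O => fun u => pr (f u) | S O => fun u => pr (f1 u) | _ => fun u => pr (f2 u) end).
    assert (T := taylor_bound 2 g x y B).
    simpl in T.
    replace (pr (f y) - pr (f x) - (y - x) * pr (f1 x)) with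
      (pr (f y) - (0 + pr (f x) * (1 / 1) + pr (f1 x) * ((y - x) * 1 / 1))) by field.
    eapply Rle_trans; [apply T | ].
    - intros n u Hn Hu. destruct n as [|[|n]]; [ | | lia]; simpl; apply P2; auto.
    - intros u Hu. eapply Rle_trans; [apply P1 | auto].
    - right. f_equal. f_equal.
      replace ((y - x) ^ 2) with (Rabs (y - x) * Rabs (y - x)).
      + rewrite Rmult_1_r. try reflexivity.
      + rewrite <- (pow2_abs (y - x)); ring. }
  assert (TR := T Re re_le_Cmod (fun g u l H => proj1 H)).
  assert (TI := T Im Im_le_Cmod (fun g u l H => proj2 H)).
  eapply Rle_trans; [apply Cmod_le_Re_Im | ].
  replace (Re (f y - f x - RtoC (y - x) * f1 x)%C) with (Re (f y) - Re (f x) - (y - x) * Re (f1 x))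
    by (unfold Re, Im; simpl; ring).
  replace (Im (f y - f x - RtoC (y - x) * f1 x)%C) with (Im (f y) - Im (f x) - (y - x) * Im (f1 x))
    by (unfold Re, Im; simpl; ring).
  lra.
Qed.

(** * Limits of complex sequences *)

Definition is_Clim (u : nat -> C) (l : C) : Prop :=
  forall eps, 0 < eps -> exists N, forall n, (N <= n)%nat -> Cmod (u n - l) < eps.

(** A total limit, so that a half-line integral can be written as a function of its integrand; the
    value is meaningful only together with [is_Clim]. *)
Definition Clim (u : nat -> C) : C := (real (Lim_seq (fun n => Re (u n))), real (Lim_seq (fun n => Im (u n)))).

Lemma is_Clim_Clim u l : is_Clim u l -> Clim u = l.
Proof.
  intros H. apply C_eq; simpl.
  - rewrite (is_lim_seq_unique _ (Re l)); [reflexivity | ].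
    apply is_lim_seq_Reals. intros eps Heps. destruct (H eps Heps) as [N HN]. exists N. intros n Hn.
    eapply Rle_lt_trans; [apply (re_le_Cmod (u n - l)) | apply HN; exact Hn].
  - rewrite (is_lim_seq_unique _ (Im l)); [reflexivity | ].
    apply is_lim_seq_Reals. intros eps Heps. destruct (H eps Heps) as [N HN]. exists N. intros n Hn.
    eapply Rle_lt_trans; [apply (Im_le_Cmod (u n - l)) | apply HN; exact Hn].
Qed.

Lemma Clim_cauchy u : (forall eps, 0 < eps -> exists N, forall n m, (N <= n <= m)%nat -> Cmod (u m - u n) < eps) ->
  is_Clim u (Clim u).
Proof.
  intros H.
  assert (A : forall pr : C -> R, (forall z w, Rabs (pr z - pr w) <= Cmod (z - w)) ->
     exists l, Un_cv (fun n => pr (u n)) l).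
  { intros pr P. destruct (Rcomplete.R_complete (fun n => pr (u n))) as [l Hl]; [ | exists l; exact Hl].
    intros eps Heps. destruct (H eps Heps) as [N HN]. exists N. intros n m Hn Hm. unfold Rdist.
    eapply Rle_lt_trans; [apply P | ]. destruct (Nat.le_ge_cases n m).
    - rewrite Cmod_minus_sym. apply HN; lia.
    - apply HN; lia. }
  destruct (A Re) as [l1 H1]; [intros z w; apply (re_le_Cmod (z - w)) | ].
  destruct (A Im) as [l2 H2]; [intros z w; apply (Im_le_Cmod (z - w)) | ].
  assert (L : is_Clim u (l1, l2)).
  { intros eps Heps. destruct (H1 (eps / 2) ltac:(lra)) as [N1 P1]. destruct (H2 (eps / 2) ltac:(lra)) as [N2 P2].
    exists (Nat.max N1 N2). intros n Hn. eapply Rle_lt_trans; [apply Cmod_le_Re_Im | ].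
    assert (Q1 := P1 n ltac:(lia)). assert (Q2 := P2 n ltac:(lia)). unfold Rdist in *.
    change (Rabs (Re (u n) - l1) + Rabs (Im (u n) - l2) < eps). lra. }
  rewrite (is_Clim_Clim _ _ L). exact L.
Qed.

Lemma is_Clim_plus u v l m : is_Clim u l -> is_Clim v m -> is_Clim (fun n => u n + v n)%C (l + m)%C.
Proof.
  intros H1 H2 eps Heps. destruct (H1 (eps / 2) ltac:(lra)) as [N1 P1]. destruct (H2 (eps / 2) ltac:(lra)) as [N2 P2].
  exists (Nat.max N1 N2). intros n Hn. replace (u n + v n - (l + m))%C with ((u n - l) + (v n - m))%C by ring.
  eapply Rle_lt_trans; [apply Cmod_triangle | ]. generalize (P1 n ltac:(lia)) (P2 n ltac:(lia)); lra.
Qed.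

Lemma is_Clim_scal c u l : is_Clim u l -> is_Clim (fun n => c * u n)%C (c * l)%C.
Proof.
  intros H eps Heps. assert (Hc := Cmod_ge_0 c).
  destruct (H (eps / (Cmod c + 1))) as [N P]; [apply Rdiv_lt_0_compat; lra | ].
  exists N. intros n Hn. replace (c * u n - c * l)%C with (c * (u n - l))%C by ring. rewrite Cmod_mult.
  specialize (P n Hn). apply Rmult_lt_compat_r with (r := Cmod c + 1) in P; [ | lra].
  replace (eps / (Cmod c + 1) * (Cmod c + 1)) with eps in P by (field; lra).
  generalize (Cmod_ge_0 (u n - l)); nra.
Qed.

Lemma is_Clim_bound u l B : is_Clim u l -> (forall n, Cmod (u n) <= B) -> Cmod l <= B.
Proof.
  intros H HB. apply le_epsilon. intros eps Heps. destruct (H eps Heps) as [N P].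
  specialize (P N (le_n N)). replace l with (u N - (u N - l))%C by ring.
  eapply Rle_trans; [apply Cmod_minus_le | ]. generalize (HB N); lra.
Qed.

Lemma is_Clim_ext u v l : (forall n, u n = v n) -> is_Clim u l -> is_Clim v l.
Proof. intros E H eps Heps. destruct (H eps Heps) as [N P]. exists N. intros n Hn. rewrite <- E. auto. Qed.

(** * Laplace representation of holomorphic functions *)

Definition exp_bounded (b G : R) (g : R -> C) : Prop :=
  (forall s, Ccontp g s) /\ (forall s, 0 <= s -> Cmod (g s) <= G * exp (b * s)).

(** A linear functional continuous for the weighted norm [sup |g s| e^(- b s)] over [s >= 0]. The
    heat flow uses nothing else of the half-line integrals: pointwise Taylor estimates in the
    parameters pass through such an [I]. *)
Definition laplace_functional (b K : R) (I : (R -> C) -> C) : Prop :=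
  (forall g1 g2 G1 G2, exp_bounded b G1 g1 -> exp_bounded b G2 g2 -> I (fun s => g1 s + g2 s)%C = (I g1 + I g2)%C) /\
  (forall c g G, exp_bounded b G g -> I (fun s => c * g s)%C = (c * I g)%C) /\
  (forall g G, exp_bounded b G g -> Cmod (I g) <= K * G).

Lemma exp_pow_INR d n : exp d ^ n = exp (d * INR n).
Proof.
  induction n as [|n IH]; [simpl; rewrite Rmult_0_r, exp_0; reflexivity | ].
  rewrite S_INR. simpl pow. rewrite IH, <- exp_plus. f_equal; ring.
Qed.

Lemma RInt_exp_decay d a b : 0 < d -> a <= b ->
  ex_RInt (fun s => exp (- d * s)) a b /\ RInt (fun s => exp (- d * s)) a b <= exp (- d * a) / d.
Proof.
  intros Hd Hab.
  assert (H : is_RInt (fun s => exp (- d * s)) a b (minus (- / d * exp (- d * b)) (- / d * exp (- d * a)))).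
  { apply (is_RInt_derive (fun s => - / d * exp (- d * s))).
    - intros x _. auto_derive; auto. field; lra.
    - intros x _. apply (ex_derive_continuous (V := R_NormedModule)). auto_derive; auto. }
  split; [eexists; exact H | ]. rewrite (is_RInt_unique _ _ _ _ H).
  unfold minus, plus, opp; simpl. assert (0 < / d) by (apply Rinv_0_lt_compat; lra).
  assert (0 < exp (- d * b)) by apply exp_pos. unfold Rdiv. nra.
Qed.

(** The integrand is at most [M G e^(- (c - b) s)], so the integrals up to [n] form a Cauchy
    sequence with geometric tails, and the limit inherits linearity and the bound. *)
Lemma half_line_functional (F : R -> C) (M b c : R) : 0 < M -> b < c -> (forall s, Ccontp F s) ->
  (forall s, 0 <= s -> Cmod (F s) <= M * exp (- c * s)) ->
  let J := fun g n => CInt (fun s => F s * g s)%C 0 (INR n) in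
  laplace_functional b (2 * M / (c - b)) (fun g => Clim (J g)) /\
  forall g G, exp_bounded b G g -> is_Clim (J g) (Clim (J g)).
Proof.
  intros HM Hbc HF HFb J.
  assert (HG : forall g G, exp_bounded b G g -> 0 <= G).
  { intros g G [_ H]. specialize (H 0 (Rle_refl 0)). rewrite Rmult_0_r, exp_0 in H.
    generalize (Cmod_ge_0 (g 0)); lra. }
  assert (Hc : forall g G n m, exp_bounded b G g -> Ccont_on (fun s => F s * g s)%C n m).
  { intros g G n m [Hg _] s _. apply Ccontp_mult; auto. }
  assert (HB : forall g G n m, exp_bounded b G g -> 0 <= n <= m ->
    Cmod (CInt (fun s => F s * g s)%C n m) <= 2 * (M * G) * (exp (- (c - b) * n) / (c - b))).
  { intros g G n m Hg Hnm. assert (HG0 := HG g G Hg).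
    destruct (RInt_exp_decay (c - b) n m) as [E1 E2]; [lra | lra | ].
    assert (HMG : 0 <= M * G) by (apply Rmult_le_pos; lra).
    apply Rle_trans with (2 * RInt (fun s => (M * G) * exp (- (c - b) * s)) n m).
    - apply CInt_bound_fun; [lra | now apply (Hc g G) | | ].
      + apply (ex_RInt_scal _ _ _ (M * G) E1).
      + intros u Hu. rewrite Cmod_mult. destruct Hg as [_ Hg].
        replace (M * G * exp (- (c - b) * u)) with ((M * exp (- c * u)) * (G * exp (b * u))).
        * apply Rmult_le_compat; auto using Cmod_ge_0; [apply HFb | apply Hg]; lra.
        * replace (- (c - b) * u) with (- c * u + b * u) by ring. rewrite exp_plus. ring.
    - replace (RInt (fun s => M * G * exp (- (c - b) * s)) n m)
        with (M * G * RInt (fun s => exp (- (c - b) * s)) n m)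
        by (symmetry; apply (RInt_scal (fun s => exp (- (c - b) * s)) n m (M * G) E1)).
      rewrite <- Rmult_assoc. apply Rmult_le_compat_l; lra. }
  assert (HL : forall g G, exp_bounded b G g -> is_Clim (J g) (Clim (J g))).
  { intros g G Hg. apply Clim_cauchy. intros eps Heps.
    assert (HG0 := HG g G Hg).
    set (D := c - b). assert (HD : 0 < D) by (unfold D; lra).
    set (K := 2 * (M * G) / D + 1).
    assert (HK : 1 <= K).
    { unfold K. assert (0 <= 2 * (M * G) / D); [ | lra].
      apply Rmult_le_pos; [nra | left; apply Rinv_0_lt_compat; lra]. }
    destruct (pow_lt_1_zero (exp (- D))) with (y := eps / K) as [N HN].
    { rewrite Rabs_right by (left; apply exp_pos). rewrite <- exp_0. apply exp_increasing. lra. }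
    { apply Rdiv_lt_0_compat; lra. }
    exists N. intros n m Hnm. unfold J.
    assert (P1 := pos_INR n). assert (P2 : INR n <= INR m) by (apply le_INR; lia).
    rewrite <- (CInt_Chasles _ 0 (INR n) (INR m)); [ | lra | lra | now apply (Hc g G)].
    replace (CInt (fun s => F s * g s) 0 (INR n) + CInt (fun s => F s * g s) (INR n) (INR m) -
      CInt (fun s => F s * g s) 0 (INR n))%C with (CInt (fun s => F s * g s)%C (INR n) (INR m)) by ring.
    eapply Rle_lt_trans; [apply (HB g G); auto; lra | ].
    specialize (HN n ltac:(lia)). rewrite Rabs_right in HN by (apply Rle_ge, pow_le; left; apply exp_pos).
    fold D. rewrite <- exp_pow_INR.
    apply Rmult_lt_compat_l with (r := K) in HN; [ | lra].
    replace (K * (eps / K)) with eps in HN by (field; lra).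
    assert (0 < exp (- D) ^ n) by (apply pow_lt, exp_pos).
    replace (2 * (M * G) * (exp (- D) ^ n / D)) with (2 * (M * G) / D * exp (- D) ^ n) by (field; lra).
    unfold K in HN. lra. }
  split; [ | exact HL]. split; [ | split].
  - intros g1 g2 G1 G2 H1 H2. apply is_Clim_Clim.
    apply (is_Clim_ext (fun n => J g1 n + J g2 n)%C).
    + intros n. unfold J. assert (P := pos_INR n). rewrite <- CInt_plus; [ | lra | now apply (Hc g1 G1) | now apply (Hc g2 G2)].
      apply CInt_ext; [lra | intros; ring].
    + apply is_Clim_plus; [apply (HL g1 G1) | apply (HL g2 G2)]; assumption.
  - intros k g G Hg. apply is_Clim_Clim.
    apply (is_Clim_ext (fun n => k * J g n)%C).
    + intros n. unfold J. assert (P := pos_INR n). rewrite <- CInt_scal; [ | lra | now apply (Hc g G)].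
      apply CInt_ext; [lra | intros; ring].
    + apply is_Clim_scal, (HL g G Hg).
  - intros g G Hg. apply (is_Clim_bound (J g)); [now apply (HL g G) | ]. intros n. unfold J.
    replace (2 * M / (c - b) * G) with (2 * (M * G) * (exp (- (c - b) * 0) / (c - b)))
      by (rewrite Rmult_0_r, exp_0; field; lra).
    apply (HB g G); [assumption | ]. generalize (pos_INR n); lra.
Qed.

Lemma laplace_functional_scal b K I c : laplace_functional b K I ->
  laplace_functional b (Cmod c * K) (fun g => c * I g)%C.
Proof.
  intros [H1 [H2 H3]]. split; [ | split].
  - intros g1 g2 G1 G2 Hg1 Hg2. rewrite (H1 _ _ _ _ Hg1 Hg2). ring.
  - intros k g G Hg. rewrite (H2 _ _ _ Hg). ring.
  - intros g G Hg. rewrite Cmod_mult, Rmult_assoc. apply Rmult_le_compat_l; [apply Cmod_ge_0 | ]. eauto.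
Qed.

Lemma Cder_cexp_lin c s : Cder (fun y => cexp (c * RtoC y)) s (c * cexp (c * RtoC s))%C.
Proof.
  apply (Cder_cexp (fun y => c * RtoC y)%C). eapply Cder_eq; [apply Cder_scal, Cder_id | ring].
Qed.

Lemma cexp_lin_taylor (c : C) (s s' B : R) : (forall u, Rmin s s' <= u <= Rmax s s' -> exp (Re c * u) <= B) ->
  Cmod (cexp (c * RtoC s') - cexp (c * RtoC s) - RtoC (s' - s) * (c * cexp (c * RtoC s)))%C
   <= Cmod c ^ 2 * B * (s' - s) ^ 2.
Proof.
  intros H. apply (Ctaylor2 (fun y => cexp (c * RtoC y)) (fun y => c * cexp (c * RtoC y))%C
    (fun y => c * (c * cexp (c * RtoC y)))%C).
  - intros u _; apply Cder_cexp_lin.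
  - intros u _. apply Cder_scal, Cder_cexp_lin.
  - intros u Hu. rewrite !Cmod_mult, Cmod_cexp.
    replace (Re (c * RtoC u)%C) with (Re c * u) by (unfold Re, Im; simpl; ring).
    rewrite <- Rmult_assoc. replace (Cmod c ^ 2) with (Cmod c * Cmod c) by ring.
    apply Rmult_le_compat_l; [ | now apply H]. apply Rmult_le_pos; apply Cmod_ge_0.
Qed.

Definition laplace_density (a : R) (G : R -> C) (om : C) (s : R) : C :=
  (om * CInt (fun u => G u * cexp (- (om * edge a u) * RtoC s)) 0 1)%C.

(** The point [om * edge a u] is a convex combination of [om a] and [om a i], whose real parts are
    [a Re om] and [- a Im om]. *)
Lemma Re_om_edge a kappa om u : 0 < a -> kappa <= Re om -> kappa <= - Im om -> 0 <= u <= 1 ->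
  kappa * a <= Re (om * edge a u)%C.
Proof.
  intros Ha Hre Him Hu. unfold Re, Im in *; simpl.
  assert (0 <= (fst om - kappa) * (a * (1 - u))) by (apply Rmult_le_pos; [lra | apply Rmult_le_pos; lra]).
  assert (0 <= (- snd om - kappa) * (a * u)) by (apply Rmult_le_pos; [lra | apply Rmult_le_pos; lra]).
  lra.
Qed.

Lemma laplace_kernel_cont a G om s : Ccont_on G 0 1 ->
  Ccont_on (fun u => G u * cexp (- (om * edge a u) * RtoC s))%C 0 1.
Proof.
  intros HG u Hu. ccont.
Qed.

Lemma Cder_exp_CInt (a : R) (om : C) (H : R -> C) (w : C) (s : R) : Ccont_on H 0 1 ->
  Cder (fun s => CInt (fun u => H u * cexp (- (om * (edge a u - w)) * RtoC s))%C 0 1) s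
    (CInt (fun u => - (om * (edge a u - w)) * (H u * cexp (- (om * (edge a u - w)) * RtoC s)))%C 0 1).
Proof.
  intros HH.
  pose (c := fun u => (- (om * (edge a u - w)))%C).
  change (Cder (fun s => CInt (fun u => H u * cexp (c u * RtoC s))%C 0 1) s
    (CInt (fun u => c u * (H u * cexp (c u * RtoC s)))%C 0 1)).
  assert (Hc : Ccont_on c 0 1).
  { intros u _. unfold c. ccont. }
  destruct (Ccont_on_bounded c 0 1) as [M1 [P1 Q1]]; [lra | exact Hc | ].
  destruct (Ccont_on_bounded H 0 1) as [M2 [P2 Q2]]; [lra | exact HH | ].
  assert (Kc : forall y, Ccont_on (fun u => H u * cexp (c u * RtoC y))%C 0 1).
  { intros y u Hu. ccont. }
  apply (Cder_CInt_param (fun y u => H u * cexp (c u * RtoC y))%C _ 0 1 s (M2 * (M1 ^ 2 * exp (M1 * (Rabs s + 1))))).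
  - lra.
  - intros y _. apply Kc.
  - intros u Hu. apply Ccontp_mult; [now apply Hc | apply (Kc s u Hu)].
  - intros y u Hy Hu. cbv beta.
    replace (H u * cexp (c u * y) - H u * cexp (c u * s) - RtoC (y - s) * (c u * (H u * cexp (c u * s))))%C
      with (H u * (cexp (c u * y) - cexp (c u * s) - RtoC (y - s) * (c u * cexp (c u * s))))%C by ring.
    rewrite Cmod_mult, Rmult_assoc. apply Rmult_le_compat; auto using Cmod_ge_0.
    eapply Rle_trans; [apply (cexp_lin_taylor (c u) s y (exp (M1 * (Rabs s + 1)))) | ].
    + intros v Hv. assert (T : Re (c u) * v <= M1 * (Rabs s + 1)).
      { eapply Rle_trans; [apply Rle_abs | ]. rewrite Rabs_mult.
        apply Rmult_le_compat; auto using Rabs_pos.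
        - eapply Rle_trans; [apply re_le_Cmod | auto].
        - apply Rabs_def2 in Hy. revert Hv. unfold Rmin, Rmax, Rabs.
          destruct Rle_dec; repeat destruct Rcase_abs; intros; lra. }
      now apply exp_le.
    + apply Rmult_le_compat_r; [apply pow2_ge_0 | ]. apply Rmult_le_compat_r; [left; apply exp_pos | ].
      apply pow_incr. split; [apply Cmod_ge_0 | auto].
Qed.

Lemma laplace_density_cont a G om s : Ccont_on G 0 1 -> Ccontp (laplace_density a G om) s.
Proof.
  intros HG.
  apply (Ccontp_mult (fun _ => om)); [apply Ccontp_const | ].
  eapply Cder_cont.
  assert (D := Cder_exp_CInt a om G 0%C s HG).
  replace (fun s : R => CInt (fun u : R => G u * cexp (- (om * edge a u) * s))%C 0 1)
    with (fun s : R => CInt (fun u : R => G u * cexp (- (om * (edge a u - 0)) * s))%C 0 1).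
  - exact D.
  - apply functional_extensionality; intros y. f_equal. apply functional_extensionality; intros u.
    do 2 f_equal. ring.
Qed.

Lemma laplace_density_bound a kappa G om : 0 < a -> kappa <= Re om -> kappa <= - Im om ->
  Ccont_on G 0 1 -> exists M, 0 < M /\
  forall s, 0 <= s -> Cmod (laplace_density a G om s) <= M * exp (- (kappa * a) * s).
Proof.
  intros Ha Hre Him HG.
  destruct (Ccont_on_bounded G 0 1) as [M [HM HMb]]; [lra | exact HG | ].
  exists ((Cmod om + 1) * (2 * M)). assert (H0 := Cmod_ge_0 om). split; [nra | ].
  intros s Hs. unfold laplace_density. rewrite Cmod_mult.
  assert (B : Cmod (CInt (fun u => G u * cexp (- (om * edge a u) * RtoC s))%C 0 1)
     <= 2 * (M * exp (- (kappa * a) * s)) * (1 - 0)).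
  { apply CInt_bound; [lra | now apply laplace_kernel_cont | ].
    intros u Hu. rewrite Cmod_mult, Cmod_cexp. apply Rmult_le_compat; auto using Cmod_ge_0; [left; apply exp_pos | ].
    replace (Re (- (om * edge a u) * RtoC s)%C) with (- Re (om * edge a u)%C * s) by (unfold Re, Im; simpl; ring).
    assert (T := Re_om_edge a kappa om u Ha Hre Him Hu).
    assert (T' : - Re (om * edge a u)%C * s <= - (kappa * a) * s) by nra.
    now apply exp_le. }
  assert (0 < exp (- (kappa * a) * s)) by apply exp_pos.
  apply Rle_trans with (Cmod om * (2 * (M * exp (- (kappa * a) * s)) * (1 - 0))).
  - now apply Rmult_le_compat_l.
  - nra.
Qed.

(* [laplace_density] integrates [1 / (zeta - w) = int_0^oo om e^{- om s (zeta - w)} ds] against [G];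
   differentiating the remainder avoids exchanging the two integrals. *)
Lemma laplace_density_transform a kappa G om (w : C) :
  0 < a -> kappa <= Re om -> kappa <= - Im om -> Ccont_on G 0 1 ->
  Re (om * w)%C < kappa * a -> Re w + Im w < a ->
  is_Clim (fun n => CInt (fun s => laplace_density a G om s * cexp (om * w * RtoC s))%C 0 (INR n))
    (CInt (fun u => G u * / (edge a u - w))%C 0 1).
Proof.
  intros Ha Hre Him HG Hw Hwa.
  set (H := fun u => (G u * / (edge a u - w))%C).
  assert (HH : Ccont_on H 0 1).
  { intros u Hu. apply Ccontp_mult; [now apply HG | ].
    apply Ccontp_inv; [now apply edge_neq | apply edge_sub_cont]. }
  (* [K s] is what remains of the half-line integral beyond [s]: [K 0] is the claimed limit, and [K]
     decays like [e^(- d s)] with [d = kappa a - Re (om w)]. *)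
  set (K := fun s : R => CInt (fun u => H u * cexp (- (om * (edge a u - w)) * RtoC s))%C 0 1).
  assert (HK : forall s, Cder (fun s => - 1 * K s)%C s (laplace_density a G om s * cexp (om * w * RtoC s))%C).
  { intros s. eapply Cder_eq; [apply Cder_scal, (Cder_exp_CInt a om H w s HH) | ].
    assert (C1 : Ccont_on (fun u => - (om * (edge a u - w)) * (H u * cexp (- (om * (edge a u - w)) * s)))%C 0 1).
    { intros u Hu. ccont. }
    etransitivity; [symmetry; apply (CInt_scal (- 1)%C _ 0 1 Rle_0_1 C1) | ].
    transitivity (om * cexp (om * w * s) * CInt (fun u => G u * cexp (- (om * edge a u) * RtoC s)) 0 1)%C;
      [ | unfold laplace_density; ring].
    rewrite <- (CInt_scal (om * cexp (om * w * s))%C _ 0 1 Rle_0_1 (laplace_kernel_cont a G om s HG)).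
    apply CInt_ext; [lra | ]. intros u Hu.
    replace (- (om * (edge a u - w)) * s)%C with (om * w * s + - (om * edge a u) * s)%C by ring.
    rewrite cexp_plus. unfold H. field. now apply edge_neq. }
  intros eps Heps.
  destruct (Ccont_on_bounded H 0 1) as [M [HM HMb]]; [lra | exact HH | ].
  set (d := kappa * a - Re (om * w)%C). assert (Hd : 0 < d) by (unfold d; lra).
  destruct (pow_lt_1_zero (exp (- d))) with (y := eps / (2 * M)) as [N HN].
  { rewrite Rabs_right by (left; apply exp_pos). rewrite <- exp_0. apply exp_increasing. lra. }
  { apply Rdiv_lt_0_compat; lra. }
  exists N. intros n Hn. assert (P := pos_INR n).
  rewrite (CInt_derive (fun s => - 1 * K s)%C); [ | lra | intros u _; apply HK | ].
  2: { intros u _. apply Ccontp_mult; [now apply laplace_density_cont | ]. eapply Cder_cont, Cder_cexp_lin. }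
  assert (E0 : K 0 = CInt H 0 1).
  { unfold K. apply CInt_ext; [lra | ]. intros u _. rewrite Cmult_0_r, cexp_0. ring. }
  fold H. rewrite <- E0.
  replace (- 1 * K (INR n) - - 1 * K 0 - K 0)%C with (- K (INR n))%C by ring. rewrite Cmod_opp.
  specialize (HN n Hn). rewrite Rabs_right in HN by (apply Rle_ge, pow_le; left; apply exp_pos).
  rewrite exp_pow_INR in HN.
  apply Rle_lt_trans with (2 * (M * exp (- d * INR n)) * (1 - 0)).
  - apply CInt_bound; [lra | | ].
    + intros u Hu. ccont.
    + intros u Hu. rewrite Cmod_mult, Cmod_cexp. apply Rmult_le_compat; auto using Cmod_ge_0; [left; apply exp_pos | ].
      replace (Re (- (om * (edge a u - w)) * RtoC (INR n))%C) with ((Re (om * w)%C - Re (om * edge a u)%C) * INR n)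
        by (unfold Re, Im; simpl; ring).
      assert (T := Re_om_edge a kappa om u Ha Hre Him Hu).
      assert (T' : (Re (om * w)%C - Re (om * edge a u)%C) * INR n <= - d * INR n) by (unfold d; nra).
      now apply exp_le.
  - apply Rmult_lt_compat_l with (r := 2 * M) in HN; [ | lra].
    replace (2 * M * (eps / (2 * M))) with eps in HN by (field; lra). lra.
Qed.

Lemma laplace_functional_weaken b K K' I : K <= K' -> laplace_functional b K I -> laplace_functional b K' I.
Proof.
  intros HK [H1 [H2 H3]]. split; [exact H1 | split; [exact H2 | ]]. intros g G Hg.
  apply Rle_trans with (1 := H3 g G Hg). apply Rmult_le_compat_r; [ | exact HK].
  destruct Hg as [_ Hg]. specialize (Hg 0 (Rle_refl 0)). rewrite Rmult_0_r, exp_0 in Hg.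
  generalize (Cmod_ge_0 (g 0)); lra.
Qed.

(* Slopes making [Re (om * zeta) >= kappa a > |Re (om * x)|] on each edge, with [Re (om^2) > 0]. *)
Definition edge_slope (kappa : R) (k : nat) : C :=
  match k with O => (1, - kappa) | 1%nat => (kappa, -1) | 2%nat => (1, - kappa) | _ => (kappa, -1) end.

(** Cauchy's formula, each side being rotated onto the first one before its Laplace representation.
    Since [|Re om| <= 1], the exponentials grow at most like [e^s] for [x] in [[-1, 1]]; having
    [b > 1] leaves room for powers of [s] and for [|x|] slightly above 1. *)
Lemma laplace_representation (r : R) (f : C -> C) : 1 < r -> holomorphic_on_disk r f ->
  exists (b K : R) (om : nat -> C) (I : nat -> (R -> C) -> C), 1 < b /\ 0 < K /\
    (forall k, Rabs (Re (om k)) <= 1 /\ 0 < Re (om k * om k)%C /\ laplace_functional b K (I k)) /\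
    forall x, -1 <= x <= 1 -> f (RtoC x) = sum4 (fun k => I k (fun s => cexp (om k * RtoC x * RtoC s)%C)).
Proof.
  intros Hr Hf.
  (* Successive midpoints: [1 < a < r], then [1 / a < kappa < 1], then [1 < b < kappa a]. *)
  set (a := (1 + r) / 2). assert (Ha1 : 1 < a) by (unfold a; lra). assert (Har : a < r) by (unfold a; lra).
  set (kappa := (1 + / a) / 2).
  assert (Hia : 0 < / a) by (apply Rinv_0_lt_compat; lra).
  assert (Hia1 : / a < 1) by (rewrite <- Rinv_1; apply Rinv_lt_contravar; lra).
  assert (Hk0 : 0 < kappa) by (unfold kappa; lra). assert (Hk1 : kappa < 1) by (unfold kappa; lra).
  assert (Hka : kappa * a = (a + 1) / 2) by (unfold kappa; field; lra).
  set (b := (1 + kappa * a) / 2).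
  assert (Hb1 : 1 < b) by (unfold b; lra). assert (Hb : b < kappa * a) by (unfold b; lra).
  pose (G := fun k u => (f (quad k * edge a u) * edge_dir a)%C).
  assert (HG : forall k, Ccont_on (G k) 0 1).
  { intros k u Hu. apply Ccontp_mult; [ | apply Ccontp_const].
    apply (holomorphic_comp_cont r f _ _ Hf).
    - apply Ccontp_mult; [apply Ccontp_const | apply Ccontp_edge].
    - rewrite Cmod_mult, Cmod_quad. generalize (Cmod_edge a u ltac:(lra) Hu); lra. }
  assert (S1 : forall k, kappa <= Re (edge_slope kappa k)) by (intros [|[|[|k]]]; unfold Re; simpl; lra).
  assert (S2 : forall k, kappa <= - Im (edge_slope kappa k)) by (intros [|[|[|k]]]; unfold Im; simpl; lra).
  pose (F := fun k => laplace_density a (G k) (edge_slope kappa k)).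
  set (c := (/ (0, (2 * PI)%R))%C).
  assert (Hc : ((0, (2 * PI)%R) * c = 1)%C).
  { apply Cinv_r. intros E. apply (f_equal Im) in E. unfold Im in E; simpl in E. generalize PI_RGT_0; lra. }
  pose (I0 := fun k g => Clim (fun n => CInt (fun s => F k s * g s)%C 0 (INR n))).
  assert (HI : forall k, exists K, 0 < K /\ laplace_functional b K (fun g => c * I0 k g)%C).
  { intros k. destruct (laplace_density_bound a kappa (G k) (edge_slope kappa k)) as [M [HM HB]]; auto; [lra | ].
    destruct (half_line_functional (F k) M b (kappa * a) HM Hb) as [L _].
    - intros s. apply laplace_density_cont, HG.
    - exact HB.
    - apply (laplace_functional_scal b _ _ c) in L.
      set (K := Cmod c * (2 * M / (kappa * a - b))) in *.
      exists (Rabs K + 1). split; [generalize (Rabs_pos K); lra | ].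
      apply (laplace_functional_weaken b K); [generalize (Rle_abs K); lra | exact L]. }
  destruct (HI 0%nat) as [K0 [P0 L0]], (HI 1%nat) as [K1 [P1 L1]], (HI 2%nat) as [K2 [P2 L2]], (HI 3%nat) as [K3 [P3 L3]].
  (* Truncating the index at 3 makes the bounds hold for every [k] with a common constant. Rotated
     by [Cconj (quad k)], the slopes are [1 - i kappa], [-1 - i kappa], [-1 + i kappa] and
     [1 + i kappa], whose squares have real part [1 - kappa^2]. *)
  exists b, (K0 + K1 + K2 + K3),
    (fun k => let k := Nat.min k 3 in edge_slope kappa k * Cconj (quad k))%C,
    (fun k g => let k := Nat.min k 3 in c * I0 k g)%C.
  split; [exact Hb1 | ]. split; [lra | ]. split.
  - intros k. split; [ | split].
    + destruct k as [|[|[|k]]]; unfold Re, Im; simpl; apply Rabs_le; lra.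
    + assert (0 < 1 - kappa * kappa) by nra.
      destruct k as [|[|[|k]]]; unfold Re, Im; simpl;
      match goal with |- 0 < ?X => replace X with (1 - kappa * kappa) by ring end; assumption.
    + assert (W : forall j K, K <= K0 + K1 + K2 + K3 -> laplace_functional b K (fun g => c * I0 j g)%C ->
        Nat.min k 3 = j -> laplace_functional b (K0 + K1 + K2 + K3) (fun g => let k := Nat.min k 3 in c * I0 k g)%C).
      { intros j K HK L E. cbv zeta. rewrite E. exact (laplace_functional_weaken b K _ _ HK L). }
      destruct (Nat.min k 3) as [|[|[|[|j]]]] eqn:E; [ | | | | lia].
      * apply (W 0%nat K0 ltac:(lra) L0 eq_refl).
      * apply (W 1%nat K1 ltac:(lra) L1 eq_refl).
      * apply (W 2%nat K2 ltac:(lra) L2 eq_refl).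
      * apply (W 3%nat K3 ltac:(lra) L3 eq_refl).
  - intros x Hx.
    assert (HQ : forall k, (k <= 3)%nat ->
      (I0 k (fun s => cexp (edge_slope kappa k * Cconj (quad k) * RtoC x * RtoC s)%C) =
       CInt (fun u => f (quad k * edge a u) * edge_form a (edge_center k x) u) 0 1)%C).
    { intros k Hk.
      assert (T := laplace_density_transform a kappa (G k) (edge_slope kappa k) (edge_center k x)
        ltac:(lra) (S1 k) (S2 k) (HG k)).
      rewrite (CInt_ext _ (fun u => G k u * / (edge a u - edge_center k x))%C) by
        (try lra; intros; unfold G, edge_form; ring).
      apply is_Clim_Clim.
      replace (edge_slope kappa k * Cconj (quad k) * RtoC x)%C with (edge_slope kappa k * edge_center k x)%C
        by (unfold edge_center; ring).
      apply T.
      - apply Rle_lt_trans with 1; [ | lra].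
        clear - Hx Hk0 Hk1. destruct k as [|[|[|k]]]; unfold Re, Im; simpl; lra.
      - apply edge_center_lt; lra. }
    unfold sum4. simpl Nat.min. cbv beta zeta. rewrite !HQ by lia.
    transitivity (c * sum4 (fun k => CInt (fun u => f (quad k * edge a u) * edge_form a (edge_center k x) u) 0 1))%C;
      [ | unfold sum4; ring].
    rewrite (cauchy_square f r a x Hf); [ | lra | lra].
    transitivity (f x * ((0, (2 * PI)%R) * c))%C; [rewrite Hc | ]; ring.
Qed.

(** * Backward heat flow *)

Lemma pow_le_fact_exp m z : 0 <= z -> z ^ m <= INR (fact m) * exp z.
Proof.
  intros Hz. assert (H0 := INR_fact_lt_0 m).
  assert (E : z ^ m / INR (fact m) <= exp z).
  { revert z Hz. clear H0. induction m as [|m IH]; intros z Hz.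
    - simpl. replace (1 / 1) with 1 by field. rewrite <- exp_0. now apply exp_le.
    - assert (D := derive_dominated (fun h => h ^ S m / INR (fact (S m))) exp (fun h => h ^ m / INR (fact m)) exp 0 z Hz).
      cbv beta in D. rewrite pow_i, exp_0 in D by lia. replace (0 / INR (fact (S m))) with 0 in D by (unfold Rdiv; ring). rewrite Rminus_0_r in D.
      eapply Rle_trans; [apply Rle_abs | ]. eapply Rle_trans; [apply D | lra].
      + intros; apply is_derive_pow_fact.
      + intros; apply is_derive_exp.
      + intros u Hu. rewrite Rabs_right; [apply IH; lra | ].
        apply Rle_ge, Rmult_le_pos; [apply pow_le; lra | left; apply Rinv_0_lt_compat, INR_fact_lt_0]. }
  apply Rmult_le_compat_l with (r := INR (fact m)) in E; [ | lra].
  replace (INR (fact m) * (z ^ m / INR (fact m))) with (z ^ m) in E by (field; lra). exact E.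
Qed.

(** One term of the exponential series at [p s / eta]. The parameter [eta] is free: a small rate in
    [m] is paid for by a fast exponential in [s]. *)
Lemma pow_mult_le_exp m p s eta : 0 < eta -> 0 <= p * s -> (p * s) ^ m <= INR (fact m) * eta ^ m * exp (p / eta * s).
Proof.
  intros He Hps.
  assert (H := pow_le_fact_exp m (p / eta * s)).
  replace (p * s) with (eta * (p / eta * s)) by (field; lra). rewrite Rpow_mult_distr.
  assert (0 <= p / eta * s).
  { replace (p / eta * s) with (p * s * / eta) by (field; lra). apply Rmult_le_pos; [lra | left; now apply Rinv_0_lt_compat]. }
  specialize (H H0). assert (0 < eta ^ m) by now apply pow_lt. nra.
Qed.

(* [D m] is the common value of [d_x^p d_t^q psi] for [p + 2 q = m]; the increments are controlled
   to second order, which survives linear functionals, series and one-sided limits. *)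
Definition heat_jet (X : R) (P : R -> Prop) (M d : R) (D : nat -> R -> R -> C) : Prop :=
  (forall m x t, Rabs x <= X -> P t -> Cmod (D m x t) <= M * (INR (fact m) * d ^ m)) /\
  (forall m x x' t, Rabs x <= X -> Rabs x' <= X -> P t ->
     Cmod (D m x' t - D m x t - RtoC (x' - x) * D (S m) x t)%C <= M * (INR (fact (m + 2)) * d ^ (m + 2)) * (x' - x) ^ 2) /\
  (forall m x t t', Rabs x <= X -> P t -> P t' ->
     Cmod (D m x t' - D m x t - RtoC (t' - t) * D (m + 2)%nat x t)%C <= M * (INR (fact (m + 4)) * d ^ (m + 4)) * (t' - t) ^ 2).

Lemma fact_pow_mono m d d' : 0 <= d <= d' -> INR (fact m) * d ^ m <= INR (fact m) * d' ^ m.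
Proof. intros H. apply Rmult_le_compat_l; [apply pos_INR | now apply pow_incr]. Qed.

Lemma heat_jet_weaken X P M M' d d' D : 0 <= M <= M' -> 0 <= d <= d' -> heat_jet X P M d D -> heat_jet X P M' d' D.
Proof.
  intros HM Hd [H1 [H2 H3]].
  assert (A : forall m, M * (INR (fact m) * d ^ m) <= M' * (INR (fact m) * d' ^ m)).
  { intros m. apply Rmult_le_compat; try lra; [ | now apply fact_pow_mono].
    apply Rmult_le_pos; [apply pos_INR | apply pow_le; lra]. }
  split; [ | split].
  - intros. eapply Rle_trans; [now apply H1 | apply A].
  - intros. eapply Rle_trans; [now apply H2 | ]. apply Rmult_le_compat_r; [apply pow2_ge_0 | apply A].
  - intros. eapply Rle_trans; [now apply H3 | ]. apply Rmult_le_compat_r; [apply pow2_ge_0 | apply A].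
Qed.

Lemma heat_jet_plus X P M M' d D D' : heat_jet X P M d D -> heat_jet X P M' d D' ->
  heat_jet X P (M + M') d (fun m x t => D m x t + D' m x t)%C.
Proof.
  intros [H1 [H2 H3]] [G1 [G2 G3]]. split; [ | split]; intros.
  - eapply Rle_trans; [apply Cmod_triangle | ]. rewrite Rmult_plus_distr_r.
    apply Rplus_le_compat; [now apply H1 | now apply G1].
  - match goal with |- Cmod ?z <= _ => replace z with
      ((D m x' t - D m x t - RtoC (x' - x) * D (S m) x t) + (D' m x' t - D' m x t - RtoC (x' - x) * D' (S m) x t))%C by ring end.
    eapply Rle_trans; [apply Cmod_triangle | ]. rewrite !Rmult_plus_distr_r.
    apply Rplus_le_compat; [now apply H2 | now apply G2].
  - match goal with |- Cmod ?z <= _ => replace z with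
      ((D m x t' - D m x t - RtoC (t' - t) * D (m + 2)%nat x t) + (D' m x t' - D' m x t - RtoC (t' - t) * D' (m + 2)%nat x t))%C by ring end.
    eapply Rle_trans; [apply Cmod_triangle | ]. rewrite !Rmult_plus_distr_r.
    apply Rplus_le_compat; [now apply H3 | now apply G3].
Qed.

Lemma heat_jet_opp X P M d D : heat_jet X P M d D -> heat_jet X P M d (fun m x t => - D m x t)%C.
Proof.
  intros [H1 [H2 H3]]. split; [ | split]; intros.
  - rewrite Cmod_opp. now apply H1.
  - match goal with |- Cmod ?z <= _ => replace z with
      (- (D m x' t - D m x t - RtoC (x' - x) * D (S m) x t))%C by ring end. rewrite Cmod_opp. now apply H2.
  - match goal with |- Cmod ?z <= _ => replace z with
      (- (D m x t' - D m x t - RtoC (t' - t) * D (m + 2)%nat x t))%C by ring end. rewrite Cmod_opp. now apply H3.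
Qed.

Lemma heat_jet_subset X X' (P P' : R -> Prop) M d D : X' <= X -> (forall t, P' t -> P t) ->
  heat_jet X P M d D -> heat_jet X' P' M d D.
Proof.
  intros HX HP [H1 [H2 H3]]. split; [ | split]; intros; [apply H1 | apply H2 | apply H3]; auto; lra.
Qed.

Definition heat_kernel (om : C) (T : R) (m : nat) (x t s : R) : C :=
  ((om * RtoC s) ^ m * cexp (om * RtoC x * RtoC s - om * om * RtoC (s * s * (T - t))))%C.

Lemma heat_kernel_cont om T m x t s : Ccontp (heat_kernel om T m x t) s.
Proof.
  assert (Hs : Ccontp RtoC s) by (eapply Cder_cont, Cder_id).
  unfold heat_kernel. ccont; [apply Ccontp_pow; ccont | ].
  eapply Cder_cont, Cder_RtoC. auto_derive; auto.
Qed.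

Lemma Cder_heat_kernel_x om T m t s x :
  Cder (fun x => heat_kernel om T m x t s) x (heat_kernel om T (S m) x t s).
Proof.
  unfold heat_kernel. eapply Cder_eq.
  - apply Cder_scal, Cder_cexp. apply (Cder_minus (fun x => om * RtoC x * RtoC s)%C); [ | apply Cder_const].
    apply (Cder_mult (fun x => om * RtoC x)%C); [apply Cder_scal, Cder_id | apply Cder_const].
  - rewrite Cpow_S. ring.
Qed.

Lemma Cder_heat_kernel_t om T m x s t :
  Cder (fun t => heat_kernel om T m x t s) t (heat_kernel om T (m + 2) x t s).
Proof.
  unfold heat_kernel. eapply Cder_eq.
  - apply Cder_scal, Cder_cexp. apply (Cder_minus (fun _ => om * RtoC x * RtoC s)%C); [apply Cder_const | ].
    apply Cder_scal, Cder_RtoC. auto_derive; [auto | reflexivity].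
  - rewrite Cpow_add_r. replace (s * s * - (1)) with (- (s * s)) by ring. rewrite RtoC_opp, RtoC_mult. simpl. ring.
Qed.

Lemma Cmod_heat_kernel om T m x t s : 0 <= s ->
  Cmod (heat_kernel om T m x t s) =
  (Cmod om * s) ^ m * exp (Re om * x * s - Re (om * om)%C * (s * s * (T - t))).
Proof.
  intros Hs. unfold heat_kernel. rewrite Cmod_mult, Cmod_pow, Cmod_mult, Cmod_R, Cmod_cexp, Rabs_right by lra.
  f_equal. f_equal. unfold Re, Im; simpl; ring.
Qed.

Lemma functional_lin b K I c g1 g2 g3 G1 G2 G3 : laplace_functional b K I ->
  exp_bounded b G1 g1 -> exp_bounded b G2 g2 -> exp_bounded b G3 g3 ->
  I (fun s => g1 s - g2 s - c * g3 s)%C = (I g1 - I g2 - c * I g3)%C.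
Proof.
  intros [H1 [H2 _]] E1 E2 E3.
  assert (S : forall k g G, exp_bounded b G g -> exp_bounded b (Cmod k * G) (fun s => k * g s)%C).
  { intros k g G [A B]. split.
    - intros s. apply Ccontp_mult; [apply Ccontp_const | auto].
    - intros s Hs. rewrite Cmod_mult, Rmult_assoc. apply Rmult_le_compat_l; [apply Cmod_ge_0 | auto]. }
  assert (P : forall g h G H, exp_bounded b G g -> exp_bounded b H h -> exp_bounded b (G + H) (fun s => g s + h s)%C).
  { intros g h G H [A B] [A' B']. split.
    - intros s. apply Ccontp_plus; auto.
    - intros s Hs. eapply Rle_trans; [apply Cmod_triangle | ]. rewrite Rmult_plus_distr_r. apply Rplus_le_compat; auto. }
  assert (F2 := S (- 1)%C g2 G2 E2). assert (F3 := S (- c)%C g3 G3 E3).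
  transitivity (I (fun s => (g1 s + - 1 * g2 s) + - c * g3 s)%C).
  - f_equal. apply functional_extensionality; intros s; ring.
  - rewrite (H1 (fun s => g1 s + - 1 * g2 s)%C (fun s => - c * g3 s)%C _ _ (P _ _ _ _ E1 F2) F3).
    rewrite (H1 g1 _ _ _ E1 F2), (H2 _ _ _ E2), (H2 _ _ _ E3). ring.
Qed.

Lemma Re_mult_bound om x X : Rabs (Re om) <= 1 -> Rabs x <= X -> Re om * x <= X.
Proof.
  intros Hom Hx. eapply Rle_trans; [apply Rle_abs | ]. rewrite Rabs_mult, <- (Rmult_1_l X).
  apply Rmult_le_compat; auto using Rabs_pos.
Qed.

(** For [t <= T] the Gaussian factor has modulus at most 1; the remaining exponential costs [X s],
    and the margin [b - X] absorbs the power of [s]. *)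
Lemma heat_kernel_bounded om T b X m x t : Rabs (Re om) <= 1 -> 0 < Re (om * om)%C -> 0 < X < b ->
  Rabs x <= X -> t <= T ->
  forall s, 0 <= s -> Cmod (heat_kernel om T m x t s) <= INR (fact m) * (Cmod om / (b - X)) ^ m * exp (b * s).
Proof.
  intros Hom Hom2 HX Hx Ht s Hs. rewrite Cmod_heat_kernel by assumption.
  assert (Hm : 0 < Cmod om).
  { apply Cmod_gt_0. intros E. rewrite E, Cmult_0_l in Hom2. simpl in Hom2. lra. }
  assert (P := pow_mult_le_exp m (Cmod om) s (Cmod om / (b - X))).
  replace (Cmod om / (Cmod om / (b - X))) with (b - X) in P by (field; lra).
  replace (b * s) with ((b - X) * s + X * s) by ring. rewrite exp_plus, <- (Rmult_assoc (INR (fact m) * _)).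
  apply Rmult_le_compat; [apply pow_le, Rmult_le_pos; lra | left; apply exp_pos | | ].
  - apply P; [apply Rdiv_lt_0_compat; lra | apply Rmult_le_pos; lra].
  - apply exp_le.
    assert (Q := Re_mult_bound om x X Hom Hx).
    assert (0 <= Re (om * om)%C * (s * s * (T - t))).
    { apply Rmult_le_pos; [lra | ]. apply Rmult_le_pos; [nra | lra]. }
    nra.
Qed.

(** For fixed [s] the kernel is expanded to second order in [x] or in [t], with a remainder bounded
    by a multiple of [e^(b s)]; the functional then transfers the three estimates. *)
Lemma heat_jet_functional om T b X K I : laplace_functional b K I ->
  Rabs (Re om) <= 1 -> 0 < Re (om * om)%C -> 0 < X < b ->
  heat_jet X (fun t => t <= T) K (Cmod om / (b - X)) (fun m x t => I (heat_kernel om T m x t)).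
Proof.
  intros HI Hom Hom2 HX.
  set (d := Cmod om / (b - X)).
  assert (EB : forall m x t, Rabs x <= X -> t <= T -> exp_bounded b (INR (fact m) * d ^ m) (heat_kernel om T m x t)).
  { intros m x t Hx Ht. split; [intros; apply heat_kernel_cont | ]. now apply heat_kernel_bounded. }
  assert (HB := proj2 (proj2 HI)).
  split; [ | split].
  - intros m x t Hx Ht. now apply HB, EB.
  - intros m x x' t Hx Hx' Ht.
    rewrite <- (functional_lin b K I _ _ _ _ _ _ _ HI (EB m x' t Hx' Ht) (EB m x t Hx Ht) (EB (S m) x t Hx Ht)).
    rewrite Rmult_assoc. apply HB. split.
    + intros s. ccont; apply heat_kernel_cont.
    + intros s Hs.
      replace (INR (fact (m + 2)) * d ^ (m + 2) * (x' - x) ^ 2 * exp (b * s))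
        with (INR (fact (m + 2)) * d ^ (m + 2) * exp (b * s) * (x' - x) ^ 2) by ring.
      apply (Ctaylor2 (fun x => heat_kernel om T m x t s) (fun x => heat_kernel om T (S m) x t s)
         (fun x => heat_kernel om T (m + 2) x t s)).
      * intros; apply Cder_heat_kernel_x.
      * intros. replace (m + 2)%nat with (S (S m)) by lia. apply Cder_heat_kernel_x.
      * intros u Hu. apply heat_kernel_bounded; eauto using Rabs_le_between_Rabs.
  - intros m x t t' Hx Ht Ht'.
    rewrite <- (functional_lin b K I _ _ _ _ _ _ _ HI (EB m x t' Hx Ht') (EB m x t Hx Ht) (EB (m + 2)%nat x t Hx Ht)).
    rewrite Rmult_assoc. apply HB. split.
    + intros s. ccont; apply heat_kernel_cont.
    + intros s Hs.
      replace (INR (fact (m + 4)) * d ^ (m + 4) * (t' - t) ^ 2 * exp (b * s))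
        with (INR (fact (m + 4)) * d ^ (m + 4) * exp (b * s) * (t' - t) ^ 2) by ring.
      apply (Ctaylor2 (fun t => heat_kernel om T m x t s) (fun t => heat_kernel om T (m + 2) x t s)
         (fun t => heat_kernel om T (m + 4) x t s)).
      * intros; apply Cder_heat_kernel_t.
      * intros. replace (m + 4)%nat with (m + 2 + 2)%nat by lia. apply Cder_heat_kernel_t.
      * intros u Hu. apply heat_kernel_bounded; auto.
        revert Hu. unfold Rmin, Rmax. destruct Rle_dec; lra.
Qed.

(** Before [T / 2] the factor [e^(- q s^2 T / 2)] dominates every [e^(A s)], so the rate [eta] may
    be taken arbitrarily small in [pow_mult_le_exp]. The constant is the exponential of the maximum
    of [A s - q s^2 T / 2], found by completing the square. *)
Lemma heat_functional_decay om T b X K I eta : laplace_functional b K I -> 0 <= K -> 0 < b ->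
  Rabs (Re om) <= 1 -> 0 < Re (om * om)%C -> 0 < X -> 0 < T -> 0 < eta ->
  exists C, 0 <= C /\ forall m x t, Rabs x <= X -> t <= T / 2 ->
    Cmod (I (heat_kernel om T m x t)) <= C * (INR (fact m) * eta ^ m).
Proof.
  intros HI HK Hb Hom Hom2 HX HT He.
  set (q := Re (om * om)%C) in *.
  set (A := Cmod om / eta + X).
  exists (K * exp (A ^ 2 / (2 * q * T))). split; [apply Rmult_le_pos; [lra | left; apply exp_pos] | ].
  intros m x t Hx Ht.
  rewrite Rmult_assoc. apply (proj2 (proj2 HI)). split; [intros; apply heat_kernel_cont | ].
  intros s Hs. rewrite Cmod_heat_kernel by assumption. fold q.
  assert (P := pow_mult_le_exp m (Cmod om) s eta He (Rmult_le_pos _ _ (Cmod_ge_0 om) Hs)).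
  apply Rle_trans with (INR (fact m) * eta ^ m * exp (Cmod om / eta * s) * exp (Re om * x * s - q * (s * s * (T - t)))).
  - apply Rmult_le_compat_r; [left; apply exp_pos | exact P].
  - rewrite Rmult_assoc, <- exp_plus.
    replace (exp (A ^ 2 / (2 * q * T)) * (INR (fact m) * eta ^ m) * exp (b * s))
      with (INR (fact m) * eta ^ m * exp (A ^ 2 / (2 * q * T) + b * s)) by (rewrite exp_plus; ring).
    apply Rmult_le_compat_l; [apply Rmult_le_pos; [apply pos_INR | apply pow_le; lra] | ].
    apply exp_le.
    assert (Q := Re_mult_bound om x X Hom Hx).
    assert (H1 : q * (s * s * (T / 2)) <= q * (s * s * (T - t))).
    { apply Rmult_le_compat_l; [lra | ]. apply Rmult_le_compat_l; [nra | lra]. }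
    assert (HqT : 0 < q * T) by (apply Rmult_lt_0_compat; lra).
    assert (H2 : A * s - q * (s * s * (T / 2)) <= A ^ 2 / (2 * q * T)).
    { replace (A ^ 2 / (2 * q * T)) with (A * s - q * (s * s * (T / 2)) + (A - q * T * s) ^ 2 / (2 * (q * T))) by (field; lra).
      assert (0 <= (A - q * T * s) ^ 2 / (2 * (q * T))); [ | lra].
      apply Rmult_le_pos; [apply pow2_ge_0 | left; apply Rinv_0_lt_compat; lra]. }
    assert (H3 : Re om * x * s <= X * s) by (apply Rmult_le_compat_r; lra).
    assert (H4 : A * s = Cmod om / eta * s + X * s) by (unfold A; ring).
    assert (0 <= b * s) by (apply Rmult_le_pos; lra). lra.
Qed.

Lemma backward_heat (T r : R) (f : C -> C) : 1 < r -> holomorphic_on_disk r f -> 0 < T ->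
  exists (X M d : R) (D : nat -> R -> R -> C), 1 < X /\ 0 < M /\ 0 < d /\
    heat_jet X (fun t => t <= T) M d D /\
    (forall eta, 0 < eta -> exists C, 0 <= C /\ forall m x t, Rabs x <= X -> t <= T / 2 ->
       Cmod (D m x t) <= C * (INR (fact m) * eta ^ m)) /\
    (forall x, -1 <= x <= 1 -> D 0%nat x T = f (RtoC x)).
Proof.
  intros Hr Hf HT.
  destruct (laplace_representation r f Hr Hf) as [b [K [om [I [Hb [HK [HI Hx]]]]]]].
  (* Taking [X > 1] puts the closed interval [[-1, 1]] inside the open one where two-sided space
     derivatives are available. *)
  set (X := (1 + b) / 2). assert (HX : 1 < X < b) by (unfold X; lra).
  set (J := fun k m x t => I k (heat_kernel (om k) T m x t)).
  assert (Hd : forall k, 0 <= Cmod (om k) / (b - X)).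
  { intros k. apply Rmult_le_pos; [apply Cmod_ge_0 | left; apply Rinv_0_lt_compat; lra]. }
  set (d := 1 + Cmod (om 0%nat) / (b - X) + Cmod (om 1%nat) / (b - X) + Cmod (om 2%nat) / (b - X) + Cmod (om 3%nat) / (b - X)).
  assert (HJ : forall k, (k <= 3)%nat -> heat_jet X (fun t => t <= T) K d (J k)).
  { intros k Hk. destruct (HI k) as [H1 [H2 H3]].
    apply (heat_jet_weaken _ _ K _ (Cmod (om k) / (b - X))); [lra | | ].
    - generalize (Hd 0%nat) (Hd 1%nat) (Hd 2%nat) (Hd 3%nat). unfold d.
      destruct k as [|[|[|[|k]]]]; [ | | | | lia]; lra.
    - apply heat_jet_functional; auto; lra. }
  exists X, (K + K + K + K), d, (fun m x t => J 0%nat m x t + J 1%nat m x t + J 2%nat m x t + J 3%nat m x t)%C.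
  split; [lra | ]. split; [lra | ].
  split. { unfold d. generalize (Hd 0%nat) (Hd 1%nat) (Hd 2%nat) (Hd 3%nat); lra. }
  split; [ | split].
  - repeat apply heat_jet_plus; apply HJ; lia.
  - intros eta He.
    assert (Q : forall k, exists C, 0 <= C /\ forall m x t, Rabs x <= X -> t <= T / 2 ->
       Cmod (J k m x t) <= C * (INR (fact m) * eta ^ m)).
    { intros k. destruct (HI k) as [H1 [H2 H3]]. apply (heat_functional_decay _ _ b X K); auto; lra. }
    destruct (Q 0%nat) as [C0 [P0 Q0]], (Q 1%nat) as [C1 [P1 Q1]], (Q 2%nat) as [C2 [P2 Q2]], (Q 3%nat) as [C3 [P3 Q3]].
    exists (C0 + C1 + C2 + C3). split; [lra | ]. intros m x t Hxx Ht.
    specialize (Q0 m x t Hxx Ht). specialize (Q1 m x t Hxx Ht). specialize (Q2 m x t Hxx Ht). specialize (Q3 m x t Hxx Ht).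
    rewrite !Rmult_plus_distr_r.
    generalize (Cmod_triangle (J 0%nat m x t + J 1%nat m x t + J 2%nat m x t) (J 3%nat m x t)),
      (Cmod_triangle (J 0%nat m x t + J 1%nat m x t) (J 2%nat m x t)), (Cmod_triangle (J 0%nat m x t) (J 1%nat m x t)). lra.
  - intros x Hxx. rewrite (Hx x Hxx). unfold sum4, J.
    assert (E : forall k, heat_kernel (om k) T 0 x T = (fun s => cexp (om k * RtoC x * RtoC s)%C)).
    { intros k. apply functional_extensionality; intros s. unfold heat_kernel.
      replace (s * s * (T - T)) with 0 by ring. simpl Cpow. rewrite Cmult_0_r, Cmult_1_l. f_equal. ring. }
    rewrite !E. reflexivity.
Qed.

(** * A Gevrey cutoff *)

Definition flat (c : R) (m : nat) (t : R) : R :=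
  if Rlt_dec 0 t then (/ t) ^ m * exp (- (c * / t)) else 0.

Lemma flat_nonpos c m t : t <= 0 -> flat c m t = 0.
Proof. intros H. unfold flat. destruct Rlt_dec; lra. Qed.

Lemma flat_pos c m t : 0 < t -> flat c m t = (/ t) ^ m * exp (- (c * / t)).
Proof. intros H. unfold flat. destruct Rlt_dec; lra. Qed.

Lemma flat_bound c m t : 0 < c -> 0 <= flat c m t <= INR (fact m) / c ^ m.
Proof.
  intros Hc. assert (Hcm : 0 < c ^ m) by now apply pow_lt.
  assert (H0 := INR_fact_lt_0 m).
  destruct (Rlt_dec 0 t) as [Ht|Ht].
  - rewrite flat_pos by assumption. assert (Hi : 0 < / t) by now apply Rinv_0_lt_compat.
    assert (P := pow_le_fact_exp m (c * / t) ltac:(nra)). rewrite Rpow_mult_distr in P.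
    rewrite exp_Ropp. assert (E := exp_pos (c * / t)).
    assert (Hm : 0 < (/ t) ^ m) by now apply pow_lt.
    split; [apply Rmult_le_pos; [lra | left; now apply Rinv_0_lt_compat] | ].
    apply Rmult_le_reg_r with (exp (c * / t)); [exact E | ]. rewrite Rmult_assoc, Rinv_l by lra.
    apply Rmult_le_reg_l with (c ^ m); [exact Hcm | ].
    replace (c ^ m * (INR (fact m) / c ^ m * exp (c * / t))) with (INR (fact m) * exp (c * / t)) by (field; lra). lra.
  - rewrite flat_nonpos by lra. split; [lra | ]. left. now apply Rdiv_lt_0_compat.
Qed.

Lemma is_derive_flat c m t : 0 < c -> is_derive (flat c m) t (c * flat c (m + 2) t - INR m * flat c (m + 1) t).
Proof.
  intros Hc. destruct (Rtotal_order t 0) as [Ht|[Ht|Ht]].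
  - rewrite !flat_nonpos by lra. replace (c * 0 - INR m * 0) with 0 by ring.
    apply (is_derive_ext_loc (fun _ => 0)); [ | apply (is_derive_const (K := R_AbsRing) (V := R_NormedModule))].
    exists (mkposreal (- t) ltac:(lra)). intros y Hy.
    change (Rabs (y - t) < - t) in Hy. apply Rabs_def2 in Hy. rewrite flat_nonpos; [reflexivity | lra].
  - subst t. rewrite !flat_nonpos by lra. replace (c * 0 - INR m * 0) with 0 by ring.
    (* For [y > 0], [flat c m y = y^2 flat c (m + 2) y] with a bounded second factor, which gives
       the derivative 0 at the origin. *)
    apply (is_derive_quadratic _ _ _ 1 (INR (fact (m + 2)) / c ^ (m + 2)) Rlt_0_1). intros y _.
    rewrite (flat_nonpos c m 0) by lra. rewrite !Rminus_0_r, Rmult_0_r, Rminus_0_r.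
    destruct (flat_bound c (m + 2) y Hc) as [B1 B2].
    destruct (Rlt_dec 0 y) as [Hy|Hy].
    + replace (flat c m y) with (flat c (m + 2) y * y ^ 2).
      * rewrite Rabs_right by (apply Rle_ge, Rmult_le_pos; [lra | apply pow2_ge_0]).
        apply Rmult_le_compat_r; [apply pow2_ge_0 | lra].
      * rewrite !flat_pos by assumption. rewrite pow_add. field. lra.
    + rewrite flat_nonpos by lra. rewrite Rabs_R0. apply Rmult_le_pos; [lra | apply pow2_ge_0].
  - apply (is_derive_ext_loc (fun t => (/ t) ^ m * exp (- (c * / t)))).
    + exists (mkposreal t Ht). intros y Hy. change (Rabs (y - t) < t) in Hy. apply Rabs_def2 in Hy.
      rewrite flat_pos; [reflexivity | lra].
    + rewrite !flat_pos by assumption. auto_derive; [lra | ].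
      rewrite !pow_add. destruct m as [|m]; simpl; field; lra.
Qed.

(* The functions [g_m = t^(-m) e^(-c/t)] satisfy [g_m' = c g_(m+2) - m g_(m+1)] and [g_m <= m! / c^m], so
   the derivatives of [e^(-c/t)] are bounded by [(2 / c)^k (2 k)!], with [c] as large as needed. *)
Fixpoint flat_derive (c : R) (k m : nat) (t : R) : R :=
  match k with
  | O => flat c m t
  | S k => c * flat_derive c k (m + 2) t - INR m * flat_derive c k (m + 1) t
  end.

Lemma is_derive_flat_derive c k : 0 < c -> forall m t, is_derive (flat_derive c k m) t (flat_derive c (S k) m t).
Proof.
  intros Hc. induction k as [|k IH]; intros m t.
  - now apply is_derive_flat.
  - apply (is_derive_minus (fun t => c * flat_derive c k (m + 2) t)
      (fun t => INR m * flat_derive c k (m + 1) t)); apply is_derive_scal; apply IH.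
Qed.

Lemma flat_derive_nonpos c k : forall m t, t <= 0 -> flat_derive c k m t = 0.
Proof.
  induction k as [|k IH]; intros m t Ht; simpl; [now apply flat_nonpos | ]. rewrite !IH by assumption. ring.
Qed.

(** Each of the two terms of the recursion is at most [2 ^ k * Q], with [Q] the quotient at order
    [k + 1]: in the second term the factor [m] is absorbed by the largest factor of the
    factorial. *)
Lemma flat_derive_bound c k : 0 < c -> forall m t,
  Rabs (flat_derive c k m t) <= 2 ^ k * (INR (fact (m + 2 * k)) / c ^ (m + k)).
Proof.
  intros Hc. induction k as [|k IH]; intros m t.
  - simpl flat_derive. rewrite Nat.mul_0_r, !Nat.add_0_r, pow_O, Rmult_1_l.
    destruct (flat_bound c m t Hc). rewrite Rabs_right; lra.
  - simpl flat_derive.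
    eapply Rle_trans; [apply Rabs_triang | ]. rewrite Rabs_Ropp, !Rabs_mult, (Rabs_right c) by lra.
    rewrite (Rabs_right (INR m)) by (apply Rle_ge, pos_INR).
    assert (H1 := IH (m + 2)%nat t). assert (H2 := IH (m + 1)%nat t).
    set (N := (m + 2 * S k)%nat).
    replace (m + 2 + 2 * k)%nat with N in H1 by (unfold N; lia).
    set (Q := INR (fact N) / c ^ (m + S k)).
    assert (Hcp : forall n, 0 < c ^ n) by (intros; now apply pow_lt).
    assert (E1 : c * (2 ^ k * (INR (fact N) / c ^ (m + 2 + k))) = 2 ^ k * Q).
    { unfold Q. replace (m + 2 + k)%nat with (S (m + S k)) by lia. simpl pow. field. split; [ | lra].
      apply Rgt_not_eq, Hcp. }
    assert (E2 : INR m * (2 ^ k * (INR (fact (m + 1 + 2 * k)) / c ^ (m + 1 + k))) <= 2 ^ k * Q).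
    { unfold Q. replace (m + 1 + k)%nat with (m + S k)%nat by lia.
      replace N with (S (m + 1 + 2 * k)) by (unfold N; lia). rewrite fact_simpl, mult_INR.
      replace (INR m * (2 ^ k * (INR (fact (m + 1 + 2 * k)) / c ^ (m + S k)))) with
        (2 ^ k * (INR m * (INR (fact (m + 1 + 2 * k)) / c ^ (m + S k)))) by ring.
      apply Rmult_le_compat_l; [left; apply pow_lt; lra | ].
      unfold Rdiv. rewrite Rmult_assoc.
      apply Rmult_le_compat_r.
      - left; apply Rmult_lt_0_compat; [apply INR_fact_lt_0 | apply Rinv_0_lt_compat, Hcp].
      - apply le_INR; lia. }
    apply Rmult_le_compat_l with (r := c) in H1; [ | lra].
    apply Rmult_le_compat_l with (r := INR m) in H2; [ | apply pos_INR].
    replace (2 ^ S k * Q) with (2 ^ k * Q + 2 ^ k * Q) by (simpl; ring). lra.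
Qed.

(* The derivative of order [k] of [a i * b j]; the recursion avoids binomial coefficients. *)
Fixpoint leibniz (a b : nat -> R -> C) (k i j : nat) (t : R) : C :=
  match k with
  | O => (a i t * b j t)%C
  | S k => (leibniz a b k (S i) j t + leibniz a b k i (S j) t)%C
  end.

Lemma Cder_leibniz (a b : nat -> R -> C) t : (forall n, Cder (a n) t (a (S n) t)) -> (forall n, Cder (b n) t (b (S n) t)) ->
  forall k i j, Cder (leibniz a b k i j) t (leibniz a b (S k) i j t).
Proof.
  intros Ha Hb. induction k as [|k IH]; intros i j.
  - apply (Cder_mult (a i) (b j)); auto.
  - apply (Cder_plus (leibniz a b k (S i) j) (leibniz a b k i (S j))); apply IH.
Qed.

Lemma fact_mult_le i j : INR (fact i) * INR (fact j) <= INR (fact (i + j)).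
Proof.
  rewrite <- mult_INR. apply le_INR. induction i as [|i IH]; [simpl; lia | ].
  change (S i + j)%nat with (S (i + j)). rewrite !fact_simpl, <- Nat.mul_assoc.
  apply Nat.mul_le_mono; lia.
Qed.

(** Unfolding [k] times produces [2 ^ k] products, each controlled by
    [(2 i)! (2 j)! <= (2 (i + j))!]. *)
Lemma leibniz_bound (a b : nat -> R -> C) A B e t : 0 < e -> 0 <= A -> 0 <= B ->
  (forall n, Cmod (a n t) <= A * (e ^ n * INR (fact (2 * n)))) ->
  (forall n, Cmod (b n t) <= B * (e ^ n * INR (fact (2 * n)))) ->
  forall k i j, Cmod (leibniz a b k i j t) <= A * B * 2 ^ k * (e ^ (k + i + j) * INR (fact (2 * (k + i + j)))).
Proof.
  intros He HA HB Ha Hb. induction k as [|k IH]; intros i j.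
  - simpl leibniz. rewrite Cmod_mult.
    apply Rle_trans with ((A * (e ^ i * INR (fact (2 * i)))) * (B * (e ^ j * INR (fact (2 * j))))).
    + apply Rmult_le_compat; auto using Cmod_ge_0.
    + rewrite pow_O, Nat.add_0_l, pow_add.
      replace (A * (e ^ i * INR (fact (2 * i))) * (B * (e ^ j * INR (fact (2 * j)))))
        with (A * B * (e ^ i * e ^ j) * (INR (fact (2 * i)) * INR (fact (2 * j)))) by ring.
      replace (A * B * 1 * (e ^ i * e ^ j * INR (fact (2 * (i + j)))))
        with (A * B * (e ^ i * e ^ j) * INR (fact (2 * (i + j)))) by ring.
      apply Rmult_le_compat_l.
      * apply Rmult_le_pos; [now apply Rmult_le_pos | ]. rewrite <- pow_add. apply pow_le; lra.
      * replace (2 * (i + j))%nat with (2 * i + 2 * j)%nat by lia. apply fact_mult_le.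
  - simpl leibniz. eapply Rle_trans; [apply Cmod_triangle | ].
    assert (H1 := IH (S i) j). assert (H2 := IH i (S j)).
    replace (k + S i + j)%nat with (S k + i + j)%nat in H1 by lia.
    replace (k + i + S j)%nat with (S k + i + j)%nat in H2 by lia.
    replace (2 ^ S k) with (2 ^ k + 2 ^ k) by (simpl; ring). lra.
Qed.

Lemma leibniz_zero_l (a b : nat -> R -> C) t : (forall n, a n t = 0%C) -> forall k i j, leibniz a b k i j t = 0%C.
Proof.
  intros H. induction k as [|k IH]; intros i j; simpl.
  - rewrite H; ring.
  - rewrite !IH; ring.
Qed.

(** Meant for time 0, where the cutoff agrees with 1 to infinite order. *)
Lemma leibniz_one_l (a b : nat -> R -> C) t : a 0%nat t = 1%C -> (forall n, a (S n) t = 0%C) -> forall k i j,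
  leibniz a b k i j t = match i with O => b (k + j)%nat t | S _ => 0%C end.
Proof.
  intros H0 H1. induction k as [|k IH]; intros i j; simpl.
  - destruct i; [rewrite H0 | rewrite H1]; ring.
  - rewrite !IH. destruct i; [ | ring]. replace (k + S j)%nat with (S (k + j)) by lia. ring.
Qed.

(** One minus the normalised primitive of the bump [e^(- c / t) e^(- c / (T - t))] on [(0, T)],
    extended by 0, whose derivatives are given by [leibniz]. The rate [e] is arbitrary because the
    power series in [x] must converge on all of [[-1, 1]]. *)
Lemma smooth_cutoff T e : 0 < T -> 0 < e ->
  exists (th : nat -> R -> C) (A : R), 0 <= A /\
    (forall n t, Cder (th n) t (th (S n) t)) /\
    th 0%nat 0 = 1%C /\ (forall n, th (S n) 0 = 0%C) /\ (forall n t, T <= t -> th n t = 0%C) /\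
    (forall n t, 0 <= t -> Cmod (th n t) <= A * (e ^ n * INR (fact (2 * n)))).
Proof.
  intros HT He. set (c := 4 / e). assert (Hc : 0 < c) by (unfold c; apply Rdiv_lt_0_compat; lra).
  pose (a := fun n t => RtoC (flat_derive c n 0 t)).
  pose (b := fun n t => RtoC ((-1) ^ n * flat_derive c n 0 (T - t))).
  assert (Ha : forall n t, Cder (a n) t (a (S n) t)).
  { intros n t. apply Cder_RtoC. now apply is_derive_flat_derive. }
  assert (Hb : forall n t, Cder (b n) t (b (S n) t)).
  { intros n t. apply Cder_RtoC.
    replace ((-1) ^ S n * flat_derive c (S n) 0 (T - t)) with ((-1) ^ n * (-1 * flat_derive c (S n) 0 (T - t)))
      by (simpl; ring).
    apply is_derive_scal.
    apply (is_derive_comp (flat_derive c n 0) (fun t => T - t)).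
    - now apply is_derive_flat_derive.
    - auto_derive; auto; ring. }
  pose (rho := fun t => flat c 0 t * flat c 0 (T - t)).
  assert (Hrho : forall t, leibniz a b 0 0 0 t = RtoC (rho t)).
  { intros t. unfold leibniz, a, b, rho. rewrite <- RtoC_mult. f_equal. simpl. ring. }
  assert (Crho : forall t, continuous rho t).
  { intros t. destruct (Cder_cont _ _ _ (Cder_leibniz a b t (fun n => Ha n t) (fun n => Hb n t) 0 0 0)) as [H _].
    apply (continuous_ext (fun u => Re (leibniz a b 0 0 0 u))); [ | exact H].
    intros u. rewrite Hrho. reflexivity. }
  assert (Erho : forall x y, ex_RInt rho x y) by (intros; apply (ex_RInt_continuous (V := R_CompleteNormedModule)); auto).
  assert (Prho : forall t, 0 <= rho t).
  { intros t. apply Rmult_le_pos; apply flat_bound; assumption. }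
  set (Z := RInt rho 0 T).
  assert (HZ : 0 < Z).
  { apply RInt_gt_0; auto. intros t Ht. unfold rho. rewrite !flat_pos by lra. simpl.
    rewrite !Rmult_1_l. apply Rmult_lt_0_compat; apply exp_pos. }
  assert (EZ : forall t, T <= t -> RInt rho 0 t = Z).
  { intros t Ht. rewrite <- (RInt_Chasles rho 0 T t) by apply Erho.
    rewrite (RInt_ext rho (fun _ => 0) T t).
    - rewrite RInt_const. change (RInt rho 0 T + (t - T) * 0 = Z). unfold Z; ring.
    - intros x Hx. rewrite Rmin_left, Rmax_right in Hx by assumption.
      unfold rho. rewrite (flat_nonpos c 0 (T - x)) by lra. apply Rmult_0_r. }
  pose (th := fun n => match n with
     | O => fun t => RtoC (1 - / Z * RInt rho 0 t)
     | S k => fun t => (RtoC (- / Z) * leibniz a b k 0 0 t)%C end).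
  assert (Zb : forall n t, T <= t -> b n t = 0%C).
  { intros n t Ht. unfold b. rewrite flat_derive_nonpos by lra. rewrite Rmult_0_r. reflexivity. }
  assert (Bb : forall n t, Cmod (a n t) <= 1 * ((e / 2) ^ n * INR (fact (2 * n)))).
  { intros n t. unfold a. rewrite Cmod_R. eapply Rle_trans; [now apply flat_derive_bound | ].
    rewrite !Nat.add_0_l. right. replace (e / 2) with (2 * / c) by (unfold c; field; lra).
    rewrite Rpow_mult_distr, pow_inv. unfold Rdiv. ring. }
  assert (Bb' : forall n t, Cmod (b n t) <= 1 * ((e / 2) ^ n * INR (fact (2 * n)))).
  { intros n t. assert (P := Bb n (T - t)). unfold a in P. rewrite Cmod_R in P.
    unfold b. rewrite Cmod_R, Rabs_mult, pow_1_abs, (Rmult_1_l (Rabs _)). exact P. }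
  assert (HZi : 0 < / Z) by (apply Rinv_0_lt_compat; exact HZ).
  assert (Hei : 0 < / e) by (apply Rinv_0_lt_compat; exact He).
  (* The term 1 bounds the cutoff itself. Up to sign, its derivative of order [n + 1] is that of
     order [n] of the bump divided by [Z], and [/ e] makes up for the missing power of [e]. *)
  exists th, (1 + / Z * / e).
  assert (HZe : 0 < / Z * / e) by now apply Rmult_lt_0_compat.
  split; [lra | ]. split; [ | split; [ | split; [ | split]]].
  - intros [|n] t.
    + simpl th. apply Cder_eq with (RtoC (0 - / Z * rho t)).
      * apply Cder_RtoC. apply (is_derive_minus (fun _ => 1) (fun t => / Z * RInt rho 0 t)).
        -- apply (is_derive_const (K := R_AbsRing) (V := R_NormedModule)).
        -- apply is_derive_scal. apply (is_derive_RInt rho _ 0); [ | apply Crho].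
           exists (mkposreal 1 Rlt_0_1). intros y _. apply (RInt_correct (V := R_CompleteNormedModule)), Erho.
      * change (a 0%nat t * b 0%nat t)%C with (leibniz a b 0 0 0 t). rewrite Hrho, <- RtoC_mult. f_equal; ring.
    + apply Cder_scal. apply Cder_leibniz; auto.
  - simpl. rewrite (RInt_point). change (RtoC (1 - / Z * 0) = 1%C). rewrite Rmult_0_r, Rminus_0_r. reflexivity.
  - intros n. change (RtoC (- / Z) * leibniz a b n 0 0 0 = 0)%C. rewrite leibniz_zero_l; [ring | ]. intros k. unfold a. rewrite flat_derive_nonpos by lra. reflexivity.
  - assert (ZL : forall k i j t, T <= t -> leibniz a b k i j t = 0%C).
    { induction k as [|k IH]; intros i j t Ht; simpl; [rewrite Zb by assumption; ring | rewrite !IH by assumption; ring]. }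
    intros [|n] t Ht; simpl th.
    + rewrite EZ by assumption. f_equal. field. lra.
    + rewrite ZL by assumption. ring.
  - intros [|n] t Ht.
    + simpl th. rewrite Cmod_R. simpl pow. simpl fact. rewrite INR_1, !Rmult_1_r.
      assert (0 <= RInt rho 0 t <= Z).
      { assert (N : forall x y, x <= y -> 0 <= RInt rho x y) by (intros; apply RInt_ge_0; auto).
        split; [now apply N | ]. destruct (Rle_dec t T) as [HtT|HtT].
        - unfold Z. rewrite <- (RInt_Chasles rho 0 t T) by apply Erho.
          generalize (N t T HtT). unfold plus; simpl; lra.
        - right. apply EZ; lra. }
      assert (0 <= / Z * RInt rho 0 t <= 1).
      { split; [apply Rmult_le_pos; lra | ]. apply Rmult_le_reg_l with Z; [lra | ].
        rewrite <- Rmult_assoc, Rinv_r by lra. lra. }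
      rewrite Rabs_right by lra. lra.
    + simpl th. rewrite Cmod_mult, Cmod_R, Rabs_Ropp, Rabs_right by lra.
      assert (L := leibniz_bound a b 1 1 (e / 2) t ltac:(lra) ltac:(lra) ltac:(lra) (fun n => Bb n t) (fun n => Bb' n t) n 0 0).
      rewrite !Nat.add_0_r, !Rmult_1_l, <- Rmult_assoc, <- Rpow_mult_distr in L.
      replace (2 * (e / 2)) with e in L by field.
      apply Rle_trans with (/ Z * (e ^ n * INR (fact (2 * n)))); [apply Rmult_le_compat_l; lra | ].
      replace (e ^ S n) with (e * e ^ n) by reflexivity.
      apply Rle_trans with (/ Z * / e * (e * e ^ n * INR (fact (2 * S n)))).
      * replace (/ Z * / e * (e * e ^ n * INR (fact (2 * S n)))) with (/ Z * (e ^ n * INR (fact (2 * S n)))) by (field; lra).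
        apply Rmult_le_compat_l; [lra | ]. apply Rmult_le_compat_l; [apply pow_le; lra | ].
        apply le_INR, fact_le; lia.
      * apply Rmult_le_compat_r; [ | lra].
        apply Rmult_le_pos; [apply Rmult_le_pos; [lra | apply pow_le; lra] | apply pos_INR].
Qed.

(** * Flat control *)

Definition CSeries (a : nat -> C) : C := (Series (fun n => Re (a n)), Series (fun n => Im (a n))).

Definition geometric_bound (K : R) (a : nat -> C) : Prop := forall n, Cmod (a n) <= K * (/ 2) ^ n.

Lemma geometric_series K : is_series (fun n => K * (/ 2) ^ n) (2 * K).
Proof.
  replace (2 * K) with (K * / (1 - / 2)) by field.
  apply (is_series_scal K (fun n => (/ 2) ^ n)). apply is_series_geom.
  rewrite Rabs_right; lra.
Qed.

Lemma geometric_ex_series K a : geometric_bound K a ->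
  ex_series (fun n => Re (a n)) /\ ex_series (fun n => Im (a n)).
Proof.
  intros H. split; apply (ex_series_le (V := R_CompleteNormedModule) _ (fun n => K * (/ 2) ^ n));
    try (eexists; apply geometric_series); intros n; (eapply Rle_trans; [ | apply H]).
  - apply re_le_Cmod.
  - apply Im_le_Cmod.
Qed.

Lemma CSeries_bound K a : geometric_bound K a -> Cmod (CSeries a) <= 4 * K.
Proof.
  intros H.
  assert (A : forall pr : C -> R, (forall z, Rabs (pr z) <= Cmod z) -> Rabs (Series (fun n => pr (a n))) <= 2 * K).
  { intros pr P.
    assert (E : ex_series (fun n => Rabs (pr (a n)))).
    { apply (ex_series_le (V := R_CompleteNormedModule) _ (fun n => K * (/ 2) ^ n)).
      - intros n. change (Rabs (Rabs (pr (a n))) <= K * (/ 2) ^ n). rewrite Rabs_Rabsolu.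
        eapply Rle_trans; [apply P | apply H].
      - eexists; apply geometric_series. }
    eapply Rle_trans; [now apply Series_Rabs | ].
    rewrite <- (is_series_unique _ _ (geometric_series K)).
    apply Series_le; [ | eexists; apply geometric_series].
    intros n; split; [apply Rabs_pos | eapply Rle_trans; [apply P | apply H]]. }
  eapply Rle_trans; [apply Cmod_le_Re_Im | ]. simpl.
  generalize (A Re re_le_Cmod) (A Im Im_le_Cmod). unfold Re, Im; simpl. lra.
Qed.

Lemma CSeries_lin c K1 K2 K3 a1 a2 a3 : geometric_bound K1 a1 -> geometric_bound K2 a2 -> geometric_bound K3 a3 ->
  CSeries (fun n => a1 n - a2 n - RtoC c * a3 n)%C = (CSeries a1 - CSeries a2 - RtoC c * CSeries a3)%C.
Proof.
  intros H1 H2 H3.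
  destruct (geometric_ex_series _ _ H1) as [R1 I1]. destruct (geometric_ex_series _ _ H2) as [R2 I2].
  destruct (geometric_ex_series _ _ H3) as [R3 I3].
  assert (L : forall u v w : nat -> R, ex_series u -> ex_series v -> ex_series w ->
    Series (fun n => u n - v n - c * w n) = Series u - Series v - c * Series w).
  { intros u v w Hu Hv Hw.
    rewrite (Series_minus (fun n => u n - v n) (fun n => c * w n)), (Series_minus u v), (Series_scal_l c w); auto.
    - now apply (ex_series_minus u v).
    - now apply (ex_series_scal_l c w). }
  apply C_eq; simpl.
  - rewrite <- Rminus_0_r, <- (Rmult_0_l (Series (fun n => Im (a3 n)))).
    transitivity (Series (fun n => Re (a1 n) - Re (a2 n) - c * Re (a3 n))).
    + apply Series_ext; intros; unfold Re, Im; simpl; ring.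
    + rewrite L by assumption. ring.
  - transitivity (Series (fun n => Im (a1 n) - Im (a2 n) - c * Im (a3 n))).
    + apply Series_ext; intros; unfold Re, Im; simpl; ring.
    + rewrite L by assumption. ring.
Qed.

Lemma CSeries_shift K a : geometric_bound K a -> CSeries a = (a 0%nat + CSeries (fun n => a (S n)))%C.
Proof.
  intros H. destruct (geometric_ex_series _ _ H) as [H1 H2].
  apply C_eq; simpl.
  - now apply Series_incr_1.
  - now apply Series_incr_1.
Qed.

(** * Power series solutions of the heat equation *)

Lemma fact_plus_le n m : INR (fact (n + m)) <= 2 ^ (n + m) * (INR (fact n) * INR (fact m)).
Proof.
  assert (A : forall s n m, (n + m)%nat = s -> INR (fact s) <= 2 ^ s * (INR (fact n) * INR (fact m))); [ | now apply A].
  clear n m. induction s as [|s IH]; intros n m E.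
  - destruct n, m; try lia. simpl. lra.
  - assert (P : forall k, 1 <= INR (fact k)).
    { intros k. change 1 with (INR 1). apply le_INR, lt_O_fact. }
    destruct n as [|n]; [ | destruct m as [|m]].
    + simpl in E; subst m. change (INR (fact 0)) with 1. rewrite Rmult_1_l.
      assert (1 <= 2 ^ S s) by (apply pow_R1_Rle; lra). generalize (P (S s)); nra.
    + replace (S n) with (S s) by lia. change (INR (fact 0)) with 1. rewrite Rmult_1_r.
      assert (1 <= 2 ^ S s) by (apply pow_R1_Rle; lra). generalize (P (S s)); nra.
    + assert (H1 := IH n (S m) ltac:(lia)). assert (H2 := IH (S n) m ltac:(lia)).
      rewrite (fact_simpl s), mult_INR. replace (INR (S s)) with (INR (S n) + INR (S m)) by (rewrite <- plus_INR; f_equal; lia).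
      apply Rmult_le_compat_l with (r := INR (S n)) in H1; [ | apply pos_INR].
      apply Rmult_le_compat_l with (r := INR (S m)) in H2; [ | apply pos_INR].
      rewrite Rmult_plus_distr_r.
      replace (2 ^ S s * (INR (fact (S n)) * INR (fact (S m)))) with
        (INR (S n) * (2 ^ s * (INR (fact n) * INR (fact (S m)))) + INR (S m) * (2 ^ s * (INR (fact (S n)) * INR (fact m)))).
      * lra.
      * rewrite (fact_simpl n), (fact_simpl m), !mult_INR. simpl pow. ring.
Qed.

(** The rate [/ 4] pays for the [2 ^ (n + m)] of the binomial coefficient and leaves [(/ 2) ^ n],
    for a geometric series in [n], and [(/ 2) ^ m], for the bounds on the jet. *)
Lemma quarter_fact_bound n m : INR (fact (n + m)) * (/ 4) ^ (n + m) / INR (fact n) <= INR (fact m) * (/ 2) ^ m * (/ 2) ^ n.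
Proof.
  assert (H := fact_plus_le n m).
  assert (Hn := INR_fact_lt_0 n).
  apply Rmult_le_reg_r with (INR (fact n)); [exact Hn | ].
  unfold Rdiv. rewrite (Rmult_assoc _ (/ INR (fact n))), Rinv_l, Rmult_1_r by lra.
  assert (Hq : 0 < (/ 4) ^ (n + m)) by (apply pow_lt; lra).
  apply Rmult_le_compat_r with (r := (/ 4) ^ (n + m)) in H; [ | lra].
  replace (INR (fact m) * (/ 2) ^ m * (/ 2) ^ n * INR (fact n))
    with (2 ^ (n + m) * (INR (fact n) * INR (fact m)) * (/ 4) ^ (n + m)); [exact H | ].
  replace (2 ^ (n + m) * (INR (fact n) * INR (fact m)) * (/ 4) ^ (n + m))
    with (INR (fact n) * INR (fact m) * (2 ^ (n + m) * (/ 4) ^ (n + m))) by ring.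
  rewrite <- Rpow_mult_distr. replace (2 * / 4) with (/ 2) by field. rewrite pow_add. ring.
Qed.

Definition monomial (n : nat) (x : R) : R := x ^ n / INR (fact n).

Definition monomial_deriv (i n : nat) (x : R) : R := if (i <=? n)%nat then monomial (n - i) x else 0.

Lemma is_derive_monomial i n x : is_derive (monomial_deriv i n) x (monomial_deriv (S i) n x).
Proof.
  unfold monomial_deriv. destruct (Nat.leb_spec i n) as [H|H].
  - destruct (Nat.leb_spec (S i) n) as [H'|H'].
    + replace (n - i)%nat with (S (n - S i)) by lia. apply is_derive_pow_fact.
    + replace (n - i)%nat with 0%nat by lia.
      apply (is_derive_ext (fun _ => 1)); [intros; unfold monomial; simpl; symmetry; apply Rdiv_1_r | ].
      apply (is_derive_const (K := R_AbsRing) (V := R_NormedModule)).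
  - destruct (Nat.leb_spec (S i) n) as [H'|H']; [lia | ].
    apply (is_derive_const (K := R_AbsRing) (V := R_NormedModule)).
Qed.

Lemma monomial_bound n x : Rabs x <= 1 -> Rabs (monomial n x) <= / INR (fact n).
Proof.
  intros Hx. unfold monomial, Rdiv. rewrite Rabs_mult, <- RPow_abs.
  assert (Hf : 0 < / INR (fact n)) by (apply Rinv_0_lt_compat, INR_fact_lt_0).
  rewrite (Rabs_right (/ _)) by lra. rewrite <- (Rmult_1_l (/ INR (fact n))) at 2.
  apply Rmult_le_compat_r; [lra | ]. rewrite <- (pow1 n). apply pow_incr. split; [apply Rabs_pos | exact Hx].
Qed.

(** The power series in [x] whose [n]-th derivative at 0 is [Z n t], differentiated [m] times. A
    derivative in [x] shifts [Z] by one and, when the derivative of [Z n] is [Z (n + 2)], a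
    derivative in [t] shifts it by two: this is the heat equation. *)
Definition heat_series (Z : nat -> R -> C) (m : nat) (x t : R) : C :=
  CSeries (fun n => Z (n + m)%nat t * RtoC (monomial n x))%C.

(** Second-order Taylor estimates on each term, summed by a geometric bound. The 16 is the 4 of
    [CSeries_bound] times the 4 lost when two derivatives of the monomials shift the geometric
    series by two ranks. *)
Lemma heat_series_jet (Z : nat -> R -> C) (K t0 t1 : R) :
  (forall n t, Cder (Z n) t (Z (n + 2)%nat t)) ->
  (forall n t, t0 <= t <= t1 -> Cmod (Z n t) <= K * (INR (fact n) * (/ 4) ^ n)) ->
  0 <= K -> heat_jet 1 (fun t => t0 <= t <= t1) (16 * K) (/ 2) (heat_series Z).
Proof.
  intros HZ HB HK.
  assert (Q : forall n m z, Cmod z <= K * (INR (fact (n + m)) * (/ 4) ^ (n + m)) ->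
     Cmod z * / INR (fact n) <= K * (INR (fact m) * (/ 2) ^ m) * (/ 2) ^ n).
  { intros n m z Hz. apply Rle_trans with (K * (INR (fact (n + m)) * (/ 4) ^ (n + m)) * / INR (fact n)).
    - apply Rmult_le_compat_r; [left; apply Rinv_0_lt_compat, INR_fact_lt_0 | exact Hz].
    - rewrite !Rmult_assoc. apply Rmult_le_compat_l; [exact HK | ].
      generalize (quarter_fact_bound n m). unfold Rdiv. rewrite !Rmult_assoc. auto. }
  assert (G0 : forall m x t, Rabs x <= 1 -> t0 <= t <= t1 ->
     geometric_bound (K * (INR (fact m) * (/ 2) ^ m)) (fun n => Z (n + m)%nat t * RtoC (monomial n x))%C).
  { intros m x t Hx Ht n. rewrite Cmod_mult, Cmod_R.
    eapply Rle_trans; [ | apply Q, (HB (n + m)%nat t Ht)].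
    apply Rmult_le_compat_l; [apply Cmod_ge_0 | now apply monomial_bound]. }
  assert (G1 : forall m x t, Rabs x <= 1 -> t0 <= t <= t1 ->
     geometric_bound (2 * (K * (INR (fact (S m)) * (/ 2) ^ S m))) (fun n => Z (n + m)%nat t * RtoC (monomial_deriv 1 n x))%C).
  { intros m x t Hx Ht [|n]; unfold monomial_deriv; simpl Nat.leb; cbv iota.
    - rewrite Cmult_0_r, Cmod_0. apply Rmult_le_pos; [ | apply pow_le; lra].
      apply Rmult_le_pos; [lra | ]. apply Rmult_le_pos; [lra | ]. apply Rmult_le_pos; [apply pos_INR | apply pow_le; lra].
    - replace (S n - 1)%nat with n by lia. replace (S n + m)%nat with (n + S m)%nat by lia.
      eapply Rle_trans; [apply (G0 (S m) x t Hx Ht n) | ]. simpl pow. right; field. }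
  (* The series of differentiated monomials has a zero first term; shifting its index gives the next
     member of the family. *)
  assert (E1 : forall m x t, Rabs x <= 1 -> t0 <= t <= t1 ->
     heat_series Z (S m) x t = CSeries (fun n => Z (n + m)%nat t * RtoC (monomial_deriv 1 n x))%C).
  { intros m x t Hx Ht. rewrite (CSeries_shift _ _ (G1 m x t Hx Ht)).
    unfold monomial_deriv at 1. simpl Nat.leb; cbv iota. rewrite Cmult_0_r, Cplus_0_l. unfold heat_series.
    f_equal. apply functional_extensionality; intros n. unfold monomial_deriv. simpl Nat.leb; cbv iota.
    replace (S n - 1)%nat with n by lia. replace (S n + m)%nat with (n + S m)%nat by lia. reflexivity. }
  assert (W : forall m, 0 <= K * (INR (fact m) * (/ 2) ^ m)).
  { intros m. apply Rmult_le_pos; [lra | ]. apply Rmult_le_pos; [apply pos_INR | apply pow_le; lra]. }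
  split; [ | split].
  - intros m x t Hx Ht. eapply Rle_trans; [apply (CSeries_bound _ _ (G0 m x t Hx Ht)) | ].
    generalize (W m); lra.
  - intros m x x' t Hx Hx' Ht. rewrite E1 by assumption. unfold heat_series.
    rewrite <- (CSeries_lin (x' - x) _ _ _ _ _ _ (G0 m x' t Hx' Ht) (G0 m x t Hx Ht) (G1 m x t Hx Ht)).
    replace (16 * K * (INR (fact (m + 2)) * (/ 2) ^ (m + 2)) * (x' - x) ^ 2)
      with (4 * (4 * (K * (INR (fact (m + 2)) * (/ 2) ^ (m + 2))) * (x' - x) ^ 2)) by ring.
    apply CSeries_bound. intros n.
    replace (4 * (K * (INR (fact (m + 2)) * (/ 2) ^ (m + 2))) * (x' - x) ^ 2 * (/ 2) ^ n)
      with (4 * (K * (INR (fact (m + 2)) * (/ 2) ^ (m + 2))) * (/ 2) ^ n * (x' - x) ^ 2) by ring.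
    apply (Ctaylor2 (fun x => Z (n + m)%nat t * RtoC (monomial n x))%C
      (fun x => Z (n + m)%nat t * RtoC (monomial_deriv 1 n x))%C (fun x => Z (n + m)%nat t * RtoC (monomial_deriv 2 n x))%C).
    + intros u _. apply Cder_scal, Cder_RtoC.
      apply (is_derive_ext (monomial_deriv 0 n)); [intros y; unfold monomial_deriv; simpl; now rewrite Nat.sub_0_r | ].
      apply is_derive_monomial.
    + intros u _. apply Cder_scal, Cder_RtoC, is_derive_monomial.
    + intros u Hu.
      assert (Hu1 : Rabs u <= 1) by eauto using Rabs_le_between_Rabs.
      destruct n as [|[|n]]; unfold monomial_deriv; simpl Nat.leb; cbv iota.
      * rewrite Cmult_0_r, Cmod_0. apply Rmult_le_pos; [generalize (W (m + 2)%nat); lra | apply pow_le; lra].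
      * rewrite Cmult_0_r, Cmod_0. apply Rmult_le_pos; [generalize (W (m + 2)%nat); lra | apply pow_le; lra].
      * replace (S (S n) - 2)%nat with n by lia. replace (S (S n) + m)%nat with (n + (m + 2))%nat by lia.
        eapply Rle_trans; [apply (G0 (m + 2)%nat u t Hu1 Ht n) | ].
        replace ((/ 2) ^ S (S n)) with (/ 4 * (/ 2) ^ n) by (simpl; field). right; field.
  - intros m x t t' Hx Ht Ht'. unfold heat_series.
    rewrite <- (CSeries_lin (t' - t) _ _ _ _ _ _ (G0 m x t' Hx Ht') (G0 m x t Hx Ht) (G0 (m + 2)%nat x t Hx Ht)).
    apply Rle_trans with (4 * (K * (INR (fact (m + 4)) * (/ 2) ^ (m + 4)) * (t' - t) ^ 2)).
    + apply CSeries_bound. intros n.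
      replace (K * (INR (fact (m + 4)) * (/ 2) ^ (m + 4)) * (t' - t) ^ 2 * (/ 2) ^ n)
        with (K * (INR (fact (m + 4)) * (/ 2) ^ (m + 4)) * (/ 2) ^ n * (t' - t) ^ 2) by ring.
      apply (Ctaylor2 (fun t => Z (n + m)%nat t * RtoC (monomial n x))%C
        (fun t => Z (n + (m + 2))%nat t * RtoC (monomial n x))%C (fun t => Z (n + (m + 4))%nat t * RtoC (monomial n x))%C).
      * intros u _. eapply Cder_eq; [apply Cder_mult; [apply HZ | apply Cder_const] | ].
        cbv beta. replace (n + (m + 2))%nat with (n + m + 2)%nat by lia. ring.
      * intros u _. eapply Cder_eq; [apply Cder_mult; [apply HZ | apply Cder_const] | ].
        cbv beta. replace (n + (m + 4))%nat with (n + (m + 2) + 2)%nat by lia. ring.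
      * intros u Hu. apply (G0 (m + 4)%nat x u Hx).
        revert Hu. unfold Rmin, Rmax. destruct Rle_dec; lra.
    + replace (16 * K * (INR (fact (m + 4)) * (/ 2) ^ (m + 4)) * (t' - t) ^ 2)
        with (16 * (K * (INR (fact (m + 4)) * (/ 2) ^ (m + 4)) * (t' - t) ^ 2)) by ring.
      assert (0 <= K * (INR (fact (m + 4)) * (/ 2) ^ (m + 4)) * (t' - t) ^ 2)
        by (apply Rmult_le_pos; [apply W | apply pow2_ge_0]). lra.
Qed.

Lemma heat_jet_Cder_x X P M d D m x t : heat_jet X P M d D -> Rabs x < X -> P t ->
  Cder (fun x => D m x t) x (D (S m) x t).
Proof.
  intros [_ [H _]] Hx Ht.
  apply (Cder_quadratic _ _ _ (X - Rabs x) (M * (INR (fact (m + 2)) * d ^ (m + 2)))); [lra | ].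
  intros y Hy. apply H; [lra | | exact Ht].
  replace y with (x + (y - x)) by ring. generalize (Rabs_triang x (y - x)); lra.
Qed.

Lemma heat_jet_Cder_t X (P : R -> Prop) M d D m x t e : heat_jet X P M d D -> Rabs x <= X -> 0 < e ->
  (forall t', Rabs (t' - t) < e -> P t') -> Cder (fun t => D m x t) t (D (m + 2)%nat x t).
Proof.
  intros [_ [_ H]] Hx He HP.
  apply (Cder_quadratic _ _ _ e (M * (INR (fact (m + 4)) * d ^ (m + 4)))); [exact He | ].
  intros y Hy. apply H; auto. apply HP. rewrite Rminus_diag, Rabs_R0. exact He.
Qed.

Lemma sum_n_taylor c h N : sum_n (fun n => c n * monomial n h) N = taylor_sum c h (S N).
Proof.
  induction N as [|N IH].
  - rewrite sum_O. simpl. unfold monomial; simpl. ring.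
  - rewrite sum_Sn, IH. reflexivity.
Qed.

(** The factorial in the derivative bound cancels that of Taylor's formula, so the remainder of
    order [n] is at most [K q^n] and tends to 0. *)
Lemma taylor_series_real (g : nat -> R -> R) K q x : 0 <= q < 1 -> Rabs x <= 1 ->
  (forall n u, Rabs u <= 1 -> is_derive (g n) u (g (S n) u)) ->
  (forall n u, Rabs u <= 1 -> Rabs (g n u) <= K * (INR (fact n) * q ^ n)) ->
  Series (fun n => g n 0 * monomial n x) = g 0%nat x.
Proof.
  intros Hq Hx Hd HB. apply is_series_unique.
  assert (HK : 0 <= K).
  { generalize (HB 0%nat 0 ltac:(rewrite Rabs_R0; lra)) (Rabs_pos (g 0%nat 0)). simpl. lra. }
  change (is_lim_seq (sum_n (fun n => g n 0 * monomial n x)) (g 0%nat x)).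
  apply is_lim_seq_Reals. intros eps Heps.
  destruct (pow_lt_1_zero q) with (y := eps / (K + 1)) as [N HN].
  { rewrite Rabs_right; lra. } { apply Rdiv_lt_0_compat; lra. }
  exists N. intros n Hn. rewrite sum_n_taylor. unfold Rdist. rewrite Rabs_minus_sym.
  assert (Hu : forall u, Rmin 0 x <= u <= Rmax 0 x -> Rabs u <= 1).
  { intros u. apply Rabs_le_between_Rabs; [rewrite Rabs_R0; lra | exact Hx]. }
  assert (T := taylor_bound (S n) g 0 x (K * (INR (fact (S n)) * q ^ S n))).
  rewrite Rminus_0_r in T. eapply Rle_lt_trans; [apply T; auto | ].
  specialize (HN (S n) ltac:(lia)). rewrite Rabs_right in HN by (apply Rle_ge, pow_le; lra).
  assert (Hf := INR_fact_lt_0 (S n)).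
  replace (K * (INR (fact (S n)) * q ^ S n) * (Rabs x ^ S n / INR (fact (S n))))
    with (K * q ^ S n * Rabs x ^ S n) by (field; lra).
  assert (Hx1 : 0 <= Rabs x ^ S n <= 1).
  { split; [apply pow_le, Rabs_pos | ]. rewrite <- (pow1 (S n)). apply pow_incr. split; [apply Rabs_pos | exact Hx]. }
  assert (Hq1 : 0 <= q ^ S n) by (apply pow_le; lra).
  apply Rmult_lt_compat_l with (r := K + 1) in HN; [ | lra].
  replace ((K + 1) * (eps / (K + 1))) with eps in HN by (field; lra).
  assert (0 <= K * q ^ S n) by (apply Rmult_le_pos; lra). nra.
Qed.

(* Flatness: the even and odd x-derivatives at 0 are the time derivatives of psi(0,.) and psi_x(0,.);
   multiplying these two flat outputs by a Gevrey cutoff gives a solution with the same data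
   at time 0 which vanishes for large times. *)
Lemma flat_control (T X M d : R) (D : nat -> R -> R -> C) : 0 < T -> 1 < X ->
  heat_jet X (fun t => t <= T) M d D ->
  (forall eta, 0 < eta -> exists C, 0 <= C /\ forall m x t, Rabs x <= X -> t <= T / 2 ->
       Cmod (D m x t) <= C * (INR (fact m) * eta ^ m)) ->
  exists (M' d' : R) (S : nat -> R -> R -> C), 0 < M' /\ 0 < d' /\
    heat_jet 1 (fun t => 0 <= t <= T) M' d' S /\
    (forall x, Rabs x <= 1 -> S 0%nat x 0 = D 0%nat x 0) /\ (forall x, S 0%nat x T = 0%C).
Proof.
  intros HT HX HD Hdecay.
  (* With rate [/ 64] for the cutoff and for the outputs, the Leibniz rule gives [/ 32] per time
     derivative, below the [(/ 4)^2] that [heat_series_jet] allows for two space derivatives. *)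
  destruct (smooth_cutoff (T / 2) (/ 64) ltac:(lra) ltac:(lra)) as [th [A [HA [T1 [T2 [T3 [T4 T5]]]]]]].
  (* [y n j] is the [j]-th time derivative of [D 0] or of [D 1] at [x = 0], according to the parity
     of [n]; [Z n] is the derivative of order [n / 2] of its product with the cutoff. *)
  pose (y := fun n j t => D (2 * j + n mod 2)%nat 0 t).
  pose (Z := fun n t => leibniz th (y n) (n / 2) 0 0 t).
  assert (R0 : forall X, 0 <= X -> Rabs 0 <= X) by (intros; rewrite Rabs_R0; assumption).
  assert (Hy : forall n j t, t < T -> Cder (y n j) t (y n (S j) t)).
  { intros n j t Ht. unfold y. replace (2 * S j + n mod 2)%nat with (2 * j + n mod 2 + 2)%nat by lia.
    apply (heat_jet_Cder_t X (fun t => t <= T) M d D _ 0 t (T - t) HD); [apply R0; lra | lra | ].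
    intros t' Ht'. apply Rabs_def2 in Ht'. lra. }
  assert (Zflat : forall n t, T / 2 <= t -> Z n t = 0%C).
  { intros n t Ht. apply leibniz_zero_l. intros k. now apply T4. }
  (* The outputs are only known to be differentiable before [T], but the product vanishes from
     [T / 2] on, so the relation holds at every time. *)
  assert (HZ : forall n t, Cder (Z n) t (Z (n + 2)%nat t)).
  { intros n t. destruct (Rle_lt_dec t (T / 2)) as [Ht|Ht].
    - unfold Z. replace (y (n + 2)%nat) with (y n).
      + replace ((n + 2) / 2)%nat with (S (n / 2)).
        * apply Cder_leibniz; [intros; apply T1 | intros; apply Hy; lra].
        * replace (n + 2)%nat with (n + 1 * 2)%nat by lia. rewrite Nat.div_add by lia. lia.
      + unfold y. replace ((n + 2) mod 2)%nat with (n mod 2)%nat; [reflexivity | ].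
        replace (n + 2)%nat with (n + 1 * 2)%nat by lia. now rewrite Nat.Div0.mod_add.
    - rewrite (Zflat (n + 2)%nat t) by lra.
      apply (Cder_quadratic _ _ _ (t - T / 2) 0); [lra | ]. intros u Hu. apply Rabs_def2 in Hu.
      rewrite !Zflat by lra. rewrite Cmult_0_r. unfold Cminus. rewrite Copp_0, !Cplus_0_r, Cmod_0. lra. }
  (* Since [(/ 16)^(2 j) = (/ 64)^j (/ 4)^j], a spare [(/ 4)^j] is left to absorb the factor
     [2 j + 1] of the odd orders. *)
  destruct (Hdecay (/ 16) ltac:(lra)) as [C0 [HC0 HC]].
  assert (Hyb : forall n j t, t <= T / 2 -> Cmod (y n j t) <= C0 * ((/ 64) ^ j * INR (fact (2 * j)))).
  { intros n j t Ht. unfold y. eapply Rle_trans; [apply HC; [apply R0; lra | exact Ht] | ].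
    apply Rmult_le_compat_l; [exact HC0 | ].
    assert (Hp : (n mod 2 < 2)%nat) by (apply Nat.mod_upper_bound; lia).
    assert (Hpow : (/ 16) ^ (2 * j) = (/ 4) ^ j * (/ 64) ^ j).
    { rewrite pow_mult, <- Rpow_mult_distr. f_equal. field. }
    assert (H4 : 0 < (/ 64) ^ j) by (apply pow_lt; lra).
    assert (Hf := INR_fact_lt_0 (2 * j)).
    assert (H41 : (/ 4) ^ j <= 1) by (rewrite <- (pow1 j); apply pow_incr; lra).
    assert (H40 : 0 < (/ 4) ^ j) by (apply pow_lt; lra).
    destruct (n mod 2)%nat as [|[|p]]; [ | | lia].
    - rewrite Nat.add_0_r, Hpow.
      replace (INR (fact (2 * j)) * ((/ 4) ^ j * (/ 64) ^ j)) with ((/ 64) ^ j * INR (fact (2 * j)) * (/ 4) ^ j) by ring.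
      rewrite <- (Rmult_1_r ((/ 64) ^ j * INR (fact (2 * j)))) at 2. apply Rmult_le_compat_l; [ | exact H41].
      left; now apply Rmult_lt_0_compat.
    - rewrite pow_add, Hpow, pow_1. replace (2 * j + 1)%nat with (S (2 * j)) by lia.
      rewrite fact_simpl, mult_INR.
      assert (B : INR (S (2 * j)) * (/ 4) ^ j <= 2).
      { clear. induction j as [|j IH]; [simpl; lra | ].
        replace (INR (S (2 * S j))) with (INR (S (2 * j)) + 2) by (rewrite !S_INR, !mult_INR, !S_INR; simpl; ring).
        assert ((/ 4) ^ j <= 1) by (rewrite <- (pow1 j); apply pow_incr; lra). simpl pow. nra. }
      replace (INR (S (2 * j)) * INR (fact (2 * j)) * ((/ 4) ^ j * (/ 64) ^ j * / 16))
        with ((/ 64) ^ j * INR (fact (2 * j)) * (INR (S (2 * j)) * (/ 4) ^ j * / 16)) by ring.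
      rewrite <- (Rmult_1_r ((/ 64) ^ j * INR (fact (2 * j)))) at 2. apply Rmult_le_compat_l; [ | lra].
      left; now apply Rmult_lt_0_compat. }
  (* The 4 is lost for odd [n], where the available power is [(/ 4)^(n - 1)]. *)
  set (K := 4 * (A * C0)). assert (HK : 0 <= K) by (unfold K; assert (0 <= A * C0) by (now apply Rmult_le_pos); lra).
  assert (HZb : forall n t, 0 <= t <= T -> Cmod (Z n t) <= K * (INR (fact n) * (/ 4) ^ n)).
  { intros n t Ht. destruct (Rle_lt_dec t (T / 2)) as [Ht'|Ht'].
    - unfold Z. eapply Rle_trans; [apply (leibniz_bound th (y n) A C0 (/ 64) t); auto; try lra; intros; apply T5; lra | ].
      rewrite !Nat.add_0_r.
      assert (Hn := Nat.div_mod_eq n 2). set (k := (n / 2)%nat) in *.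
      assert (Hp : (n mod 2 < 2)%nat) by (apply Nat.mod_upper_bound; lia).
      replace (A * C0 * 2 ^ k * ((/ 64) ^ k * INR (fact (2 * k))))
        with (A * C0 * INR (fact (2 * k)) * (2 ^ k * (/ 64) ^ k)) by ring.
      rewrite <- Rpow_mult_distr. replace (2 * / 64) with (/ 4 * / 4 * / 2) by field.
      rewrite !Rpow_mult_distr.
      assert (H2 : (/ 2) ^ k <= 1) by (rewrite <- (pow1 k); apply pow_incr; lra).
      assert (H4 : 0 < (/ 4) ^ k) by (apply pow_lt; lra).
      assert (HAC : 0 <= A * C0) by now apply Rmult_le_pos.
      apply Rle_trans with (A * C0 * INR (fact (2 * k)) * ((/ 4) ^ k * (/ 4) ^ k)).
      + apply Rmult_le_compat_l; [apply Rmult_le_pos; [exact HAC | apply pos_INR] | ].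
        assert (0 < (/ 4) ^ k * (/ 4) ^ k) by now apply Rmult_lt_0_compat. nra.
      + rewrite <- pow_add. replace (k + k)%nat with (2 * k)%nat by lia.
        apply Rle_trans with (A * C0 * (INR (fact n) * (4 * (/ 4) ^ n))).
        * rewrite Rmult_assoc. apply Rmult_le_compat_l; [exact HAC | ].
          apply Rmult_le_compat; [apply pos_INR | apply pow_le; lra | apply le_INR, fact_le; lia | ].
          assert (0 < (/ 4) ^ (2 * k)) by (apply pow_lt; lra).
          rewrite Hn. destruct (n mod 2)%nat as [|[|p]]; [ | | lia].
          -- rewrite Nat.add_0_r. lra.
          -- rewrite pow_add, pow_1. lra.
        * unfold K. right; ring.
    - rewrite Zflat by lra. rewrite Cmod_0. apply Rmult_le_pos; [exact HK | ].
      apply Rmult_le_pos; [apply pos_INR | apply pow_le; lra]. }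
  exists (16 * (K + 1)), (/ 2), (heat_series Z). split; [lra | ]. split; [lra | ]. split; [ | split].
  - apply (heat_jet_weaken _ _ (16 * K) _ (/ 2)); [lra | lra | ]. now apply heat_series_jet.
  - intros x Hx. unfold heat_series.
    assert (E : forall n, Z n 0 = D n 0 0).
    { intros n. unfold Z. rewrite leibniz_one_l by assumption. unfold y. f_equal.
      generalize (Nat.div_mod_eq n 2); lia. }
    transitivity (CSeries (fun n => D n 0%R 0%R * RtoC (monomial n x))%C).
    { f_equal. apply functional_extensionality; intros n. rewrite Nat.add_0_r, E. reflexivity. }
    assert (Hder : forall n u, Rabs u <= 1 -> Cder (fun u => D n u 0) u (D (S n) u 0)).
    { intros n u Hu. apply (heat_jet_Cder_x X (fun t => t <= T) M d); [exact HD | lra | lra]. }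
    assert (Hb : forall n u, Rabs u <= 1 -> Cmod (D n u 0) <= C0 * (INR (fact n) * (/ 16) ^ n)).
    { intros n u Hu. apply HC; lra. }
    (* At time 0 the series is the Taylor series of [D 0 . 0] at the origin, and the rate [/ 16 < 1]
       makes it converge to that function; [pr] stands for the real or the imaginary part. *)
    assert (KS : forall pr : C -> R, (forall z, Rabs (pr z) <= Cmod z) -> (forall z a, pr (z * RtoC a)%C = pr z * a) ->
      (forall g u l, Cder g u l -> is_derive (fun v => pr (g v)) u (pr l)) ->
      Series (fun n => pr (D n 0%R 0%R * RtoC (monomial n x))%C) = pr (D 0%nat x 0)).
    { intros pr P1 P2 P3. rewrite <- (taylor_series_real (fun n u => pr (D n u 0)) C0 (/ 16) x); try lra.
      - apply Series_ext. intros n. apply P2.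
      - intros n u Hu. apply P3, (Hder n u Hu).
      - intros n u Hu. eapply Rle_trans; [apply P1 | now apply Hb]. }
    apply C_eq; apply KS; auto using re_le_Cmod, Im_le_Cmod; try (intros; unfold Re, Im; simpl; ring); intros g u l H; apply H.
  - intros x. unfold heat_series.
    transitivity (CSeries (fun _ => 0%C)).
    { f_equal. apply functional_extensionality; intros n. rewrite Zflat by lra. ring. }
    assert (G : geometric_bound 0 (fun _ => 0%C)) by (intros n; rewrite Cmod_0; lra).
    apply Cmod_eq_0, Rle_antisym; [ | apply Cmod_ge_0]. generalize (CSeries_bound _ _ G); lra.
Qed.

Lemma null_to_target (T r : R) (f : C -> C) : 1 < r -> holomorphic_on_disk r f -> 0 < T ->
  exists (M d : R) (D : nat -> R -> R -> C), 0 < M /\ 0 < d /\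
    heat_jet 1 (fun t => 0 <= t <= T) M d D /\
    (forall x, -1 <= x <= 1 -> D 0%nat x 0 = 0%C) /\ (forall x, -1 <= x <= 1 -> D 0%nat x T = f (RtoC x)).
Proof.
  intros Hr Hf HT.
  destruct (backward_heat T r f Hr Hf HT) as [X [M [d [D [HX [HM [Hd [HD [Hdec HDT]]]]]]]]].
  destruct (flat_control T X M d D HT HX HD Hdec) as [M' [d' [S [HM' [Hd' [HS [HS0 HST]]]]]]].
  exists (M + M'), (d + d'), (fun m x t => D m x t + - S m x t)%C.
  split; [lra | ]. split; [lra | ]. split; [ | split].
  - apply heat_jet_plus.
    + apply (heat_jet_weaken _ _ M _ d); [lra | lra | ].
      apply (heat_jet_subset X _ (fun t => t <= T)); [lra | intros t Ht; lra | exact HD].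
    + apply heat_jet_opp. apply (heat_jet_weaken _ _ M' _ d'); [lra | lra | exact HS].
  - intros x Hx. rewrite HS0 by (apply Rabs_le; lra). ring.
  - intros x Hx. rewrite HST, HDT by assumption. ring.
Qed.

(** * Uniqueness *)

Definition continuous_on_rectangle (a1 a2 b1 b2 : R) (v : R -> R -> R) : Prop :=
  forall x t eps, a1 <= x <= a2 -> b1 <= t <= b2 -> 0 < eps -> exists delta, 0 < delta /\
    forall x' t', a1 <= x' <= a2 -> b1 <= t' <= b2 -> Rabs (x' - x) < delta -> Rabs (t' - t) < delta ->
      Rabs (v x' t' - v x t) < eps.

(** The property that is bisected says that the values on the sub-rectangle dominate all values of
    [v]: if the four quadrants failed, the largest of the four witnesses would exceed [v] on the
    whole sub-rectangle. Continuity at the limit point then shows that the maximum is reached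
    there. *)
Lemma rectangle_max (v : R -> R -> R) a1 a2 b1 b2 : a1 <= a2 -> b1 <= b2 -> continuous_on_rectangle a1 a2 b1 b2 v ->
  exists p q, a1 <= p <= a2 /\ b1 <= q <= b2 /\ forall x t, a1 <= x <= a2 -> b1 <= t <= b2 -> v x t <= v p q.
Proof.
  intros Ha Hb Hv.
  pose (B := fun x1 x2 y1 y2 => forall x t, a1 <= x <= a2 -> b1 <= t <= b2 ->
    exists x' t', x1 <= x' <= x2 /\ y1 <= t' <= y2 /\ v x t <= v x' t').
  destruct (rectangle_bisection B a1 a2 b1 b2 Ha Hb) as [p [q [Hp [Hq H]]]].
  - intros x t Hx Ht. exists x, t. repeat split; lra.
  - intros x1 x2 y1 y2 Sx Sy HB m n.
    apply NNPP. intros N.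
    assert (F : forall u v0 w z, ~ B u v0 w z -> exists x t, (a1 <= x <= a2 /\ b1 <= t <= b2) /\
      forall x' t', u <= x' <= v0 -> w <= t' <= z -> v x' t' < v x t).
    { intros u v0 w z HN. apply NNPP. intros HE. apply HN. intros x t Hx Ht. apply NNPP. intros HE2.
      apply HE. exists x, t. split; [tauto | ]. intros x' t' Hx' Ht'. apply Rnot_le_lt. intros HL.
      apply HE2. exists x', t'. tauto. }
    destruct (F x1 m y1 n) as [p1 [q1 [R1 D1]]]; [tauto | ].
    destruct (F m x2 y1 n) as [p2 [q2 [R2 D2]]]; [tauto | ].
    destruct (F x1 m n y2) as [p3 [q3 [R3 D3]]]; [tauto | ].
    destruct (F m x2 n y2) as [p4 [q4 [R4 D4]]]; [tauto | ].
    pose (z := Rmax (Rmax (v p1 q1) (v p2 q2)) (Rmax (v p3 q3) (v p4 q4))).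
    assert (Hz : exists p q, (a1 <= p <= a2 /\ b1 <= q <= b2) /\ v p q = z).
    { unfold z, Rmax. repeat destruct Rle_dec; eauto. }
    assert (L1 : v p1 q1 <= z /\ v p2 q2 <= z /\ v p3 q3 <= z /\ v p4 q4 <= z).
    { unfold z, Rmax. repeat destruct Rle_dec; lra. }
    destruct Hz as [p7 [q7 [R7 Ez]]].
    destruct (HB p7 q7) as [x' [t' [Hx' [Ht' L]]]]; [tauto | tauto | ].
    destruct (Rle_dec x' m) as [Hm|Hm]; destruct (Rle_dec t' n) as [Hn|Hn].
    + assert (Q := D1 x' t' ltac:(lra) ltac:(lra)). lra.
    + assert (Q := D3 x' t' ltac:(lra) ltac:(lra)). lra.
    + assert (Q := D2 x' t' ltac:(lra) ltac:(lra)). lra.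
    + assert (Q := D4 x' t' ltac:(lra) ltac:(lra)). lra.
  - exists p, q. split; [exact Hp | ]. split; [exact Hq | ]. intros x t Hx Ht.
    apply le_epsilon. intros eps Heps.
    destruct (Hv p q eps Hp Hq Heps) as [d [Hd HC]].
    destruct (H d Hd) as [x1 [x2 [y1 [y2 [Sx [Sy [Px [Py [Dx [Dy HB]]]]]]]]]].
    destruct (HB x t Hx Ht) as [x' [t' [Hx' [Ht' L]]]].
    unfold subinterval in *.
    assert (Q : Rabs (v x' t' - v p q) < eps) by (apply HC; try lra; apply Rabs_def1; lra).
    apply Rabs_def2 in Q. lra.
Qed.

Lemma max_left_derivative (g : R -> R) x l e : 0 < e -> is_derive g x l ->
  (forall y, x - e < y < x -> g y <= g x) -> 0 <= l.
Proof.
  intros He Hg Hmax. apply Rnot_lt_le. intros Hl.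
  destruct (proj1 (is_derive_Reals g x l) Hg (- l)) as [d Hd]; [lra | ].
  set (h := - (Rmin (d / 2) (e / 2))).
  assert (0 < Rmin (d / 2) (e / 2)) by (apply Rmin_pos; [generalize (cond_pos d) | ]; lra).
  assert (Hh1 : Rabs h < d).
  { unfold h. rewrite Rabs_Ropp, Rabs_right by lra. generalize (Rmin_l (d / 2) (e / 2)) (cond_pos d); lra. }
  assert (Hh2 : - e < h < 0) by (unfold h; generalize (Rmin_r (d / 2) (e / 2)); lra).
  specialize (Hd h ltac:(lra) Hh1). apply Rabs_def2 in Hd.
  assert (Q : g (x + h) <= g x) by (apply Hmax; lra).
  assert (Q2 : (g (x + h) - g x) / h < 0) by lra.
  assert (0 <= (g (x + h) - g x) / h); [ | lra].
  replace ((g (x + h) - g x) / h) with ((g x - g (x + h)) * / (- h)) by (field; lra).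
  apply Rmult_le_pos; [lra | left; apply Rinv_0_lt_compat; lra].
Qed.

Lemma max_right_derivative (g : R -> R) x l e : 0 < e -> is_derive g x l ->
  (forall y, x < y < x + e -> g y <= g x) -> l <= 0.
Proof.
  intros He Hg Hmax.
  assert (H := max_left_derivative (fun y => g (- y)) (- x) (- l) e He).
  assert (0 <= - l); [ | lra]. apply H.
  - replace (- l) with (-1 * l) by ring. apply (is_derive_comp g Ropp).
    + rewrite Ropp_involutive. exact Hg.
    + auto_derive; auto; ring.
  - intros y Hy. rewrite Ropp_involutive. apply Hmax. lra.
Qed.

(** If [g2 > 0], then [g1 u >= g2 / 2 * (u - x)] just to the right of [x], whence
    [g (x + h) >= g x + g2 / 4 * h ^ 2], against maximality. *)
Lemma max_second_derivative (g g1 : R -> R) x g2 e : 0 < e ->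
  (forall y, x - e < y < x + e -> is_derive g y (g1 y)) -> is_derive g1 x g2 ->
  (forall y, x - e < y < x + e -> g y <= g x) -> g1 x = 0 /\ g2 <= 0.
Proof.
  intros He Hg Hg1 Hmax.
  assert (E0 : g1 x = 0).
  { apply Rle_antisym.
    - apply (max_right_derivative g x _ e He); [apply Hg; lra | intros; apply Hmax; lra].
    - apply (max_left_derivative g x _ e He); [apply Hg; lra | intros; apply Hmax; lra]. }
  split; [exact E0 | ]. apply Rnot_lt_le. intros Hl.
  destruct (proj1 (is_derive_Reals g1 x g2) Hg1 (g2 / 2)) as [d Hd]; [lra | ].
  set (h := Rmin (d / 2) (e / 2)).
  assert (Hh : 0 < h) by (apply Rmin_pos; [generalize (cond_pos d) | ]; lra).
  assert (Hhd : h < d) by (unfold h; generalize (Rmin_l (d / 2) (e / 2)) (cond_pos d); lra).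
  assert (Hhe : h < e) by (unfold h; generalize (Rmin_r (d / 2) (e / 2)); lra).
  assert (L := derive_dominated (fun y => g2 / 4 * (y - x) ^ 2) g (fun y => g2 / 2 * (y - x)) g1 x (x + h) ltac:(lra)).
  assert (Q : g (x + h) <= g x) by (apply Hmax; lra).
  assert (L' : Rabs (g2 / 4 * (x + h - x) ^ 2 - g2 / 4 * (x - x) ^ 2) <= g (x + h) - g x).
  { apply L.
    - intros u _. auto_derive; auto. field.
    - intros u Hu. apply Hg. lra.
    - intros u Hu. rewrite Rabs_right by nra. destruct (Req_dec u x) as [-> | Hne]; [rewrite E0; lra | ].
      specialize (Hd (u - x) ltac:(lra)). rewrite Rabs_right in Hd by lra. specialize (Hd ltac:(lra)).
      apply Rabs_def2 in Hd. replace (x + (u - x)) with u in Hd by ring. rewrite E0, Rminus_0_r in Hd.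
      replace (g1 u) with (g1 u / (u - x) * (u - x)) by (field; lra). apply Rmult_le_compat_r; lra. }
  assert (P := Rle_abs (g2 / 4 * (x + h - x) ^ 2 - g2 / 4 * (x - x) ^ 2)).
  assert (0 < g2 / 4 * (x + h - x) ^ 2 - g2 / 4 * (x - x) ^ 2); [ | lra].
  replace (g2 / 4 * (x + h - x) ^ 2 - g2 / 4 * (x - x) ^ 2) with (g2 / 4 * h ^ 2) by ring.
  apply Rmult_lt_0_compat; [lra | now apply pow_lt].
Qed.

Lemma continuous_on_rectangle_mult a1 a2 b1 b2 u v :
  continuous_on_rectangle a1 a2 b1 b2 u -> continuous_on_rectangle a1 a2 b1 b2 v ->
  continuous_on_rectangle a1 a2 b1 b2 (fun x t => u x t * v x t).
Proof.
  intros Hu Hv x t eps Hx Ht Heps.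
  set (M := Rabs (u x t) + Rabs (v x t) + 1).
  assert (Pu := Rabs_pos (u x t)). assert (Pv := Rabs_pos (v x t)). assert (HM : 1 <= M) by (unfold M; lra).
  set (e := Rmin 1 (eps / M)).
  assert (He : 0 < e) by (apply Rmin_pos; [lra | apply Rdiv_lt_0_compat; lra]).
  assert (He1 : e <= 1) by apply Rmin_l.
  assert (He2 : e * M <= eps).
  { apply Rle_trans with (eps / M * M); [apply Rmult_le_compat_r; [lra | apply Rmin_r] | right; field; lra]. }
  destruct (Hu x t e Hx Ht He) as [d1 [P1 Q1]]. destruct (Hv x t e Hx Ht He) as [d2 [P2 Q2]].
  exists (Rmin d1 d2). split; [now apply Rmin_pos | ]. intros x' t' Hx' Ht' Dx Dt.
  assert (L1 := Rmin_l d1 d2). assert (L2 := Rmin_r d1 d2).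
  assert (A1 := Q1 x' t' Hx' Ht' ltac:(lra) ltac:(lra)). assert (A2 := Q2 x' t' Hx' Ht' ltac:(lra) ltac:(lra)).
  replace (u x' t' * v x' t' - u x t * v x t) with
    ((u x' t' - u x t) * (v x' t' - v x t) + (u x' t' - u x t) * v x t + u x t * (v x' t' - v x t)) by ring.
  eapply Rle_lt_trans; [apply Rabs_triang | ]. eapply Rle_lt_trans; [apply Rplus_le_compat_r, Rabs_triang | ].
  rewrite !Rabs_mult. apply Rlt_le_trans with (2 := He2). unfold M.
  assert (B1 := Rabs_pos (u x' t' - u x t)). assert (B2 := Rabs_pos (v x' t' - v x t)). nra.
Qed.

Lemma continuity_pt_eps f x eps : continuity_pt f x -> 0 < eps -> exists delta, 0 < delta /\
  forall y, Rabs (y - x) < delta -> Rabs (f y - f x) < eps.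
Proof.
  intros Hf Heps. destruct (Hf eps Heps) as [d [Hd H]]. exists d. split; [exact Hd | ]. intros y Hy.
  destruct (Req_dec x y) as [<- | Hne]; [rewrite Rminus_diag, Rabs_R0; exact Heps | ].
  apply (H y). split; [split; [exact I | exact Hne] | exact Hy].
Qed.

(* At a positive maximum of [U e^(- k x^2 - la t)], a large [k] gives the Robin conditions the sign that
   excludes the boundary, and a large [la] then excludes interior points. When [beta = 0] the quotient
   [alpha / beta] in the choice of [k] is a junk value, but then [U] vanishes on that side. *)
Lemma heat_max_principle (alpha0 beta0 alpha1 beta1 T : R) (U Ux Uxx Ut : R -> R -> R) :
  (alpha0, beta0) <> (0, 0) -> (alpha1, beta1) <> (0, 0) ->
  continuous_on_rectangle (-1) 1 0 T U ->
  (forall x t, -1 <= x <= 1 -> 0 < t < T -> exists g, is_derive g x (Ux x t) /\ forall y, -1 <= y <= 1 -> g y = U y t) ->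
  (forall x t, -1 < x < 1 -> 0 < t < T ->
     is_derive (fun x => Ux x t) x (Uxx x t) /\ is_derive (fun t => U x t) t (Ut x t) /\ Ut x t = Uxx x t) ->
  (forall t, 0 < t < T -> alpha0 * U (-1) t + beta0 * Ux (-1) t = 0 /\ alpha1 * U 1 t + beta1 * Ux 1 t = 0) ->
  (forall x, -1 < x < 1 -> U x 0 = 0) ->
  forall x t, -1 <= x <= 1 -> 0 <= t <= T -> U x t <= 0.
Proof.
  intros Hab0 Hab1 HU HUx Hheat Hbc H0 x0 t0 Hx0 Ht0.
  apply Rnot_lt_le. intros Hpos.
  (* The initial condition is given for interior [x]; continuity extends it to the corners. *)
  assert (H0' : forall x, -1 <= x <= 1 -> U x 0 = 0).
  { intros x Hx. apply NNPP. intros Hne.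
    destruct (HU x 0 (Rabs (U x 0)) Hx ltac:(lra) (Rabs_pos_lt _ Hne)) as [d [Hd HC]].
    set (h := Rmin (d / 2) (/ 2)). assert (Hh : 0 < h) by (apply Rmin_pos; lra).
    assert (Hh1 : h <= / 2) by apply Rmin_r. assert (Hh2 : h <= d / 2) by apply Rmin_l.
    assert (Hx' : exists x', -1 < x' < 1 /\ Rabs (x' - x) < d).
    { destruct (Rle_dec x 0); [exists (x + h) | exists (x - h)]; (split; [lra | apply Rabs_def1; lra]). }
    destruct Hx' as [x' [Hx' Hd']].
    specialize (HC x' 0 ltac:(lra) ltac:(lra) Hd'). rewrite Rminus_diag, Rabs_R0 in HC.
    specialize (HC Hd). rewrite (H0 x' Hx'), Rminus_0_l, Rabs_Ropp in HC. lra. }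
  (* The positive value is moved to a time before [T], so that the maximum is taken where the
     equation and the boundary conditions hold. *)
  assert (Ht1 : exists t1, 0 < t1 < T /\ 0 < U x0 t1).
  { assert (t0 <> 0) by (intros ->; rewrite H0' in Hpos by assumption; lra).
    destruct (HU x0 t0 (U x0 t0) Hx0 Ht0 Hpos) as [d [Hd HC]].
    set (h := Rmin (d / 2) (t0 / 2)). assert (Hh : 0 < h) by (apply Rmin_pos; lra).
    assert (Hh1 : h <= t0 / 2) by apply Rmin_r. assert (Hh2 : h <= d / 2) by apply Rmin_l.
    exists (t0 - h). split; [lra | ].
    specialize (HC x0 (t0 - h) Hx0 ltac:(lra)). rewrite Rminus_diag, Rabs_R0 in HC.
    specialize (HC Hd ltac:(apply Rabs_def1; lra)). apply Rabs_def2 in HC. lra. }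
  clear t0 Ht0 Hpos. destruct Ht1 as [t0 [Ht0 Hpos]].
  set (k := 1 + Rabs (alpha0 / beta0) + Rabs (alpha1 / beta1)).
  assert (Hk : 1 <= k) by (unfold k; generalize (Rabs_pos (alpha0 / beta0)) (Rabs_pos (alpha1 / beta1)); lra).
  (* Exceeds [2 k + 4 k^2], which bounds the ratio [Uxx / U] at an interior maximum of the weighted
     function, whereas a maximum up to time [q] forces [Ut >= la U]. *)
  set (la := 2 * k + 4 * k ^ 2 + 1).
  pose (w := fun x => exp (- k * x ^ 2)). pose (wt := fun t => exp (- la * t)).
  assert (Hw : forall x, 0 < w x) by (intros; apply exp_pos).
  assert (Hwt : forall t, 0 < wt t) by (intros; apply exp_pos).
  assert (Dw : forall x, is_derive w x (- (2 * k * x) * w x)).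
  { intros x. unfold w. auto_derive; auto. ring_simplify. replace (x * (x * 1)) with (x ^ 2) by ring. ring. }
  assert (Dwt : forall t, is_derive wt t (- la * wt t)).
  { intros t. unfold wt. auto_derive; auto. ring. }
  pose (v := fun x t => U x t * w x * wt t).
  assert (Hv : continuous_on_rectangle (-1) 1 0 t0 v).
  { assert (D1 : forall f l u, is_derive f u l -> continuity_pt f u).
    { intros f l u H. apply continuity_pt_filterlim, (ex_derive_continuous (V := R_NormedModule)). now exists l. }
    apply continuous_on_rectangle_mult; [apply continuous_on_rectangle_mult | ].
    - intros x t eps Hx Ht Heps. destruct (HU x t eps Hx ltac:(lra) Heps) as [d [P Q]].
      exists d. split; [exact P | ]. intros x' t' Hx' Ht'. apply Q; lra.
    - intros x t eps _ _ Heps. destruct (continuity_pt_eps w x eps (D1 _ _ _ (Dw x)) Heps) as [d [P Q]].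
      exists d. split; [exact P | ]. intros x' t' _ _ Dx _. now apply Q.
    - intros x t eps _ _ Heps. destruct (continuity_pt_eps wt t eps (D1 _ _ _ (Dwt t)) Heps) as [d [P Q]].
      exists d. split; [exact P | ]. intros x' t' _ _ _ Dt. now apply Q. }
  destruct (rectangle_max v (-1) 1 0 t0 ltac:(lra) ltac:(lra) Hv) as [p [q [Hp [Hq Hmax]]]].
  assert (Hvpos : 0 < v p q).
  { apply Rlt_le_trans with (v x0 t0); [ | apply Hmax; lra].
    unfold v. apply Rmult_lt_0_compat; [apply Rmult_lt_0_compat; auto | auto]. }
  assert (HUpos : 0 < U p q).
  { unfold v in Hvpos. apply Rnot_le_lt. intros HL.
    assert (Q : 0 < w p * wt q) by (apply Rmult_lt_0_compat; auto). nra. }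
  assert (Hq0 : 0 < q).
  { destruct (proj1 Hq) as [Q|Q]; [exact Q | ]. rewrite <- Q, H0' in HUpos by assumption. lra. }
  assert (HqT : 0 < q < T) by lra.
  destruct (Hbc q HqT) as [Hbc0 Hbc1].
  (* [g] continues [U . q] beyond the ends of the interval, so that even there the derivative is an
     ordinary one. *)
  destruct (HUx p q Hp HqT) as [g [Dg Eg]].
  assert (Gm : forall y, -1 <= y <= 1 -> g y * w y <= g p * w p).
  { intros y Hy. rewrite !Eg by assumption. assert (Q := Hmax y q Hy ltac:(lra)). unfold v in Q.
    apply Rmult_le_reg_r with (wt q); [apply Hwt | exact Q]. }
  assert (Dgw : is_derive (fun y => g y * w y) p ((Ux p q - 2 * k * p * U p q) * w p)).
  { replace ((Ux p q - 2 * k * p * U p q) * w p) with (Ux p q * w p + g p * (- (2 * k * p) * w p))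
      by (rewrite Eg by assumption; ring).
    apply (is_derive_mult g w p _ _ Dg (Dw p)). intros; apply Rmult_comm. }
  (* The sign [s] is the outward direction, which treats both ends at once. Up to the positive
     factor [w], the outward derivative of [U w] is [(- s al / be - 2 k) U], negative by the choice
     of [k], whereas a maximum at that end would make it nonnegative. *)
  assert (BC : forall al be s r, (al, be) <> (0, 0) -> al * U p q + be * Ux p q = 0 -> Rabs (al / be) < 2 * k ->
     r = s * (Ux p q - 2 * k * s * U p q) -> s * s = 1 -> r < 0).
  { intros al be s r Hne E Hal -> Hs.
    assert (Hbe : be <> 0).
    { intros ->. apply Hne. f_equal. nra. }
    assert (EU : Ux p q = - (al / be) * U p q).
    { apply Rmult_eq_reg_l with be; [ | exact Hbe]. field_simplify; lra. }
    rewrite EU. apply Rabs_def2 in Hal.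
    replace (s * (- (al / be) * U p q - 2 * k * s * U p q)) with ((- s * (al / be) - 2 * k * (s * s)) * U p q) by ring.
    rewrite Hs. assert (Hs' : s = 1 \/ s = -1).
    { assert (Z : (s - 1) * (s + 1) = 0) by (ring_simplify; replace (s ^ 2) with (s * s) by ring; lra).
      apply Rmult_integral in Z. destruct Z; [left | right]; lra. }
    destruct Hs' as [-> | ->]; nra. }
  destruct (Req_dec p 1) as [Hp1|Hp1].
  { assert (L : 0 <= (Ux p q - 2 * k * p * U p q) * w p).
    { apply (max_left_derivative _ p _ 1 Rlt_0_1 Dgw). intros y Hy. apply Gm. lra. }
    assert (Q : 1 * (Ux p q - 2 * k * 1 * U p q) < 0).
    { apply (BC alpha1 beta1 1 _ Hab1); try ring; [rewrite Hp1; exact Hbc1 | ].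
      unfold k. generalize (Rabs_pos (alpha0 / beta0)) (Rabs_pos (alpha1 / beta1)); lra. }
    rewrite Hp1 in L at 2. assert (Q2 := Hw p). nra. }
  destruct (Req_dec p (-1)) as [Hp2|Hp2].
  { assert (L : (Ux p q - 2 * k * p * U p q) * w p <= 0).
    { apply (max_right_derivative _ p _ 1 Rlt_0_1 Dgw). intros y Hy. apply Gm. lra. }
    assert (Q : -1 * (Ux p q - 2 * k * -1 * U p q) < 0).
    { apply (BC alpha0 beta0 (-1) _ Hab0); try ring; [rewrite Hp2; exact Hbc0 | ].
      unfold k. generalize (Rabs_pos (alpha0 / beta0)) (Rabs_pos (alpha1 / beta1)); lra. }
    rewrite Hp2 in L at 2. assert (Q2 := Hw p). nra. }
  assert (Hpi : -1 < p < 1) by lra.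
  set (e := Rmin (1 - p) (1 + p)). assert (He : 0 < e) by (apply Rmin_pos; lra).
  assert (Hein : forall y, p - e < y < p + e -> -1 < y < 1).
  { intros y Hy. assert (L1 := Rmin_l (1 - p) (1 + p)). assert (L2 := Rmin_r (1 - p) (1 + p)). fold e in L1, L2. lra. }
  assert (DU : forall y, -1 < y < 1 -> is_derive (fun x => U x q) y (Ux y q)).
  { intros y Hy. destruct (HUx y q ltac:(lra) HqT) as [g' [Dg' Eg']].
    apply (is_derive_ext_loc g'); [ | exact Dg'].
    exists (mkposreal (Rmin (1 - y) (1 + y)) ltac:(apply Rmin_pos; lra)). intros z Hz.
    change (Rabs (z - y) < Rmin (1 - y) (1 + y)) in Hz.
    assert (L1 := Rmin_l (1 - y) (1 + y)). assert (L2 := Rmin_r (1 - y) (1 + y)).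
    apply Rabs_def2 in Hz. apply Eg'. lra. }
  destruct (Hheat p q Hpi HqT) as [DUx [DUt Eheat]].
  pose (G := fun y => U y q * w y).
  pose (G1 := fun y => (Ux y q - 2 * k * y * U y q) * w y).
  destruct (max_second_derivative G G1 p ((Uxx p q - (2 * k * U p q + 2 * k * p * Ux p q)) * w p +
    (Ux p q - 2 * k * p * U p q) * (- (2 * k * p) * w p)) e He) as [M1 M2].
  { intros y Hy. unfold G, G1.
    replace ((Ux y q - 2 * k * y * U y q) * w y) with (Ux y q * w y + U y q * (- (2 * k * y) * w y)) by ring.
    apply (is_derive_mult (fun x => U x q) w y _ _ (DU y (Hein y Hy)) (Dw y)). intros; apply Rmult_comm. }
  { apply (is_derive_mult (fun y => Ux y q - 2 * k * y * U y q) w p _ _); [ | apply Dw | intros; apply Rmult_comm].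
    apply (is_derive_minus (fun y => Ux y q) (fun y => 2 * k * y * U y q)); [exact DUx | ].
    apply (is_derive_mult (fun y => 2 * k * y) (fun x => U x q) p _ _); [ | apply DU; lra | intros; apply Rmult_comm].
    auto_derive; auto; ring. }
  { intros y Hy. assert (Hy' := Hein y Hy). unfold G. rewrite <- !Eg by lra. apply Gm; lra. }
  unfold G1 in M1. assert (Wp := Hw p).
  assert (E1 : Ux p q = 2 * k * p * U p q).
  { apply Rmult_integral in M1. destruct M1; lra. }
  assert (Dvt : 0 <= (Ut p q - la * U p q) * wt q).
  { apply (max_left_derivative (fun t => U p t * wt t) q _ q Hq0).
    - replace ((Ut p q - la * U p q) * wt q) with (Ut p q * wt q + U p q * (- la * wt q)) by ring.
      apply (is_derive_mult (fun t => U p t) wt q _ _ DUt (Dwt q)). intros; apply Rmult_comm.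
    - intros t Ht. assert (Q := Hmax p t Hp ltac:(lra)). unfold v in Q.
      apply Rmult_le_reg_r with (w p); [exact Wp | ]. lra. }
  assert (F1 : la * U p q <= Ut p q).
  { assert (Q := Hwt q). apply Rnot_lt_le. intros L. nra. }
  assert (F2 : Uxx p q <= (2 * k + 4 * k ^ 2 * p ^ 2) * U p q).
  { rewrite E1 in M2. apply Rnot_lt_le. intros L.
    assert (Z : 0 < (Uxx p q - (2 * k + 4 * k ^ 2 * p ^ 2) * U p q) * w p) by (apply Rmult_lt_0_compat; lra).
    replace ((Uxx p q - (2 * k * U p q + 2 * k * p * (2 * k * p * U p q))) * w p +
      (2 * k * p * U p q - 2 * k * p * U p q) * (- (2 * k * p) * w p))
      with ((Uxx p q - (2 * k + 4 * k ^ 2 * p ^ 2) * U p q) * w p) in M2 by ring. lra. }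
  assert (F3 : (2 * k + 4 * k ^ 2 * p ^ 2) * U p q <= (2 * k + 4 * k ^ 2) * U p q).
  { apply Rmult_le_compat_r; [lra | ]. assert (p ^ 2 <= 1) by nra. assert (0 <= 4 * k ^ 2) by nra. nra. }
  unfold la in F1. lra.
Qed.

(** * Conclusion *)

(** Common to one-sided and two-sided derivatives: either filter can converge only to [x], and a
    quadratic remainder is negligible compared with the increment. *)
Lemma filterdiff_quadratic (F : (R -> Prop) -> Prop) (f : R -> C) (x : R) (l : C) (M : R) :
  Filter F ->
  (forall y : R, is_filter_lim (T := R_UniformSpace) F y -> y = x) ->
  (forall d, 0 < d -> F (fun y => Rabs (y - x) < d /\ Cmod (f y - f x - RtoC (y - x) * l)%C <= M * (y - x) ^ 2)) ->
  @filterdiff R_AbsRing R_NormedModule C_R_NormedModule f F (fun h : R => @scal R_AbsRing C_R_NormedModule h l).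
Proof.
  intros FF Hlim H. split.
  - apply (is_linear_scal_l (V := C_R_NormedModule)).
  - intros x' Hx'. apply Hlim in Hx'. subst x'. intros eps.
    destruct (eps_of_quadratic M eps (cond_pos eps)) as [d [Hd Hq]].
    apply (filter_imp (fun y => Rabs (y - x) < d /\ Cmod (f y - f x - RtoC (y - x) * l)%C <= M * (y - x) ^ 2)); [ | now apply H].
    intros y [Hy HQ].
    rewrite <- Cmod_norm, scal_R_Cmult. change (Cmod (f y - f x - RtoC (y - x) * l)%C <= eps * Rabs (y - x)).
    eapply Rle_trans; [exact HQ | now apply Hq].
Qed.

Lemma is_derive_within_quadratic (D : R -> Prop) (f : R -> C) (x : R) (l : C) (M : R) : D x ->
  (forall y, D y -> Cmod (f y - f x - RtoC (y - x) * l)%C <= M * (y - x) ^ 2) -> is_derive_within D f x l.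
Proof.
  intros Hx H. apply (filterdiff_quadratic _ f x l M).
  - apply within_filter, locally_filter.
  (* As [x] lies in [D], it belongs to every set of the filter, which therefore cannot converge to
     another point. *)
  - intros y Hy. apply Rminus_diag_uniq. destruct (Req_dec (y - x) 0) as [E|E]; [exact E | exfalso].
    destruct (Hy (fun z => Rabs (z - y) < Rabs (y - x))) as [d Hd].
    + exists (mkposreal _ (Rabs_pos_lt _ E)). intros z Hz. exact Hz.
    + specialize (Hd x (ball_center x d) Hx). rewrite Rabs_minus_sym in Hd. lra.
  - intros d Hd. exists (mkposreal d Hd). intros y Hy Dy. split; [exact Hy | now apply H].
Qed.

Lemma is_derive_C_quadratic (f : R -> C) (x : R) (l : C) (M d : R) : 0 < d ->
  (forall y, Rabs (y - x) < d -> Cmod (f y - f x - RtoC (y - x) * l)%C <= M * (y - x) ^ 2) ->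
  @is_derive R_AbsRing C_R_NormedModule f x l.
Proof.
  intros Hd H. apply (filterdiff_quadratic _ f x l M).
  - apply locally_filter.
  - intros y Hy. symmetry. now apply (is_filter_lim_locally_unique (K := R_AbsRing) (V := R_NormedModule)).
  - intros d' Hd'. exists (mkposreal _ (Rmin_pos _ _ Hd Hd')). intros y Hy.
    change (Rabs (y - x) < Rmin d d') in Hy. split.
    + eapply Rlt_le_trans; [exact Hy | apply Rmin_r].
    + apply H. eapply Rlt_le_trans; [exact Hy | apply Rmin_l].
Qed.

Lemma filterdiff_eps (F : (R -> Prop) -> Prop) (f : R -> C) (x : R) (l : C) eps :
  @filterdiff R_AbsRing R_NormedModule C_R_NormedModule f F (fun h : R => @scal R_AbsRing C_R_NormedModule h l) ->
  is_filter_lim (T := R_UniformSpace) F x -> Filter F -> 0 < eps ->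
  F (fun y => Cmod (f y - f x - RtoC (y - x) * l)%C <= eps * Rabs (y - x)).
Proof.
  intros [_ H] Hx FF Heps. generalize (H x Hx (mkposreal eps Heps)). apply filter_imp. intros y Hy.
  rewrite <- Cmod_norm, scal_R_Cmult in Hy. exact Hy.
Qed.

Lemma is_derive_within_eps (D : R -> Prop) (f : R -> C) (x : R) (l : C) : is_derive_within D f x l ->
  forall eps, 0 < eps -> exists delta, 0 < delta /\ forall y, D y -> Rabs (y - x) < delta ->
    Cmod (f y - f x - RtoC (y - x) * l)%C <= eps * Rabs (y - x).
Proof.
  intros H eps Heps.
  destruct (filterdiff_eps _ f x l eps H) as [d Hd]; [ | apply within_filter, locally_filter | exact Heps | ].
  - intros P [d Hd]. exists d. intros y Hy _. now apply Hd.
  - exists d. split; [apply cond_pos | ]. intros y Dy Hy. now apply (Hd y Hy).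
Qed.

Lemma is_derive_C_eps (f : R -> C) (x : R) (l : C) : @is_derive R_AbsRing C_R_NormedModule f x l ->
  forall eps, 0 < eps -> exists delta, 0 < delta /\ forall y, Rabs (y - x) < delta ->
    Cmod (f y - f x - RtoC (y - x) * l)%C <= eps * Rabs (y - x).
Proof.
  intros H eps Heps.
  destruct (filterdiff_eps _ f x l eps H (fun P HP => HP)) as [d Hd]; [apply locally_filter | exact Heps | ].
  exists d. split; [apply cond_pos | exact Hd].
Qed.

(** Outside the interval the function is continued by its tangent line at [x], which turns a
    one-sided derivative into the two-sided one that [heat_max_principle] expects. *)
Lemma within_extension (a b x : R) (f : R -> R) (l : R) : a <= x <= b ->
  (forall eps, 0 < eps -> exists delta, 0 < delta /\ forall y, a <= y <= b -> Rabs (y - x) < delta ->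
     Rabs (f y - f x - (y - x) * l) <= eps * Rabs (y - x)) ->
  exists g, is_derive g x l /\ forall y, a <= y <= b -> g y = f y.
Proof.
  intros Hx H.
  exists (fun y => if Rle_dec a y then if Rle_dec y b then f y else f x + (y - x) * l else f x + (y - x) * l).
  split.
  - apply is_derive_eps. intros eps Heps. destruct (H eps Heps) as [d [Hd Hy]]. exists d. split; [exact Hd | ].
    intros y H'. assert (0 <= eps * Rabs (y - x)) by (apply Rmult_le_pos; [lra | apply Rabs_pos]).
    destruct (Rle_dec a x) as [_|]; [ | lra]. destruct (Rle_dec x b) as [_|]; [ | lra].
    assert (Z : Rabs (f x + (y - x) * l - f x - (y - x) * l) <= eps * Rabs (y - x)).
    { replace (f x + (y - x) * l - f x - (y - x) * l) with 0 by ring. now rewrite Rabs_R0. }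
    destruct (Rle_dec a y); [destruct (Rle_dec y b) | ]; try exact Z. apply Hy; lra.
  - intros y Hy. destruct (Rle_dec a y); [ | lra]. destruct (Rle_dec y b); [reflexivity | lra].
Qed.

Lemma continuous_on_eps (x1 x2 t1 t2 : R) (v : R -> R -> C) :
  continuous_on (rectangle x1 x2 t1 t2) (fun z : R * R => v (fst z) (snd z) : C_UniformSpace) ->
  forall x t, rectangle x1 x2 t1 t2 (x, t) -> forall eps, 0 < eps -> exists delta, 0 < delta /\
    forall x' t', rectangle x1 x2 t1 t2 (x', t') -> Rabs (x' - x) < delta -> Rabs (t' - t) < delta ->
      Cmod (v x' t' - v x t) < eps.
Proof.
  intros H x t Hxt eps Heps.
  assert (He : 0 < eps / 2) by lra.
  destruct (H (x, t) Hxt (fun z : C => ball (v x t : C_UniformSpace) (mkposreal _ He) z)) as [d Hd].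
  - exists (mkposreal _ He). intros z Hz. exact Hz.
  - exists d. split; [apply cond_pos | ]. intros x' t' Hxt' Dx Dt.
    destruct (Hd (x', t') (conj Dx Dt) Hxt') as [B1 B2].
    change (Rabs (Re (v x' t') - Re (v x t)) < eps / 2) in B1.
    change (Rabs (Im (v x' t') - Im (v x t)) < eps / 2) in B2.
    eapply Rle_lt_trans; [apply Cmod_le_Re_Im | ].
    change (Rabs (Re (v x' t') - Re (v x t)) + Rabs (Im (v x' t') - Im (v x t)) < eps). lra.
Qed.

Lemma continuous_on_lipschitz (x1 x2 t1 t2 L : R) (v : R -> R -> C) : 0 < L ->
  (forall x t x' t', rectangle x1 x2 t1 t2 (x, t) -> rectangle x1 x2 t1 t2 (x', t') ->
     Cmod (v x' t' - v x t) <= L * (Rabs (x' - x) + Rabs (t' - t))) ->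
  continuous_on (rectangle x1 x2 t1 t2) (fun z : R * R => v (fst z) (snd z) : C_UniformSpace).
Proof.
  intros HL H [x t] Hxt P [e He].
  assert (Hd : 0 < e / (2 * L)) by (apply Rdiv_lt_0_compat; [apply cond_pos | lra]).
  exists (mkposreal _ Hd). intros [x' t'] [Dx Dt] Hxt'. apply He.
  change (Rabs (x' - x) < e / (2 * L)) in Dx. change (Rabs (t' - t) < e / (2 * L)) in Dt.
  assert (Q : Cmod (v x' t' - v x t) < e).
  { eapply Rle_lt_trans; [now apply H | ].
    apply Rlt_le_trans with (L * (e / (2 * L) + e / (2 * L))); [apply Rmult_lt_compat_l; lra | right; field; lra]. }
  split.
  - change (Rabs (Re (v x' t' - v x t)%C) < e). eapply Rle_lt_trans; [apply re_le_Cmod | exact Q].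
  - change (Rabs (Im (v x' t' - v x t)%C) < e). eapply Rle_lt_trans; [apply Im_le_Cmod | exact Q].
Qed.

(** The coefficients being real, the problem splits into real and imaginary parts, represented by
    [pr]; the maximum principle applied to the difference in both orders gives equality. *)
Lemma heat_solution_unique (alpha0 beta0 alpha1 beta1 T : R) (h0 h1 : R -> C) (phi psi : R -> R -> C) :
  (alpha0, beta0) <> (0, 0) -> (alpha1, beta1) <> (0, 0) ->
  heat_solution alpha0 beta0 alpha1 beta1 T h0 h1 phi ->
  heat_solution alpha0 beta0 alpha1 beta1 T h0 h1 psi ->
  forall x t, rectangle (-1) 1 0 T (x, t) -> phi x t = psi x t.
Proof.
  intros Hab0 Hab1 Hphi Hpsi x t Hxt.
  assert (K : forall (pr : C -> R) phi psi,
    (forall z, Rabs (pr z) <= Cmod z) -> (forall z w, pr (z - w)%C = pr z - pr w) ->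
    (forall a z, pr (RtoC a * z)%C = a * pr z) ->
    heat_solution alpha0 beta0 alpha1 beta1 T h0 h1 phi ->
    heat_solution alpha0 beta0 alpha1 beta1 T h0 h1 psi -> pr (phi x t) - pr (psi x t) <= 0).
  { clear phi psi Hphi Hpsi. intros pr phi psi P1 P2 P3 [C1 [fx [fxx [ft [D1 [E1 [B1 I1]]]]]]] [C2 [gx [gxx [gt [D2 [E2 [B2 I2]]]]]]].
    assert (P0 : pr 0%C = 0).
    { transitivity (pr (RtoC 0 * RtoC 0)%C); [f_equal; ring | rewrite P3; ring]. }
    assert (Padd : forall z w, pr (z + w)%C = pr z + pr w).
    { intros z w. transitivity (pr (z - (RtoC 0 - w))%C); [f_equal; ring | rewrite !P2, P0; ring]. }
    assert (Pd : forall f1 f2 l1 l2 x y, Rabs ((pr (f1 y) - pr (f2 y)) - (pr (f1 x) - pr (f2 x)) - (y - x) * (pr l1 - pr l2))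
        <= Cmod (f1 y - f1 x - RtoC (y - x) * l1)%C + Cmod (f2 y - f2 x - RtoC (y - x) * l2)%C).
    { intros f1 f2 l1 l2 u y.
      replace ((pr (f1 y) - pr (f2 y)) - (pr (f1 u) - pr (f2 u)) - (y - u) * (pr l1 - pr l2))
        with (pr (f1 y - f1 u - RtoC (y - u) * l1)%C - pr (f2 y - f2 u - RtoC (y - u) * l2)%C)
        by (rewrite !P2, !P3; ring).
      eapply Rle_trans; [apply Rabs_triang | ]. rewrite Rabs_Ropp. apply Rplus_le_compat; apply P1. }
    assert (Pe : forall f1 f2 l1 l2 x, @is_derive R_AbsRing C_R_NormedModule f1 x l1 ->
       @is_derive R_AbsRing C_R_NormedModule f2 x l2 -> is_derive (fun y => pr (f1 y) - pr (f2 y)) x (pr l1 - pr l2)).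
    { intros f1 f2 l1 l2 u H1 H2. apply is_derive_eps. intros eps Heps.
      destruct (is_derive_C_eps _ _ _ H1 (eps / 2) ltac:(lra)) as [d1 [Q1 R1]].
      destruct (is_derive_C_eps _ _ _ H2 (eps / 2) ltac:(lra)) as [d2 [Q2 R2]].
      exists (Rmin d1 d2). split; [now apply Rmin_pos | ]. intros y Hy.
      eapply Rle_trans; [apply Pd | ].
      assert (S1 := R1 y (Rlt_le_trans _ _ _ Hy (Rmin_l _ _))). assert (S2 := R2 y (Rlt_le_trans _ _ _ Hy (Rmin_r _ _))). lra. }
    apply (heat_max_principle alpha0 beta0 alpha1 beta1 T (fun x t => pr (phi x t) - pr (psi x t))
      (fun x t => pr (fx x t) - pr (gx x t)) (fun x t => pr (fxx x t) - pr (gxx x t))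
      (fun x t => pr (ft x t) - pr (gt x t)) Hab0 Hab1).
    - intros u s eps Hu Hs Heps.
      destruct (continuous_on_eps _ _ _ _ _ C1 u s (conj Hu Hs) (eps / 2) ltac:(lra)) as [d1 [Q1 R1]].
      destruct (continuous_on_eps _ _ _ _ _ C2 u s (conj Hu Hs) (eps / 2) ltac:(lra)) as [d2 [Q2 R2]].
      exists (Rmin d1 d2). split; [now apply Rmin_pos | ]. intros u' s' Hu' Hs' Du Ds.
      assert (L1 := Rmin_l d1 d2). assert (L2 := Rmin_r d1 d2).
      replace (pr (phi u' s') - pr (psi u' s') - (pr (phi u s) - pr (psi u s)))
        with (pr (phi u' s' - phi u s)%C - pr (psi u' s' - psi u s)%C) by (rewrite !P2; ring).
      eapply Rle_lt_trans; [apply Rabs_triang | ]. rewrite Rabs_Ropp.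
      assert (S1 := R1 u' s' (conj Hu' Hs') ltac:(lra) ltac:(lra)).
      assert (S2 := R2 u' s' (conj Hu' Hs') ltac:(lra) ltac:(lra)).
      generalize (P1 (phi u' s' - phi u s)%C) (P1 (psi u' s' - psi u s)%C). lra.
    - intros u s Hu Hs. apply within_extension; [exact Hu | ]. intros eps Heps.
      destruct (is_derive_within_eps _ _ _ _ (D1 u s Hu Hs) (eps / 2) ltac:(lra)) as [d1 [Q1 R1]].
      destruct (is_derive_within_eps _ _ _ _ (D2 u s Hu Hs) (eps / 2) ltac:(lra)) as [d2 [Q2 R2]].
      exists (Rmin d1 d2). split; [now apply Rmin_pos | ]. intros y Hy Dy.
      eapply Rle_trans; [apply (Pd (fun y => phi y s) (fun y => psi y s)) | ].
      assert (S1 := R1 y Hy (Rlt_le_trans _ _ _ Dy (Rmin_l _ _))).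
      assert (S2 := R2 y Hy (Rlt_le_trans _ _ _ Dy (Rmin_r _ _))). lra.
    - intros u s Hu Hs. destruct (E1 u s Hu Hs) as [F1 [F2 F3]]. destruct (E2 u s Hu Hs) as [G1 [G2 G3]].
      split; [now apply (Pe (fun x => fx x s) (fun x => gx x s)) | ].
      split; [now apply (Pe (fun t => phi u t) (fun t => psi u t)) | ].
      apply (f_equal pr) in F3. apply (f_equal pr) in G3. rewrite P2, P0 in F3, G3. lra.
    - intros s Hs. destruct (B1 s Hs) as [F1 F2]. destruct (B2 s Hs) as [G1 G2].
      split.
      + rewrite <- G1 in F1. apply (f_equal pr) in F1. rewrite !Padd, !P3 in F1. lra.
      + rewrite <- G2 in F2. apply (f_equal pr) in F2. rewrite !Padd, !P3 in F2. lra.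
    - intros u Hu. rewrite I1, I2 by assumption. ring.
    - apply Hxt.
    - apply Hxt. }
  assert (KK : forall pr : C -> R, (forall z, Rabs (pr z) <= Cmod z) -> (forall z w, pr (z - w)%C = pr z - pr w) ->
    (forall a z, pr (RtoC a * z)%C = a * pr z) -> pr (phi x t) = pr (psi x t)).
  { intros pr P1 P2 P3. generalize (K pr phi psi P1 P2 P3 Hphi Hpsi) (K pr psi phi P1 P2 P3 Hpsi Hphi). lra. }
  apply C_eq; apply KK; auto using re_le_Cmod, Im_le_Cmod; intros; unfold Re, Im; simpl; ring.
Qed.

Lemma fact_pow_1 p : fact_pow p 1 = INR (fact p).
Proof. apply Rpower_1, INR_fact_lt_0. Qed.

Lemma fact_pow_2 p : fact_pow p 2 = INR (fact p) ^ 2.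
Proof.
  unfold fact_pow. rewrite <- (Rpower_pow 2) by apply INR_fact_lt_0. f_equal; simpl; ring.
Qed.

(** From [(p + 2 q)! <= 2^(p + 2 q) p! (2 q)!] and [(2 q)! <= 4^q q!^2]. The Gevrey radii are thus
    [1 / (2 d)] in space and [1 / (16 d^2)] in time. *)
Lemma gevrey_fact_bound p q d : 0 < d ->
  INR (fact (p + 2 * q)) * d ^ (p + 2 * q) <= INR (fact p) * INR (fact q) ^ 2 * ((2 * d) ^ p * (16 * d ^ 2) ^ q).
Proof.
  intros Hd.
  assert (H1 := fact_plus_le p (2 * q)). assert (H2 := fact_plus_le q q).
  replace (q + q)%nat with (2 * q)%nat in H2 by lia.
  assert (P2 : 0 < 2 ^ (p + 2 * q)) by (apply pow_lt; lra).
  assert (Pd : 0 < d ^ (p + 2 * q)) by now apply pow_lt.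
  assert (Pp := INR_fact_lt_0 p).
  apply Rle_trans with (2 ^ (p + 2 * q) * (INR (fact p) * (2 ^ (2 * q) * (INR (fact q) * INR (fact q)))) * d ^ (p + 2 * q)).
  - apply Rmult_le_compat_r; [lra | ]. eapply Rle_trans; [exact H1 | ].
    apply Rmult_le_compat_l; [lra | ]. apply Rmult_le_compat_l; [lra | exact H2].
  - right. replace (16 * d ^ 2) with ((2 ^ 2 * 2 ^ 2) * d ^ 2) by ring. rewrite !Rpow_mult_distr, !pow_add, !pow_mult. ring.
Qed.

(** On a rectangle with sides of length 2 and [T], the bounds on increments give a Lipschitz
    estimate in each variable. *)
Lemma heat_jet_continuous_on T M d D m : 0 < T -> 0 < M -> 0 < d -> heat_jet 1 (fun t => 0 <= t <= T) M d D ->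
  continuous_on (rectangle (-1) 1 0 T) (fun z : R * R => D m (fst z) (snd z) : C_UniformSpace).
Proof.
  intros HT HM Hd [H1 [H2 H3]].
  pose (b := fun n => M * (INR (fact n) * d ^ n)).
  assert (Hb : forall n, 0 < b n).
  { intros n. apply Rmult_lt_0_compat; [exact HM | ]. apply Rmult_lt_0_compat; [apply INR_fact_lt_0 | now apply pow_lt]. }
  assert (A : forall z w (h B1 B2 S : R), Cmod (z - RtoC h * w)%C <= B2 * h ^ 2 -> Cmod w <= B1 -> Rabs h <= S -> 0 < B2 ->
     Cmod z <= (B1 + B2 * S) * Rabs h).
  { intros z w h B1 B2 S Hz Hw Hh HB. replace z with ((z - RtoC h * w) + RtoC h * w)%C by ring.
    eapply Rle_trans; [apply Cmod_triangle | ]. rewrite Cmod_mult, Cmod_R.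
    assert (Hp := Rabs_pos h). rewrite <- pow2_abs in Hz.
    assert (Rabs h * Cmod w <= Rabs h * B1) by now apply Rmult_le_compat_l.
    assert (B2 * Rabs h ^ 2 <= B2 * S * Rabs h).
    { replace (B2 * Rabs h ^ 2) with (B2 * Rabs h * Rabs h) by ring. apply Rmult_le_compat_r; [exact Hp | ].
      apply Rmult_le_compat_l; lra. }
    lra. }
  set (L1 := b (S m) + b (m + 2)%nat * 2). set (L2 := b (m + 2)%nat + b (m + 4)%nat * T).
  assert (PL1 : 0 < L1) by (unfold L1; generalize (Hb (S m)) (Hb (m + 2)%nat); lra).
  assert (PL2 : 0 < L2).
  { unfold L2. assert (0 < b (m + 4)%nat * T) by (apply Rmult_lt_0_compat; auto). generalize (Hb (m + 2)%nat); lra. }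
  apply (continuous_on_lipschitz _ _ _ _ (L1 + L2)); [lra | ].
  intros x t x' t' [Hx Ht] [Hx' Ht']. unfold segment in *; simpl in *.
  assert (Ax : Rabs x <= 1) by (apply Rabs_le; lra). assert (Ax' : Rabs x' <= 1) by (apply Rabs_le; lra).
  replace (D m x' t' - D m x t)%C with ((D m x' t' - D m x t') + (D m x t' - D m x t))%C by ring.
  eapply Rle_trans; [apply Cmod_triangle | ].
  assert (B1 : Cmod (D m x' t' - D m x t') <= L1 * Rabs (x' - x)).
  { apply (A _ (D (S m) x t')); [now apply H2 | now apply H1 | apply Rabs_le; lra | apply Hb]. }
  assert (B2 : Cmod (D m x t' - D m x t) <= L2 * Rabs (t' - t)).
  { apply (A _ (D (m + 2)%nat x t)); [now apply H3 | now apply H1 | apply Rabs_le; lra | apply Hb]. }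
  assert (Q1 := Rabs_pos (x' - x)). assert (Q2 := Rabs_pos (t' - t)).
  assert (0 <= L1 * Rabs (t' - t)) by (apply Rmult_le_pos; lra).
  assert (0 <= L2 * Rabs (x' - x)) by (apply Rmult_le_pos; lra). lra.
Qed.

Lemma segment_Rabs x : segment (-1) 1 x -> Rabs x <= 1.
Proof. intros H. apply Rabs_le. unfold segment in H. lra. Qed.

Lemma heat_jet_Gevrey2 T M d D : 0 < T -> 0 < M -> 0 < d -> heat_jet 1 (fun t => 0 <= t <= T) M d D ->
  Gevrey2 1 2 (-1) 1 0 T (D 0%nat).
Proof.
  intros HT HM Hd HD. exists (fun p q => D (p + 2 * q)%nat). split; [split; [ | split] | ].
  - reflexivity.
  - intros p q x t [Hx Ht]. simpl in Hx, Ht. destruct HD as [H1 [H2 H3]]. split.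
    + apply (is_derive_within_quadratic _ _ _ _ (M * (INR (fact (p + 2 * q + 2)) * d ^ (p + 2 * q + 2)))); [exact Hx | ].
      intros y Hy. apply H2; auto using segment_Rabs.
    + replace (p + 2 * S q)%nat with (p + 2 * q + 2)%nat by lia.
      apply (is_derive_within_quadratic _ _ _ _ (M * (INR (fact (p + 2 * q + 4)) * d ^ (p + 2 * q + 4)))); [exact Ht | ].
      intros y Hy. apply H3; auto using segment_Rabs.
  - intros p q. now apply (heat_jet_continuous_on T M d).
  - exists M, (/ (2 * d)), (/ (16 * d ^ 2)).
    assert (0 < d ^ 2) by now apply pow_lt.
    split; [exact HM | ]. split; [apply Rinv_0_lt_compat; lra | ]. split; [apply Rinv_0_lt_compat; lra | ].
    intros p q x t [Hx Ht]. simpl in Hx, Ht.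
    eapply Rle_trans; [apply HD; [now apply segment_Rabs | exact Ht] | ].
    apply Rmult_le_compat_l; [lra | ]. rewrite fact_pow_1, fact_pow_2, !pow_inv.
    eapply Rle_trans; [now apply gevrey_fact_bound | ]. right. field.
    split; apply pow_nonzero; lra.
Qed.

Lemma heat_jet_boundary_Gevrey T M d D alpha beta x : 0 < M -> 0 < d -> heat_jet 1 (fun t => 0 <= t <= T) M d D ->
  Rabs x <= 1 -> Gevrey 2 0 T (fun t => RtoC alpha * D 0%nat x t + RtoC beta * D 1%nat x t)%C.
Proof.
  intros HM Hd [H1 [H2 H3]] Hx.
  exists (fun p t => RtoC alpha * D (2 * p)%nat x t + RtoC beta * D (1 + 2 * p)%nat x t)%C. split; [split | ].
  - reflexivity.
  - intros p t Ht.
    apply (is_derive_within_quadratic _ _ _ _ (Rabs alpha * (M * (INR (fact (2 * p + 4)) * d ^ (2 * p + 4))) +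
      Rabs beta * (M * (INR (fact (1 + 2 * p + 4)) * d ^ (1 + 2 * p + 4))))); [exact Ht | ].
    intros y Hy.
    replace (2 * S p)%nat with (2 * p + 2)%nat by lia. replace (1 + (2 * p + 2))%nat with (1 + 2 * p + 2)%nat by lia.
    match goal with |- Cmod ?z <= _ => replace z with
      (RtoC alpha * (D (2 * p)%nat x y - D (2 * p)%nat x t - RtoC (y - t) * D (2 * p + 2)%nat x t) +
       RtoC beta * (D (1 + 2 * p)%nat x y - D (1 + 2 * p)%nat x t - RtoC (y - t) * D (1 + 2 * p + 2)%nat x t))%C by ring end.
    eapply Rle_trans; [apply Cmod_triangle | ]. rewrite !Cmod_mult, !Cmod_R, Rmult_plus_distr_r, !(Rmult_assoc (Rabs _)).
    apply Rplus_le_compat; apply Rmult_le_compat_l; try apply Rabs_pos; apply H3; auto.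
  (* The factor [2 d] comes from [gevrey_fact_bound] with one space derivative; the term 1 keeps the
     constant positive. *)
  - exists (M * (Rabs alpha + Rabs beta * (2 * d) + 1)), (/ (16 * d ^ 2)).
    assert (Ha := Rabs_pos alpha). assert (Hb := Rabs_pos beta).
    assert (Hbd : 0 <= Rabs beta * (2 * d)) by (apply Rmult_le_pos; lra).
    assert (0 < d ^ 2) by now apply pow_lt.
    split; [apply Rmult_lt_0_compat; lra | ]. split; [apply Rinv_0_lt_compat; lra | ].
    intros p t Ht.
    eapply Rle_trans; [apply Cmod_triangle | ]. rewrite !Cmod_mult, !Cmod_R, fact_pow_2, pow_inv.
    set (E := INR (fact p) ^ 2 * (16 * d ^ 2) ^ p).
    replace (INR (fact p) ^ 2 / / (16 * d ^ 2) ^ p) with E by (unfold E; field; apply pow_nonzero; lra).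
    assert (HE : 0 < E) by (apply Rmult_lt_0_compat; apply pow_lt; [apply INR_fact_lt_0 | lra]).
    assert (B0 := gevrey_fact_bound 0 p d Hd). assert (B1 := gevrey_fact_bound 1 p d Hd).
    change (INR (fact 0)) with 1 in B0. change (INR (fact 1)) with 1 in B1. rewrite Nat.add_0_l in B0.
    rewrite Rmult_1_l, pow_O, Rmult_1_l in B0. rewrite Rmult_1_l, pow_1 in B1. fold E in B0.
    replace (INR (fact p) ^ 2 * (2 * d * (16 * d ^ 2) ^ p)) with (2 * d * E) in B1 by (unfold E; ring).
    assert (C0 := H1 (2 * p)%nat x t Hx Ht). assert (C1 := H1 (1 + 2 * p)%nat x t Hx Ht).
    assert (C0' : Cmod (D (2 * p)%nat x t) <= M * E) by (eapply Rle_trans; [exact C0 | apply Rmult_le_compat_l; lra]).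
    assert (C1' : Cmod (D (1 + 2 * p)%nat x t) <= M * (2 * d * E)) by (eapply Rle_trans; [exact C1 | apply Rmult_le_compat_l; lra]).
    assert (S0 : Rabs alpha * Cmod (D (2 * p)%nat x t) <= Rabs alpha * (M * E)) by now apply Rmult_le_compat_l.
    assert (S1 : Rabs beta * Cmod (D (1 + 2 * p)%nat x t) <= Rabs beta * (M * (2 * d * E))) by now apply Rmult_le_compat_l.
    assert (0 < M * E) by now apply Rmult_lt_0_compat.
    replace (M * (Rabs alpha + Rabs beta * (2 * d) + 1) * E)
      with (Rabs alpha * (M * E) + Rabs beta * (M * (2 * d * E)) + M * E) by ring. lra.
Qed.

Theorem theorem3p14 :
  forall (alpha0 beta0 alpha1 beta1 T r : R) (psiT : C -> C),
  (alpha0, beta0) <> (0, 0) ->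
  (alpha1, beta1) <> (0, 0) ->
  0 < T ->
  exp (/ (2 * exp 1)) < r ->
  holomorphic_on_disk r psiT ->
  exists h0 h1 : R -> C,
    Gevrey 2 0 T h0 /\ Gevrey 2 0 T h1 /\
    exists psi : R -> R -> C,
      heat_solution alpha0 beta0 alpha1 beta1 T h0 h1 psi /\
      (forall phi : R -> R -> C,
         heat_solution alpha0 beta0 alpha1 beta1 T h0 h1 phi ->
         forall x t, rectangle (-1) 1 0 T (x, t) -> phi x t = psi x t) /\
      Gevrey2 1 2 (-1) 1 0 T psi /\
      (forall x : R, segment (-1) 1 x -> psi x T = psiT (RtoC x)).
Proof.
  intros alpha0 beta0 alpha1 beta1 T r psiT Hab0 Hab1 HT Hr Hf.
  assert (Hr1 : 1 < r).
  { apply Rlt_trans with (2 := Hr). apply Rle_lt_trans with (exp 0); [right; symmetry; apply exp_0 | ].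
    apply exp_increasing, Rinv_0_lt_compat. generalize (exp_pos 1); lra. }
  destruct (null_to_target T r psiT Hr1 Hf HT) as [M [d [D [HM [Hd [HD [HD0 HDT]]]]]]].
  (* The controls are read off as the boundary traces of the solution already built. *)
  pose (h0 := fun t => (RtoC alpha0 * D 0%nat (-1)%R t + RtoC beta0 * D 1%nat (-1)%R t)%C).
  pose (h1 := fun t => (RtoC alpha1 * D 0%nat 1%R t + RtoC beta1 * D 1%nat 1%R t)%C).
  assert (Hsol : heat_solution alpha0 beta0 alpha1 beta1 T h0 h1 (D 0%nat)).
  { split; [now apply (heat_jet_continuous_on T M d) | ].
    (* [D 2] is both the second space derivative and the time derivative: the equation is built into
       the indexing of the jet. *)
    exists (D 1%nat), (D 2%nat), (D 2%nat). assert (HD' := HD). destruct HD' as [H1 [H2 H3]].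
    split; [ | split; [ | split]].
    - intros x t Hx Ht. apply (is_derive_within_quadratic _ _ _ _ (M * (INR (fact 2) * d ^ 2))); [exact Hx | ].
      intros y Hy. apply (H2 0%nat); auto using segment_Rabs. lra.
    - intros x t Hx Ht. split; [ | split].
      + apply (is_derive_C_quadratic _ _ _ (M * (INR (fact 3) * d ^ 3)) (Rmin (1 - x) (1 + x))); [apply Rmin_pos; lra | ].
        intros y Hy. assert (L1 := Rmin_l (1 - x) (1 + x)). assert (L2 := Rmin_r (1 - x) (1 + x)).
        apply Rabs_def2 in Hy. apply (H2 1%nat); [apply Rabs_le; lra | apply Rabs_le; lra | lra].
      + apply (is_derive_C_quadratic _ _ _ (M * (INR (fact 4) * d ^ 4)) (Rmin t (T - t))); [apply Rmin_pos; lra | ].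
        intros y Hy. assert (L1 := Rmin_l t (T - t)). assert (L2 := Rmin_r t (T - t)).
        apply Rabs_def2 in Hy. apply (H3 0%nat); [apply Rabs_le; lra | lra | lra].
      + ring.
    - intros t Ht. split; reflexivity.
    - intros x Hx. apply HD0. lra. }
  exists h0, h1. split; [ | split].
  - apply (heat_jet_boundary_Gevrey T M d); auto. rewrite Rabs_left; lra.
  - apply (heat_jet_boundary_Gevrey T M d); auto. rewrite Rabs_right; lra.
  - exists (D 0%nat). split; [exact Hsol | ]. split; [ | split].
    + intros phi Hphi x t Hxt. now apply (heat_solution_unique alpha0 beta0 alpha1 beta1 T h0 h1).
    + now apply (heat_jet_Gevrey2 T M d).
    + intros x Hx. now apply HDT.
Qed.
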